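(* Let $J>0$, $h\in\mathbb{R}$, $t\ge 0$, $\alpha_0\in[-1,+1]$ and $\sigma\in\{-1,+1\}$. Then $\alpha\mapsto\gamma_t(\sigma\mid\alpha)$ is continuous at $\alpha_0$ if and only if the variational problem $\inf_{\phi:\,\phi(t)=\alpha_0} I^t(\phi)$ has a unique minimizing path or, equivalently, if and only if $\inf_{m\in[-1,+1]}C_{t,\alpha_0}(m)$ has a unique minimizing magnetization $m$.
   Context: Curie-Weiss model: for $N\in\mathbb{N}$ let $\Omega_N=\{-1,+1\}^N$, $H^N(\sigma)=-\frac{J}{2N}\sum_{i,j=1}^N\sigma_i\sigma_j-h\sum_{i=1}^N\sigma_i$, and $\mu^N(\sigma)=e^{-H^N(\sigma)}/Z^N$ ($Z^N$ normalizing). Let $\mu^N_t$ be the law at time $t$ of the continuous-time Markov chain on $\Omega_N$ started from $\mu^N$ with generator $(L_Nf)(\sigma)=\sum_{i=1}^N[f(\sigma^i)-f(\sigma)]$, where $\sigma^i$ is $\sigma$ with spin $i$ flipped (independent spin-flips at rate 1). The empirical magnetization is $m_N(\sigma)=\frac1N\sum_{i=1}^N\sigma_i\in\mathcal{M}_N=\{-1,-1+2N^{-1},\ldots,+1-2N^{-1},+1\}$. Specification kernel: for $\sigma_1\in\{-1,+1\}$ and $\alpha_{N-1}\in\mathcal{M}_{N-1}$ let $\gamma^N_t(\sigma_1\mid\alpha_{N-1})$ be the conditional $\mu^N_t$-probability that the first spin equals $\sigma_1$ given that the other $N-1$ spins form a configuration $\sigma_{N-1}$ with $m_{N-1}(\sigma_{N-1})=\alpha_{N-1}$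 (by permutation invariance it does not depend on the choice of $\sigma_{N-1}$). Define $\gamma_t(\cdot\mid\alpha)=\lim_{N\to\infty}\gamma^N_t(\cdot\mid\alpha_{N-1})$ whenever this limit exists for all sequences $(\alpha_N)_{N\in\mathbb{N}}$ with $\alpha_N\in\mathcal{M}_N$ and $\alpha_N\to\alpha$ and is independent of the sequence. ''$\alpha\mapsto\gamma_t(\sigma\mid\alpha)$ is continuous at $\alpha_0$'' means that $\alpha_0$ is a good magnetization: there is a neighborhood of $\alpha_0$ in $[-1,+1]$ on which $\gamma_t(\cdot\mid\bar\alpha)$ exists in this sense (so that in particular $\bar\alpha\mapsto\gamma_t(\cdot\mid\bar\alpha)$ is continuous at $\bar\alpha=\alpha_0$). Rate functions: $\bar H(x)=-\frac12Jx^2-hx$, $\bar I(m)=\frac{1+m}{2}\log(1+m)+\frac{1-m}{2}\log(1-m)$ (with $0\log0=0$), $I_S=\bar H+\bar I$ on $[-1,+1]$. For a càdlàg path $\phi:[0,t]\to[-1,+1]$ let $I^t(\phi)=I_S(\phi(0))+I^t_D(\phi)$ with $I^t_D(\phi)=\int_0^tL(\phi(s),\dot\phi(s))\,ds$ if $\dot\phi$ exists (i.e. $\phi$ is absolutely continuous) and $I_D^t(\phi)=\infty$ otherwise, where $$L(m,\dot m)=-\tfrac12\sqrt{4(1-m^2)+\dot m^2}+\tfrac12\dot m\log\Big(\frac{\sqrt{4(1-m^2)+\dot m^2}+\dot m}{2(1-m)}\Big)+1$$ (extended by lower semicontinuity to $m=\pm1$). Finally $C_{t,\alpha}(m)=\inf\{I^t(\phi):\phi(0)=m,\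 \phi(t)=\alpha\}$ for $m,\alpha\in[-1,+1]$. *)

(* Defs.v *)
From HB Require Import structures.
From mathcomp Require Import all_boot all_order all_algebra all_fingroup.
From mathcomp Require Import all_classical all_reals all_analysis.
Set Implicit Arguments.
Unset Strict Implicit.
Unset Printing Implicit Defensive.
Import Order.TTheory GRing.Theory Num.Theory.
Import numFieldNormedType.Exports.
Local Open Scope classical_set_scope.
Local Open Scope ring_scope.

Section Model.
Variable R : realType.

(* A spin is a boolean, with true standing for +1 and false for -1. *)
Definition spin (b : bool) : R := if b then 1 else -1.

Definition config (N : nat) := N.-tuple bool.

Definition flip N (i : 'I_N) (s : config N) : config N :=
  [tuple if j == i then ~~ tnth s j else tnth s j | j < N].

Definition magn N (s : config N) : R := N%:R^-1 * \sum_(i < N) spin (tnth s i).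

Definition magnset (N : nat) : set R :=
  [set a | exists2 k : nat, (k <= N)%N & a = -1 + 2 * k%:R / N%:R].

Definition hamiltonian (J h : R) N (s : config N) : R :=
  - (J / (2 * N%:R)) * (\sum_(i < N) \sum_(j < N) spin (tnth s i) * spin (tnth s j))
  - h * \sum_(i < N) spin (tnth s i).

Definition gibbs (J h : R) N (s : config N) : R :=
  expR (- hamiltonian J h s) / \sum_(e : config N) expR (- hamiltonian J h e).

Definition generator N (f : config N -> R) (s : config N) : R :=
  \sum_(i < N) (f (flip i s) - f s).

(* exp (t L_N), as an everywhere convergent series since L_N is a bounded
   operator; its value on the indicator of s is the transition probability of
   the Markov chain to s in time t. *)
Definition semigroup N (t : R) (f : config N -> R) (s : config N) : R :=
  limn (series (fun k : nat => t ^+ k / k`!%:R * iter k (@generator N) f s)).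

Definition law (J h t : R) N (s : config N) : R :=
  \sum_(e : config N)
    gibbs J h e * semigroup t (fun x => (x == s)%:R) e.

Definition cond_spin (J h t : R) n (b : bool) (e : config n) : R :=
  law J h t [tuple of b :: e] / \sum_(c : bool) law J h t [tuple of c :: e].

(* The specification kernel for N = n.+1 spins; a is the magnetization of the
   n spins conditioned upon.  gammaE below shows that the choice of the
   configuration is immaterial. *)
Definition gamma (J h t : R) n (b : bool) (a : R) : R :=
  if [pick e : config n | magn e == a] is Some e then cond_spin J h t b e else 0.

Definition gamma_lim (J h t : R) (b : bool) (a l : R) : Prop :=
  forall a_ : nat -> R, (forall n, (0 < n)%N -> magnset n (a_ n)) ->
    a_ n @[n --> \oo] --> a -> gamma J h t n b (a_ n) @[n --> \oo] --> l.

(* The limiting kernel exists on a neighbourhood of a0 in [-1, 1].  As the two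
   values of gamma sum to 1, it is immaterial whether existence is required
   for one or for both values of b. *)
Definition gamma_continuous_at (J h t : R) (b : bool) (a0 : R) : Prop :=
  \forall a \near a0, -1 <= a <= 1 -> exists l : R, gamma_lim J h t b a l.

(* 0 log 0 = 0 holds here because ln 0 = 0. *)
Definition Ibar (m : R) : R :=
  (1 + m) / 2 * ln (1 + m) + (1 - m) / 2 * ln (1 - m).

Definition Hbar (J h m : R) : R := - (2^-1 * J * m ^+ 2) - h * m.

Definition IS (J h m : R) : R := Hbar J h m + Ibar m.

Definition lagrangian_int (m v : R) : R :=
  - (2^-1 * Num.sqrt (4 * (1 - m ^+ 2) + v ^+ 2))
  + 2^-1 * v * ln ((Num.sqrt (4 * (1 - m ^+ 2) + v ^+ 2) + v) / (2 * (1 - m)))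
  + 1.

(* The formula on |m| < 1, extended to m = -1 and m = 1 by its lower limit from
   |m| < 1; the extension takes the value +oo for velocities pointing out of
   [-1, 1]. *)
Definition lagrangian (m v : R) : \bar R :=
  if -1 < m < 1 then (lagrangian_int m v)%:E
  else limf_einf (fun p : R * R => (lagrangian_int p.1 p.2)%:E)
         (within [set p : R * R | -1 < p.1 < 1] (nbhs (m, v))).

(* Paths on [0, t] are represented by total functions whose values outside
   [0, t] are irrelevant. *)
Definition is_path (t : R) (phi : R -> R) : Prop :=
  [/\ forall s, 0 <= s <= t -> -1 <= phi s <= 1,
      forall s, 0 <= s < t -> phi x @[x --> s^'+] --> phi s
    & forall s, 0 < s <= t -> cvg (phi x @[x --> s^'-])].

Definition abs_continuous (t : R) (phi : R -> R) : Prop :=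
  forall e : R, 0 < e -> exists2 d : R, 0 < d &
    forall (n : nat) (a b : 'I_n -> R),
      (forall i, 0 <= a i /\ a i <= b i /\ b i <= t) ->
      trivIset setT (fun i => [set x : R | a i < x < b i]) ->
      \sum_(i < n) (b i - a i) < d ->
      \sum_(i < n) `|phi (b i) - phi (a i)| < e.

(* The derivative of an absolutely continuous path exists at almost every
   point of ]0, t[, which is all that the integral depends on. *)
Definition ID (t : R) (phi : R -> R) : \bar R :=
  if `[< abs_continuous t phi >]
  then (\int[lebesgue_measure]_(s in `[0%R, t]) lagrangian (phi s) (derive1 phi s))%E
  else +oo%E.

Definition rate (J h t : R) (phi : R -> R) : \bar R :=
  ((IS J h (phi 0))%:E + ID t phi)%E.

Definition paths_to (t a : R) : set (R -> R) :=
  [set phi | is_path t phi /\ phi t = a].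

Definition cost (J h t a m : R) : \bar R :=
  ereal_inf (rate J h t @` (paths_to t a `&` [set phi | phi 0 = m])).

Definition path_minimizer (J h t a : R) (phi : R -> R) : Prop :=
  paths_to t a phi /\ rate J h t phi = ereal_inf (rate J h t @` paths_to t a).

Definition unique_path_minimizer (J h t a : R) : Prop :=
  exists2 phi : R -> R, path_minimizer J h t a phi &
    forall psi, path_minimizer J h t a psi ->
      forall s, 0 <= s <= t -> psi s = phi s.

Definition magn_minimizer (J h t a m : R) : Prop :=
  -1 <= m <= 1 /\
  cost J h t a m = ereal_inf (cost J h t a @` [set m | -1 <= m <= 1]).

End Model.

Section Exchangeability.
Variables (R : realType) (J h t : R).

Let act N (p : 'S_N) (s : config N) : config N := [tuple tnth s (p i) | i < N].

Let act_bij N (p : 'S_N) : bijective (@act N p).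
Proof.
exists (act (p^-1)%g) => s; apply: eq_from_tnth => i.
  by rewrite !tnth_mktuple permKV.
by rewrite !tnth_mktuple permK.
Qed.

Let act_flip N (p : 'S_N) i (s : config N) :
  act p (flip (p i) s) = flip i (act p s).
Proof.
apply: eq_from_tnth => j.
by rewrite !tnth_mktuple (inj_eq perm_inj).
Qed.

Let act_sum N (p : 'S_N) (s : config N) :
  \sum_(i < N) spin R (tnth (act p s) i) = \sum_(i < N) spin R (tnth s i).
Proof.
rewrite [RHS](reindex_inj (@perm_inj _ p)) /=.
by apply: eq_bigr => i _; rewrite tnth_mktuple.
Qed.

Let act_gibbs N (p : 'S_N) (s : config N) : gibbs J h (act p s) = gibbs J h s.
Proof.
rewrite /gibbs; congr (expR (- _) / _); rewrite /hamiltonian act_sum.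
by congr (_ * _ - _); rewrite -!big_distrlr /= act_sum.
Qed.

Let act_generator N (p : 'S_N) (f : config N -> R) k s :
  iter k (@generator R N) f (act p s) = iter k (@generator R N) (f \o act p) s.
Proof.
elim: k s => [//|k IH] s; rewrite !iterS /generator.
rewrite [RHS](reindex_inj (@perm_inj _ p)) /=.
by apply: eq_bigr => i _; rewrite -!IH act_flip.
Qed.

Let act_law N (p : 'S_N) (s : config N) : law J h t (act p s) = law J h t s.
Proof.
rewrite /law (reindex (act p)) /=; last exact/onW_bij/act_bij.
apply: eq_bigr => e _; rewrite act_gibbs; congr (_ * _).
rewrite /semigroup; congr (limn (series _)); apply/funext => k.
rewrite act_generator.
have -> // : (fun x : config N => (x == act p s)%:R : R) \o act p =
             (fun x => (x == s)%:R).
by apply/funext => x /=; rewrite (inj_eq (bij_inj (act_bij p))).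
Qed.

Let sum_spin N (s : config N) :
  \sum_(i < N) spin R (tnth s i) = (count_mem true s)%:R *+ 2 - N%:R.
Proof.
rewrite -sum1_count -(big_tuple _ _ s xpredT (spin R)) natr_sum -sumrMnl.
rewrite -[X in _ - X%:R](size_tuple s) -sum1_size natr_sum.
rewrite (big_mkcond (pred1 true)) -sumrB /=.
by apply: eq_bigr => -[] _; rewrite /= ?mulr2n ?addrK ?sub0r.
Qed.

Lemma gammaE n b (e : config n) :
  gamma J h t n b (magn R e) = cond_spin J h t b e.
Proof.
rewrite /gamma; case: pickP => [e' /eqP|/(_ e)]; last by rewrite eqxx.
have [n0|n0] := eqVneq n 0%N; first by subst n; rewrite (tuple0 e) (tuple0 e').
rewrite /magn => /(mulfI _); rewrite invr_eq0 pnatr_eq0 => /(_ n0).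
rewrite !sum_spin => /addIr/eqP; rewrite eqrMn2r //= eqr_nat => /eqP ce.
have lawE c : law J h t [tuple of c :: e'] = law J h t [tuple of c :: e].
  have /tuple_permP[p pE] : perm_eq [tuple of c :: e'] [tuple of c :: e].
    rewrite /= perm_cons; apply/seq.permP => q.
    have cq (u : seq bool) : count q u =
        (q true * count_mem true u + q false * (size u - count_mem true u))%N.
      have -> : (size u - count_mem true u)%N = count_mem false u.
        rewrite -(count_predC (pred1 true)) addKn.
        by apply: eq_count => -[].
      by elim: u => [|[] v IH] /=; rewrite ?muln0 // IH;
        case: (q true); case: (q false); rewrite /= ?mul0n ?mul1n ?add0n //
          addnCA.
    by rewrite !cq ce !size_tuple.
  by rewrite -[RHS](act_law p); congr (law _ _ _ _); apply: val_inj.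
by rewrite /cond_spin lawE; congr (_ / _); apply: eq_bigr.
Qed.

End Exchangeability.

(* Main.v *)
Require Import Defs.
From HB Require Import structures.
From mathcomp Require Import all_boot all_order all_algebra.
From mathcomp Require Import all_classical all_reals all_analysis.
From mathcomp Require Import measurable_realfun ring lra.
Set Implicit Arguments.
Unset Strict Implicit.
Unset Printing Implicit Defensive.
Import Order.TTheory GRing.Theory Num.Theory.
Import numFieldNormedType.Exports.
Local Open Scope classical_set_scope.
Local Open Scope ring_scope.

(** Both sides of the equivalence are properties of one function of a real
    variable. Put e = exp (- 2 t), so that a spin started at s' is found at s
    after time t with probability (1 + e s s') / 2, and let
    W_c(y) = (1 + e c) / 2 exp y + (1 - e c) / 2 exp (- y) for c = 1 and -1:
    the weight of ending at c after starting from a spin in a field y. With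

      Phi_a(x) = - J x^2 / 2 + (1 + a) / 2 ln W_+(J x + h)
                             + (1 - a) / 2 ln W_-(J x + h),

    a magnetization minimizes the cost of reaching a exactly when it maximizes
    Phi_a, minimizing paths correspond to maximizers, and the limiting kernel
    exists near a0 exactly when Phi_a0 has a single maximizer.

    Paths. The Lagrangian is the Legendre transform of the Hamiltonian of the
    flip dynamics. The Hamilton-Jacobi equation has solutions that are affine
    in the magnetization, namely the logarithms of solutions of the backward
    equation of one spin. Along an absolutely continuous path such a solution
    is absolutely continuous, and by the Fenchel inequality it grows no faster
    than the action, so that the action is at least its increment (action_ge).
    Taking the solution adapted to the initial slope J phi(0) + h, and adding
    the Gibbs variational principle at time 0, gives
    rate phi >= Ibar a - Phi_a(phi 0) (rate_ge). For a maximizer x of Phi_a the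
    equation Phi_a'(x) = 0 says that an explicit combination of exponentials
    starts at x, and this path attains the bound (opt_action). Conversely,
    equality forces the optimal speed at almost every time, hence a linear
    differential equation that determines the path (action_eq_speed,
    opt_path_unique).

    Kernel. The characters of the hypercube diagonalise the generator, which
    gives the transition probabilities in product form, and a Gaussian integral
    linearises the interaction. The kernel becomes a ratio of integrals against
    exp (n Phi_a(x)) (gamma_ratio), and Laplace's method shows that it tends to
    W_b / (W_+ + W_-) at the maximizer whenever this is unique, uniformly for
    nearby conditionings (gamma_concentration).

    Degenerate magnetizations. Call a degenerate when Phi_a has two maximizers.
    The critical points of Phi_a solve crit_level x = a e, and since maximizers
    increase with a, distinct degenerate magnetizations need distinct
    inflection points of crit_level between their maximizers. There are at most
    three such points, so degenerate magnetizations are isolated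
    (degenerate_isolated) and every non-degenerate one is good. At a degenerate
    a0 inside ]-1, 1[ the maximizer jumps, hence the kernel has different
    one-sided limits. At a0 = 1 or -1 only one side is available; but there
    degeneracy forces the bias coming from the aligned configuration to cancel
    the external field, so that along the constant sequence a_n = a0 the kernel
    is known exactly by spin-flip symmetry, and it differs from the one-sided
    limit (degenerate_gamma_lim).

    At t = 0 there is nothing to choose: a path is a point, and no
    magnetization is degenerate. *)

(** * Absolutely continuous functions and families of intervals *)

Section ac.
Variable R : realType.
Implicit Types (J : seq (R * R)) (p q : R * R) (f F : R -> R).

(** Intervals are pairs of end points. Touching and degenerate intervals are
    allowed in a family: this makes families stable under clipping, and
    degenerate members contribute neither length nor oscillation. *)
Definition apart (p q : R * R) := (p.2 <= q.1) || (q.2 <= p.1).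
Definition itv_family (J : seq (R * R)) :=
  all (fun p => p.1 <= p.2) J && pairwise apart J.
Definition total_length (J : seq (R * R)) := \sum_(p <- J) (p.2 - p.1).
Definition oscillation (f : R -> R) (J : seq (R * R)) :=
  \sum_(p <- J) `|f p.2 - f p.1|.
Definition ac (f : R -> R) := forall e, 0 < e -> exists2 d, 0 < d &
  forall J, itv_family J -> total_length J < d -> oscillation f J < e.

(** Composition with the projection onto [0, t] turns absolute continuity on
    [0, t] into absolute continuity on the whole line. *)
Definition clamp (t s : R) := Num.max 0 (Num.min s t).

Lemma clamp_homo t : {homo clamp t : x y / x <= y}.
Proof.
move=> x y xy; rewrite /clamp.
by rewrite ge_max le_max lexx /= le_max le_min !ge_min xy lexx !orbT.
Qed.

Lemma clamp_itv t s : 0 <= t -> 0 <= clamp t s <= t.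
Proof. by move=> t0; rewrite /clamp le_max lexx /= ge_max t0 ge_min lexx orbT. Qed.

Lemma clamp_id t s : 0 <= s <= t -> clamp t s = s.
Proof. by move=> /andP[s0 st]; rewrite /clamp min_l// max_r. Qed.

Lemma clampK t s : 0 <= t -> clamp t (clamp t s) = clamp t s.
Proof. by move=> t0; rewrite clamp_id// clamp_itv. Qed.

Lemma clamp_contract t x y : x <= y -> clamp t y - clamp t x <= y - x.
Proof.
move=> xy; rewrite /clamp !maxElt !minElt.
by case: (ltP y t) => ?; case: (ltP x t) => ?; repeat case: ltP => ?; lra.
Qed.

Lemma family_nth J i j : itv_family J -> (i < size J)%N -> (j < size J)%N ->
  i != j -> apart (nth (0, 0) J i) (nth (0, 0) J j).
Proof.
move=> /andP[_ /(pairwiseP (0, 0)) pJ] iJ jJ.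
rewrite neq_ltn => /orP[ij|ji]; first exact: pJ.
by rewrite /apart orbC; apply: pJ.
Qed.

Lemma ac_clamp t phi : 0 <= t -> abs_continuous t phi -> ac (phi \o clamp t).
Proof.
move=> t0 acphi e /acphi[d d0 H]; exists d => // J fJ lJ.
pose x (i : 'I_(size J)) := nth (0, 0) J i.
have Jx (i : 'I_(size J)) : (x i).1 <= (x i).2.
  by case/andP: fJ => /allP + _; apply; exact: mem_nth.
have := H (size J) (fun i => clamp t (x i).1) (fun i => clamp t (x i).2).
rewrite /oscillation (big_nth (0, 0)) big_mkord; apply.
- move=> i; split; first by case/andP: (clamp_itv (x i).1 t0).
  split; last by case/andP: (clamp_itv (x i).2 t0).
  exact/clamp_homo/Jx.
- move=> i j _ _ [z /= [/andP[a b] /andP[c d']]].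
  apply/eqP/negPn/negP => ij.
  have /orP[/(clamp_homo t)|/(clamp_homo t)] :=
    family_nth fJ (ltn_ord i) (ltn_ord j) ij.
    by rewrite -/(x i) -/(x j); lra.
  by rewrite -/(x i) -/(x j); lra.
- apply: le_lt_trans lJ.
  rewrite /total_length (big_nth (0, 0)) big_mkord; apply: ler_sum => i _.
  exact/clamp_contract/Jx.
Qed.

Lemma ac_small_step f e : ac f -> 0 < e -> exists2 d, 0 < d &
  forall x y, `|x - y| < d -> `|f x - f y| < e.
Proof.
move=> acf /acf[d d0 H]; exists d => // x y.
wlog yx : x y / y <= x => [W|].
  case: (leP y x) => [/W//|/ltW xy]; rewrite distrC => /W-/(_ xy).
  by rewrite distrC.
rewrite ger0_norm ?subr_ge0// => xyd.
have := H [:: (y, x)]; rewrite /itv_family /total_length /oscillation !big_seq1/=.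
by rewrite yx; apply.
Qed.

Lemma ac_continuous f : ac f -> continuous f.
Proof.
move=> acf x; apply/cvgrPdist_lt => e e0.
have [d d0 H] := ac_small_step acf e0.
near=> y; apply: H; near: y.
by apply/nbhs_ballP; exists d.
Unshelve. all: by end_near. Qed.

Lemma acD f g : ac f -> ac g -> ac (f \+ g).
Proof.
move=> acf acg e e0.
have e2 : 0 < e / 2 by lra.
have [d d0 Hf] := acf _ e2; have [d' d'0 Hg] := acg _ e2.
exists (Num.min d d') => [|J fJ]; first by rewrite lt_min d0.
rewrite lt_min => /andP[/(Hf _ fJ) f1 /(Hg _ fJ) g1].
apply: (@le_lt_trans _ _ (oscillation f J + oscillation g J)); last by lra.
rewrite /oscillation -big_split/=; apply: ler_sum => p _.
by rewrite opprD addrACA ler_normD.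
Qed.

Lemma acN f : ac f -> ac (\- f).
Proof.
move=> acf e /acf[d d0 H]; exists d => // J fJ lJ.
rewrite (_ : oscillation _ _ = oscillation f J) ?H//.
by apply: eq_bigr => p _; rewrite /= -opprD normrN.
Qed.

(** An interval is added to a family by clipping the members to the half-lines
    on its left and on its right. Clipping is monotone, hence keeps the members
    apart, and the total length does not grow. *)
Lemma disjoint_cover (I : seq (R * R)) : all (fun p => p.1 <= p.2) I ->
  exists J, [/\ itv_family J, total_length J <= total_length I &
    forall x, has (fun p => p.1 < x <= p.2) I ->
              has (fun p => p.1 < x <= p.2) J].
Proof.
elim: I => [_|p I IH /= /andP[p12 /IH[J [/andP[oJ aJ] lJ cJ]]]].
  by exists [::]; split.
pose l q := (Num.min q.1 p.1, Num.min q.2 p.1).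
pose r q := (Num.max q.1 p.2, Num.max q.2 p.2).
exists (p :: map l J ++ map r J); split.
- apply/andP; split; rewrite /= ?p12 /=.
    rewrite all_cat !all_map; apply/andP.
    split; apply: sub_all oJ => q /= q12.
      by rewrite le_min !ge_min q12 lexx orbT.
    by rewrite ge_max !le_max q12 lexx orbT.
  rewrite all_cat !all_map pairwise_cat !pairwise_map; apply/and3P; split.
  + apply/andP; split; apply/allP => q _ /=; rewrite /apart /=.
      by rewrite ge_min lexx !orbT.
    by rewrite le_max lexx !orbT.
  + apply/allrelP => _ _ /mapP[q _ ->] /mapP[q' _ ->].
    by apply/orP; left; rewrite (@le_trans _ _ p.1)//= ?ge_min ?le_max ?lexx ?p12 ?orbT.
  + apply/andP; split; apply: sub_pairwise aJ => q q'; rewrite /apart /=.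
      by case/orP => H; apply/orP; [left|right]; rewrite le_min !ge_min H lexx orbT.
    by case/orP => H; apply/orP; [left|right]; rewrite ge_max !le_max H lexx orbT.
- move: lJ; rewrite /total_length !big_cons big_cat/= !big_map lerD2l.
  apply: le_trans; rewrite -big_split/= big_seq [X in _ <= X]big_seq.
  apply: ler_sum => q /(allP oJ) q12.
  rewrite !minElt !maxElt.
  case: (ltP q.1 p.1) => ?; case: (ltP q.2 p.1) => ?;
  case: (ltP q.1 p.2) => ?; case: (ltP q.2 p.2) => ?; lra.
- move=> x /=; rewrite has_cat !has_map => /orP[->//|/cJ/hasP[q qJ /andP[qx xq]]].
  have [px|xp] := ltP p.1 x; last first.
    apply/orP; right; apply/orP; left; apply/hasP; exists q => //=.
    by rewrite gt_min le_min qx xq xp.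
  have [xp|px'] := leP x p.2; first by [].
  apply/orP; right; apply/orP; right; apply/hasP; exists q => //=.
  by rewrite gt_max le_max qx xq px'.
Qed.

(** A partition gives a family with the variation as oscillation, which brings
    absolute continuity to bear on the total variation. *)
Lemma partition_family f a b s : itv_partition a b s ->
  [/\ itv_family (zip (a :: s) s), total_length (zip (a :: s) s) = b - a,
      oscillation f (zip (a :: s) s) = variation a b f s &
      forall q, q \in zip (a :: s) s -> a <= q.1 /\ q.2 <= b].
Proof.
move=> abs; rewrite variation_zip//; case: abs => + /eqP.
rewrite /itv_family /total_length /oscillation.
elim: s a b => [a b _ /= ->|x s IH a b /= /andP[ax xs] sb].
  by rewrite !big_nil subrr; split.
have [/andP[oJ aJ] lJ fJ HJ] := IH _ _ xs sb.
have xb : x <= b.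
  move: sb xs; case: (s) => [/= <-//|y s' sb].
  move=> /order_path_min-/(_ lt_trans)/allP H.
  by apply/ltW/H; rewrite -sb; exact: (mem_last y s').
split.
- rewrite /= oJ aJ (ltW ax) !andbT /=; apply/allP => q /HJ[xq _].
  by rewrite /apart xq.
- by rewrite /= big_cons lJ /=; lra.
- by rewrite /= !big_cons fJ.
- move=> q; rewrite inE => /orP[/eqP ->//|/HJ[xq qb]]; split => //.
  exact: le_trans (ltW ax) xq.
Qed.

End ac.

(** * Total variation of an absolutely continuous function *)

Section tv.
Variable R : realType.
Implicit Types (J : seq (R * R)) (p q : R * R) (f F : R -> R).

(** On steps shorter than the threshold for oscillation 1 the variation is at
    most 1, and finitely many steps reach any point. *)
Lemma ac_total_variation_fin f b : ac f -> 0 <= b ->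
  total_variation 0 b f \is a fin_num.
Proof.
move=> acf b0; have [d d0 H] := acf 1 ltr01.
have small x y : x <= y -> y - x < d -> (total_variation x y f <= 1)%E.
  move=> xy yxd; apply: ge_ereal_sup => _ [_ [s sxy <-] <-].
  have [fs ls <- _] := partition_family f sxy.
  by rewrite lee_fin ltW// H// ls.
have fin n : total_variation 0 (n%:R * (d / 2)) f \is a fin_num.
  elim: n => [|n IH]; first by rewrite mul0r total_variationxx.
  have n0 : 0 <= n%:R * (d / 2) by rewrite mulr_ge0// divr_ge0// ltW.
  have nn : n%:R * (d / 2) <= n.+1%:R * (d / 2).
    by rewrite ler_wpM2r ?ler_nat// divr_ge0// ltW.
  rewrite (total_variationD _ n0 nn) fin_numD IH/=.
  rewrite ge0_fin_numE ?total_variation_ge0//.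
  apply: le_lt_trans (small _ _ nn _) (ltry _).
  by rewrite -mulrBl -natrB// subSnn mul1r; lra.
have d2 : 0 < d / 2 by lra.
pose n := (Num.truncn (b / (d / 2))).+1.
have bn : b <= n%:R * (d / 2).
  by rewrite -ler_pdivrMr// ltW// Num.Theory.truncnS_gt.
have := fin n; rewrite (total_variationD f b0 bn) fin_numD => /andP[]//.
Qed.

(** Both this function and its difference with f are monotone and absolutely
    continuous: the Jordan decomposition. *)
Definition tv (t : R) (f : R -> R) (x : R) := fine (total_variation 0 (clamp t x) f).

Variables (t : R) (f : R -> R).
Hypotheses (t0 : 0 <= t) (acf : ac f).

Lemma tvB x y : x <= y ->
  (tv t f y - tv t f x)%:E = total_variation (clamp t x) (clamp t y) f.
Proof.
move=> xy; have [/andP[x0 _] /andP[y0 _]] := (clamp_itv x t0, clamp_itv y t0).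
have cxy := clamp_homo t xy.
have D := total_variationD f x0 cxy.
have finx := ac_total_variation_fin acf x0.
have finy := ac_total_variation_fin acf y0.
rewrite EFinB /tv !fineK// D addeAC subee// add0e//.
Qed.

Lemma tv_homo : {homo tv t f : x y / x <= y}.
Proof.
move=> x y xy; rewrite -subr_ge0 -lee_fin tvB// total_variation_ge0//.
exact: clamp_homo.
Qed.

Lemma tv_ge x y : x <= y ->
  `|f (clamp t y) - f (clamp t x)| <= tv t f y - tv t f x.
Proof.
by move=> xy; rewrite -lee_fin tvB// total_variation_ge// clamp_homo.
Qed.

(** Each increment of the variation is almost attained by a partition, and the
    partitions of disjoint intervals together form a family. *)
Lemma tv_family J e : itv_family J -> 0 < e -> exists J',
  [/\ itv_family J', total_length J' <= total_length J,
   \sum_(p <- J) (tv t f p.2 - tv t f p.1) <= oscillation f J' + e &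
   forall q, q \in J' -> exists2 p, p \in J &
     clamp t p.1 <= q.1 /\ q.2 <= clamp t p.2].
Proof.
elim: J e => [|p J IH] e.
  by exists [::]; rewrite /oscillation /total_length !big_nil; split => //; lra.
rewrite /itv_family /= => /andP[/andP[p12 oJ] /andP[pJ aJ]] e0.
have [||J' [/andP[oJ' aJ'] lJ' fJ' sJ']] := IH (e / 2); first by rewrite /itv_family oJ.
  lra.
have : total_variation (clamp t p.1) (clamp t p.2) f \is a fin_num by rewrite -tvB.
have e2 : 0 < e / 2 by lra.
move=> /(ub_ereal_sup_adherent e2)[_ [_ [s ps <-] <-]].
rewrite -/(total_variation _ _ _) -tvB// -EFinB lte_fin => sE.
have [/andP[os as_] ls fs ss] := partition_family f ps.
exists (zip (clamp t p.1 :: s) s ++ J'); split.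
- rewrite /itv_family all_cat os oJ' pairwise_cat as_ aJ' !andbT /=.
  apply/allrelP => q q' qs q's.
  have [q1 q2] := ss _ qs; have [p' p'J [p'q' q'p']] := sJ' _ q's.
  have /orP[/(clamp_homo t) h|/(clamp_homo t) h] := allP pJ _ p'J; apply/orP.
    by left; apply: le_trans q2 (le_trans h _).
  by right; apply: le_trans q'p' (le_trans h _).
- rewrite /total_length big_cat big_cons/=; apply: lerD => //.
  by rewrite [X in X <= _]ls clamp_contract.
- rewrite /oscillation big_cat big_cons/=.
  move: fJ' fs; rewrite /oscillation => fJ' ->; lra.
- move=> q; rewrite mem_cat => /orP[/ss qs|/sJ'[p' p'J h]].
    by exists p => //; rewrite inE eqxx.
  by exists p' => //; rewrite inE p'J orbT.
Qed.

Lemma tv_ac : ac (tv t f).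
Proof.
move=> e e0; have e2 : 0 < e / 2 by lra.
have [d d0 H] := acf e2; exists d => // J fJ lJ.
have [J' [fJ' lJ' sJ' _]] := tv_family fJ e2.
apply: (@le_lt_trans _ _ (oscillation f J' + e / 2)); last first.
  by have := H J' fJ' (le_lt_trans lJ' lJ); lra.
apply: le_trans sJ'; rewrite /oscillation big_seq [X in _ <= X]big_seq.
apply: ler_sum => p pJ; rewrite ger0_norm// subr_ge0 tv_homo//.
by case/andP: fJ => /allP + _; exact.
Qed.

End tv.

(** * Stieltjes measures and densities *)

Section density.
Variable R : realType.
Notation mu := (@lebesgue_measure R).
Implicit Types (J : seq (R * R)) (p q : R * R) (f F : R -> R).

Definition covered J : set R := [set x | has (fun p => p.1 < x <= p.2) J].

Lemma covered_nil : covered [::] = set0.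
Proof. by apply/seteqP; split. Qed.

Lemma covered_cons p J : covered (p :: J) = `]p.1, p.2]%classic `|` covered J.
Proof. by apply/seteqP; split => x; rewrite /covered/= in_itv/= => /orP. Qed.

Lemma measurable_covered J : measurable (covered J).
Proof.
by elim: J => [|p J IH]; rewrite ?covered_nil// covered_cons; apply: measurableU.
Qed.

Section stieltjes.
Variable F : cumulative R R.
Let nu : {measure set (measurableTypeR R) -> \bar R} := lebesgue_stieltjes_measure F.

Lemma stieltjes_itv a b : a <= b -> nu `]a, b]%classic = (F b - F a)%:E.
Proof.
move=> ab; rewrite /nu/= /lebesgue_stieltjes_measure /measure_extension.
by rewrite measurable_mu_extE/= ?wlength_itv_bnd//; exact: is_ocitv.
Qed.

Lemma stieltjes_covered J : all (fun p => p.1 <= p.2) J ->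
  (nu (covered J) <= (oscillation F J)%:E)%E.
Proof.
elim: J => [_|p J IH /= /andP[p12 /IH{}IH]].
  by rewrite covered_nil measure0 lee_fin sumr_ge0.
rewrite covered_cons /oscillation big_cons EFinD.
apply: (@le_trans _ _ (nu `]p.1, p.2]%classic + nu (covered J))%E).
  by apply: measureU2 => //; exact: measurable_covered.
apply: leeD => //; rewrite stieltjes_itv// lee_fin.
exact: ler_norm.
Qed.

(** A null set is covered by countably many intervals of small total length.
    Finitely many of them can be made disjoint without growing in length, so
    that absolute continuity bounds their Stieltjes measure; continuity of the
    measure from below reaches the whole cover. *)
Lemma ac_stieltjes_dominated : ac F -> nu `<< mu.
Proof.
move=> acF; apply/null_content_dominatesP => A mA muA0.
apply/eqP; rewrite eq_le measure_ge0 andbT; apply/lee_addgt0Pr => e e0.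
rewrite add0e; have [d d0 H] := acF e e0.
have : (mu A < d%:E)%E by rewrite muA0 lte_fin.
move=> /ereal_inf_lt [_ [I [mI AI] <-] Id].
have /choice[p pI] : forall k, exists p : R * R, [/\ p.1 <= p.2,
    I k `<=` `]p.1, p.2]%classic & wlength idfun (I k) = (p.2 - p.1)%:E].
  move=> k; have /ocitvP[->|[x x12 ->]] := mI k.
    by exists (0, 0); rewrite wlength0 subrr; split.
  by exists x; rewrite wlength_itv_bnd ?ltW//; split => //; exact: ltW.
pose U n := covered (map p (iota 0 n)).
have Ule n : (nu (U n) <= e%:E)%E.
  have := @disjoint_cover _ (map p (iota 0 n)); case.
    by rewrite all_map; apply/allP => k _ /=; have [] := pI k.
  move=> J [fJ lJ cJ].
  apply: (@le_trans _ _ (nu (covered J))).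
    apply: le_measure; rewrite ?inE; try exact: measurable_covered.
    exact: cJ.
  apply: le_trans (stieltjes_covered _) _; first by case/andP: fJ.
  rewrite lee_fin; apply/ltW/H => //; apply: le_lt_trans lJ _.
  rewrite -lte_fin; apply: le_lt_trans Id.
  rewrite /total_length big_map -sumEFin.
  under eq_bigr => k _ do have [_ _ <-] := pI k.
  rewrite -[X in iota 0 X]subn0 -/(index_iota 0 n).
  by apply: nneseries_lim_ge => k _ _; exact: wlength_ge0.
have cvgU : nu (U n) @[n --> \oo] --> nu (\bigcup_n U n).
  apply: nondecreasing_cvg_mu => [n||m n mn].
  - exact: measurable_covered.
  - by apply: bigcup_measurable => n _; exact: measurable_covered.
  - apply/subsetPset => x /hasP[q /mapP[k kn ->] h]; apply/hasP; exists (p k) => //.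
    apply: map_f; move: kn; rewrite !mem_iota !add0n /= => /leq_trans; exact.
apply: (@le_trans _ _ (nu (\bigcup_n U n))).
  apply: le_measure; rewrite ?inE//.
    by apply: bigcup_measurable => n _; exact: measurable_covered.
  move=> x /AI[k _]; have [_ Ik _] := pI k => /Ik/=; rewrite in_itv/= => xk.
  exists k.+1 => //; apply/hasP; exists (p k) => //; apply: map_f.
  by rewrite mem_iota/= add0n.
rewrite -(cvg_lim _ cvgU)//; apply: lime_le; first by apply/cvg_ex; eexists; exact: cvgU.
by near=> n; exact: Ule.
Unshelve. all: by end_near. Qed.

(** The Radon-Nikodym theorem needs a finite measure: bounds on F suffice. *)
Lemma stieltjes_finite a b : (forall x, F a <= F x <= F b) -> fin_num_fun nu.
Proof.
move=> Fab A mA; rewrite ge0_fin_numE//.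
apply: (@le_lt_trans _ _ (F b - F a)%:E); last exact: ltry.
pose I n : set R := `]- (n%:R), n%:R]%classic.
have mI n : measurable (I n) by exact: measurable_itv.
have cvgI : nu (I n) @[n --> \oo] --> nu (\bigcup_n I n).
  apply: nondecreasing_cvg_mu => [//||m n mn].
    by apply: bigcup_measurable => n _; exact: mI.
  by apply/subsetPset/subset_itv; rewrite leBSide/= ?lerN2 ler_nat.
apply: (@le_trans _ _ (nu (\bigcup_n I n))).
  by apply: le_measure => [||x _]; rewrite ?inE//; [by apply: bigcup_measurable => n _; exact: mI | by rewrite (bigcup_itvT false false)].
rewrite -(cvg_lim _ cvgI)//; apply: lime_le; first by apply/cvg_ex; eexists; exact: cvgI.
near=> n; rewrite stieltjes_itv ?lee_fin; last by rewrite (@le_trans _ _ 0)// oppr_le0.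
have /andP[Fa _] := Fab (- n%:R); have /andP[_ Fb] := Fab n%:R.
exact: lerB.
Unshelve. all: by end_near. Qed.

End stieltjes.

Lemma monotone_ac_density F a b : {homo F : x y / x <= y} -> ac F ->
  (forall x, F a <= F x <= F b) ->
  exists g : R -> R, mu.-integrable setT (EFin \o g) /\
    forall x y, x <= y -> (\int[mu]_(z in `]x, y]) (g z)%:E = (F y - F x)%:E)%E.
Proof.
move=> ndF acF Fab.
have rcF : right_continuous F by apply: right_continuousW; exact: ac_continuous.
pose C : cumulative R R := HB.pack F (isCumulative.Build R _ R F ndF rcF).
pose nu0 := lebesgue_stieltjes_measure C.
have fin0 : fin_num_fun nu0 by exact: (@stieltjes_finite C a b).
pose nu : {finite_measure set _ -> \bar R} :=
  HB.pack nu0 (Measure_isFinite.Build _ _ _ nu0 fin0).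
have dom : nu `<< mu by exact: (@ac_stieltjes_dominated C).
have [g [g0 gfin gint gE]] := radon_nikodym_sigma_finite dom.
have gK : EFin \o (fine \o g) = g.
  by apply/funext => x /=; rewrite fineK.
exists (fine \o g); rewrite gK; split => // x y xy.
have -> : (F y - F x)%:E = (\int[mu]_(z in `]x, y]) g z)%E.
  by rewrite -gE//; symmetry; exact: (@stieltjes_itv C).
by apply: eq_integral => z _; rewrite /= fineK.
Qed.

End density.

Section ftc.
Variable R : realType.
Notation mu := (@lebesgue_measure R).

(** The fundamental theorem of calculus for absolutely continuous functions:
    the monotone parts of the Jordan decomposition have Radon-Nikodym densities,
    whose difference is the density sought. *)
Lemma abs_continuous_density (t : R) (phi : R -> R) : 0 <= t ->
  abs_continuous t phi ->
  exists g : R -> R, mu.-integrable setT (EFin \o g) /\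
    forall x y, 0 <= x -> x <= y -> y <= t ->
      (\int[mu]_(z in `[x, y]) (g z)%:E = (phi y - phi x)%:E)%E.
Proof.
move=> t0 acphi; pose f := phi \o clamp t; pose T := tv t f.
have acf : ac f by exact: ac_clamp.
have acT : ac T by exact: tv_ac.
have fc x : f (clamp t x) = f x by rewrite /f/= clampK.
have cT x : T x = T (clamp t x) by rewrite /T /tv clampK.
have c0 x : clamp t 0 <= clamp t x.
  by rewrite clamp_id ?lexx//; case/andP: (clamp_itv x t0).
have ct x : clamp t x <= clamp t t.
  by rewrite (@clamp_id _ t t) ?lexx ?andbT//; case/andP: (clamp_itv x t0).
have ndT := tv_homo t0 acf : {homo T : x y / x <= y}.
have [|g [ig gE]] := @monotone_ac_density _ T 0 t ndT acT.
  move=> x; rewrite (cT 0) (cT x) (cT t); apply/andP; split; exact: ndT.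
pose W := T \+ (\- f).
have ndW : {homo W : x y / x <= y}.
  move=> x y xy; have := tv_ge t0 acf xy; rewrite !fc -/T /W/= => h.
  have := ler_norm (f y - f x); lra.
have acW : ac W by apply: acD => //; exact: acN.
have cW x : W x = W (clamp t x) by rewrite /W/= fc cT.
have [|k [ik kE]] := @monotone_ac_density _ W 0 t ndW acW.
  move=> x; rewrite (cW 0) (cW x) (cW t); apply/andP; split; exact: ndW.
have igk : mu.-integrable setT (EFin \o (fun x => g x - k x)).
  by rewrite (_ : _ \o _ = (EFin \o g) \- (EFin \o k))%E//; apply: integrableB.
exists (fun x => g x - k x); split => // x y x0 xy yt.
rewrite -integral_itv_obnd_cbnd; last first.
  by apply: (@measurable_int _ _ _ mu); apply: integrableS igk.
have ig' : mu.-integrable `]x, y] (EFin \o g) by apply: integrableS ig.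
have ik' : mu.-integrable `]x, y] (EFin \o k) by apply: integrableS ik.
under eq_integral do rewrite EFinB.
rewrite (integralB _ ig' ik')//=.
rewrite gE// kE// -EFinB; congr (_%:E); rewrite /W /f/= !clamp_id; lra.
Qed.

Lemma ae_density_derive (t : R) (phi g : R -> R) :
  mu.-integrable setT (EFin \o g) ->
  (forall x y, 0 <= x -> x <= y -> y <= t ->
      (\int[mu]_(z in `[x, y]) (g z)%:E = (phi y - phi x)%:E)%E) ->
  {ae mu, forall x, 0 < x < t -> derivable phi x 1 /\ derive1 phi x = g x}.
Proof.
move=> ig gE.
pose F x := (\int[mu]_(z in `[0%R, x]) g z)%R.
have : {ae mu, forall x, (BLeft 0%R < BRight x)%E ->
    derivable F x 1 /\ derive1 F x = g x}.
  apply: (@FTC1 R g (BLeft 0%R) _ _).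
    by move=> y; apply: integrableS ig.
  by apply: open_integrable_locally => //; exact: openT.
apply: (filterS (F := almost_everywhere mu)) => x H /andP[x0 xt]; have [|dF DF] := H.
  by rewrite (@lte_fin R).
have E : \forall y \near x, phi y = F y + phi 0.
  near=> y; rewrite /F /Rintegral gE/= ?lexx//; first by rewrite subrK.
    by near: y; exact: lt_le_nbhsr.
  by near: y; exact: lt_le_nbhsl.
clearbody F; have D1 : is_derive x (1 : R) F (g x).
  by apply: DeriveDef => //; rewrite -derive1E.
have D : is_derive x (1 : R) (F + cst (phi 0)) (g x + 0) by exact: is_deriveD.
have E' : {near x, (F + cst (phi 0) : R -> R) =1 phi} by apply: filterS E => y ->.
split; first exact: near_eq_derivable E' (@ex_derive _ _ _ _ _ _ _ D).
have E2 : \forall y \near x, phi y = (F + cst (phi 0)) y by exact: E.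
by rewrite derive1E (near_eq_derive _ E2) (@derive_val _ _ _ _ _ _ _ D) addr0.
Unshelve. all: by end_near. Qed.

End ftc.

(** * The Lagrangian as a Legendre transform *)

Section lagr.
Variable R : realType.
Implicit Types m p v : R.

(** The Hamiltonian of the total spin, which jumps by 2 at rate (1 - m) / 2
    and by -2 at rate (1 + m) / 2 per spin; [speed] is its derivative in the
    momentum p. *)
Definition hamil m p : R :=
  (1 + m) / 2 * (expR (- (2 * p)) - 1) + (1 - m) / 2 * (expR (2 * p) - 1).
Definition speed m p : R :=
  (1 - m) * expR (2 * p) - (1 + m) * expR (- (2 * p)).

Lemma lagrangian_int_speed m p : -1 < m < 1 ->
  lagrangian_int m (speed m p) = p * speed m p - hamil m p.
Proof.
move=> /andP[m1 m2]; rewrite /lagrangian_int /hamil /speed expRN.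
have := expR_gt0 (2 * p); have lnE := expRK (2 * p).
move: (expR (2 * p)) lnE => z lnE z0.
have zz : z * z^-1 = 1 by rewrite divff// gt_eqF.
have iz : 0 < z^-1 by rewrite invr_gt0.
set v := (1 - m) * z - (1 + m) / z.
have rE : Num.sqrt (4 * (1 - m ^+ 2) + v ^+ 2) = (1 - m) * z + (1 + m) / z.
  rewrite (_ : _ + _ = ((1 - m) * z + (1 + m) / z) ^+ 2).
    rewrite sqrtr_sqr ger0_norm// addr_ge0//.
      by rewrite mulr_ge0//; lra.
    by rewrite mulr_ge0//; lra.
  rewrite /v; move: (z^-1) zz => w zw.
  have -> : ((1 - m) * z + (1 + m) * w) ^+ 2 =
    ((1 - m) * z - (1 + m) * w) ^+ 2 + 4 * (1 - m ^+ 2) * (z * w) by ring.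
  by rewrite zw; ring.
rewrite rE (_ : (_ + v) / _ = z); last by rewrite /v; field; lra.
rewrite lnE /v; field; lra.
Qed.

(** The momentum that produces speed v solves a quadratic equation in
    exp (2 p), whose positive root appears in the logarithm of the
    Lagrangian. *)
Lemma speed_surj m v : -1 < m < 1 -> exists p, v = speed m p.
Proof.
move=> /andP[m1 m2]; pose s := Num.sqrt (v ^+ 2 + 4 * (1 - m ^+ 2)).
have m0 : 0 < 1 - m ^+ 2.
  have -> : 1 - m ^+ 2 = (1 - m) * (1 + m) by ring.
  by apply: mulr_gt0; lra.
have s2 : s ^+ 2 = v ^+ 2 + 4 * (1 - m ^+ 2).
  by rewrite sqr_sqrtr// addr_ge0 ?sqr_ge0//; lra.
have s0 : 0 <= s by exact: sqrtr_ge0.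
have sv : 0 < s + v.
  have [v0|v0] := leP 0 v; first nra.
  nra.
pose z := (s + v) / (2 * (1 - m)).
have z0 : 0 < z by rewrite divr_gt0//; lra.
exists (ln z / 2); rewrite /speed expRN mulrCA divff// mulr1 lnK//.
rewrite /z; apply/eqP; rewrite -subr_eq0; apply/eqP.
have -> : v - ((1 - m) * ((s + v) / (2 * (1 - m))) -
      (1 + m) / ((s + v) / (2 * (1 - m)))) =
   (v ^+ 2 + 4 * (1 - m ^+ 2) - s ^+ 2) / (2 * (s + v)) by field; lra.
by rewrite s2 subrr mul0r.
Qed.

Lemma hamil_convex m p q : -1 <= m <= 1 ->
  hamil m p + (q - p) * speed m p <= hamil m q.
Proof.
move=> /andP[m1 m2]; rewrite /hamil /speed.
have -> : 2 * q = 2 * p + 2 * (q - p) by ring.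
rewrite opprD !expRD; have := expR_ge1Dx (2 * (q - p)).
have := expR_ge1Dx (- (2 * (q - p))).
have := expR_gt0 (2 * p); have := expR_gt0 (- (2 * p)).
move: (expR (- (2 * p))) (expR (2 * p)) (expR (- (2 * (q - p))))
  (expR (2 * (q - p))) => a b c d a0 b0 hc hd.
have h1 := mulr_ge0 (mulr_ge0 (ltac:(lra) : 0 <= 1 + m) (ltW a0)) (ltac:(lra) : 0 <= c - (1 - (2 * (q - p)))).
have h2 := mulr_ge0 (mulr_ge0 (ltac:(lra) : 0 <= 1 - m) (ltW b0)) (ltac:(lra) : 0 <= d - (1 + (2 * (q - p)))).
lra.
Qed.

Lemma fenchel_int m v p : -1 < m < 1 -> p * v - hamil m p <= lagrangian_int m v.
Proof.
move=> m1; have [q ->] := speed_surj v m1.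
rewrite lagrangian_int_speed//; have : -1 <= m <= 1.
  by case/andP: m1 => ma mb; rewrite (ltW ma) (ltW mb).
by move=> /(@hamil_convex m q p); lra.
Qed.

Lemma continuous_hamil p : continuous (fun x : R * R => p * x.2 - hamil x.1 p).
Proof.
move=> x; rewrite /hamil; apply: cvgB.
  by apply: cvgM; [exact: cvg_cst|exact: cvg_snd].
apply: cvgD; (apply: cvgM; last exact: cvg_cst); (apply: cvgM; last exact: cvg_cst).
  by apply: cvgD; [exact: cvg_cst|exact: cvg_fst].
by apply: cvgB; [exact: cvg_cst|exact: cvg_fst].
Qed.

(** For fixed p the lower bound is continuous in (m, v), hence the Fenchel
    inequality passes to the lower limit that defines the Lagrangian at
    m = 1 and m = -1. *)
Lemma fenchel m v p : -1 <= m <= 1 ->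
  ((p * v - hamil m p)%:E <= lagrangian m v)%E.
Proof.
move=> m1; rewrite /lagrangian; case: ifPn => [m2|_].
  by rewrite lee_fin fenchel_int.
rewrite limf_einfE; apply/lee_subgt0Pr => e e0.
pose V := [set x : R * R | -1 < x.1 < 1 /\ p * v - hamil m p - e < p * x.2 - hamil x.1 p].
apply: (@le_trans _ _ (ereal_inf ((fun x : R * R => (lagrangian_int x.1 x.2)%:E) @` V))).
  apply: le_ereal_inf_tmp => _ [x [x1 Vx] <-].
  rewrite -EFinB lee_fin; apply: le_trans (fenchel_int _ _ x1).
  exact/ltW/Vx.
apply: ereal_sup_ubound; exists V => //.
have C : (fun x : R * R => p * x.2 - hamil x.1 p) @ (m, v) --> p * v - hamil m p.
  by have := @continuous_hamil p (m, v); rewrite /continuous_at/=.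
have lt1 : p * v - hamil m p - e < p * v - hamil m p by rewrite ltrBlDr ltrDl.
have H := cvgr_gt _ C _ lt1.
rewrite /within/=; near=> x => x1; split => //; near: x; exact: H.
Unshelve. all: by end_near. Qed.

Lemma lagrangian_ge0 m v : -1 <= m <= 1 -> (0 <= lagrangian m v)%E.
Proof.
move=> m1; have := fenchel v 0 m1.
by rewrite /hamil mulr0 oppr0 expR0 mul0r subrr !mulr0 addr0 subrr.
Qed.

End lagr.

(** * Affine solutions of the Hamilton-Jacobi equation *)

Lemma is_derive_ln (R : realType) (f : R -> R) (x d : R) : 0 < f x ->
  is_derive x 1 f d -> is_derive x 1 (fun y => ln (f y)) (d / f x).
Proof.
move=> f0 df; have dl := is_derive1_ln f0.
have := is_derive1_comp dl df.
by rewrite /GRing.scale/= mulrC.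
Qed.

Lemma is_derive_continuous (R : realType) (f : R -> R) (x d : R) :
  is_derive x (1 : R) f d -> {for x, continuous f}.
Proof.
move=> D; apply: differentiable_continuous; apply/derivable1_diffP; exact: ex_derive.
Qed.

Section value.
Variable R : realType.
Variables t beta : R.

(** Solutions of the backward equation of a single spin, at the spins 1 and -1
    and normalised to have mean 1; their terminal values are 1 + beta and
    1 - beta. The affine interpolation of their logarithms is [value]. *)
Definition up (s : R) := 1 + beta * expR (2 * (s - t)).
Definition um (s : R) := 1 - beta * expR (2 * (s - t)).
Definition momentum s := (ln (up s) - ln (um s)) / 2.
Definition value s m := (1 + m) / 2 * ln (up s) + (1 - m) / 2 * ln (um s).

Lemma is_derive_up s : is_derive s (1 : R) up (2 * (up s - 1)).
Proof.
rewrite /up; apply: is_derive_eq; rewrite /GRing.scale/=; ring.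
Qed.

Lemma is_derive_um s : is_derive s (1 : R) um (2 * (um s - 1)).
Proof.
rewrite /um; apply: is_derive_eq; rewrite /GRing.scale/=; ring.
Qed.

Lemma u_gt0 r s : `|beta| * expR (2 * (r - t)) < 1 -> s <= r -> 0 < up s /\ 0 < um s.
Proof.
move=> Hr sr; have : `|beta * expR (2 * (s - t))| < 1.
  rewrite normrM (ger0_norm (expR_ge0 _)); apply: le_lt_trans Hr.
  by rewrite ler_wpM2l// ler_expR; lra.
by rewrite ltr_norml /up /um => /andP[]; split; lra.
Qed.

Lemma expR_momentum s : 0 < up s -> 0 < um s -> expR (2 * momentum s) = up s / um s.
Proof.
move=> u0 m0; rewrite /momentum mulrCA divff// mulr1 expRB !lnK//.
Qed.

(** The value function solves the Hamilton-Jacobi equation; being affine in m,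
    it can be composed with any differentiable path. *)
Lemma is_derive_value (phi : R -> R) s : 0 < up s -> 0 < um s ->
  derivable phi s 1 ->
  is_derive s (1 : R) (fun z => value z (phi z))
    (momentum s * derive1 phi s - hamil (phi s) (momentum s)).
Proof.
move=> u0 m0 dphi.
have Dp : is_derive s (1 : R) phi (derive1 phi s) by apply: DeriveDef => //; rewrite derive1E.
have Du := is_derive_ln u0 (is_derive_up s).
have Dm := is_derive_ln m0 (is_derive_um s).
rewrite /value; apply: is_derive_eq.
rewrite /GRing.scale/= /hamil expRN expR_momentum// /momentum.
have uE : um s = 2 - up s by rewrite /up /um; ring.
move: (ln (up s)) (ln (um s)) => lu lm; rewrite uE in m0 *.
by field; lra.
Qed.

End value.

Section lipschitz.
Variable R : realType.

(** The Lipschitz bounds are the source of absolute continuity for all the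
    explicit functions of a path. *)
Lemma C1_lipschitz (r : R) (f f' : R -> R) : 0 <= r ->
  (forall s, 0 <= s <= r -> is_derive s 1 f (f' s)) ->
  {within `[0, r], continuous f'} ->
  exists2 M, 0 <= M & forall x y, 0 <= x <= r -> 0 <= y <= r ->
    `|f y - f x| <= M * `|y - x|.
Proof.
move=> r0 df cf'.
have cn : {within `[0, r], continuous (fun x => `|f' x|)}.
  by move=> x; apply: continuous_comp; [exact: cf'|exact: norm_continuous].
have [c cr cM] := EVT_max r0 cn.
exists `|f' c| => // x y.
wlog xy : x y / x <= y => [W x0 y0|].
  case: (leP x y) => [/W|/ltW/W]; first exact.
  by rewrite distrC (distrC y); exact.
move=> /andP[x0 xr] /andP[y0 yr].
have [z| |z zxy ->] := @MVT_segment R f f' x y xy.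
- rewrite in_itv/= => /andP[xz zy]; apply: df; lra.
- apply: derivable_within_continuous => z.
  rewrite in_itv/= => /andP[xz zy].
  have D : is_derive z 1 f (f' z) by apply: df; lra.
  exact: ex_derive.
- rewrite normrM ler_wpM2r//; apply: cM.
  by move: zxy; rewrite !in_itv/= => /andP[xz zy]; lra.
Qed.

Lemma abs_continuous_lipschitz (t K : R) (phi F : R -> R) : 0 <= K ->
  abs_continuous t phi ->
  (forall x y, 0 <= x <= t -> 0 <= y <= t ->
     `|F y - F x| <= K * (`|y - x| + `|phi y - phi x|)) ->
  abs_continuous t F.
Proof.
move=> K0 aphi HF e e0.
have K1 : 0 < 2 * (K + 1) by lra.
have e1 : 0 < e / (2 * (K + 1)) by rewrite divr_gt0.
have [d d0 H] := aphi _ e1.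
exists (Num.min d (e / (2 * (K + 1)))); first by rewrite lt_min d0 e1.
move=> n a b ab disj; rewrite lt_min => /andP[sd se].
have := H n a b ab disj sd => h.
apply: (@le_lt_trans _ _ (\sum_(i < n) K * ((b i - a i) + `|phi (b i) - phi (a i)|))).
  apply: ler_sum => i _; have [a0 [aib bt]] := ab i.
  have := HF (a i) (b i) (ltac:(lra)) (ltac:(lra)).
  by rewrite (ger0_norm (_ : 0 <= b i - a i))//; lra.
rewrite -mulr_sumr big_split/=.
apply: (@le_lt_trans _ _ ((K + 1) * (\sum_(i < n) (b i - a i) + \sum_(i < n) `|phi (b i) - phi (a i)|))).
  rewrite ler_wpM2r//; last by lra.
  rewrite addr_ge0 ?sumr_ge0// => i _; have [? []] := ab i; lra.
apply: (@lt_le_trans _ _ ((K + 1) * (e / (2 * (K + 1)) + e / (2 * (K + 1))))).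
  by rewrite ltr_pM2l; lra.
by rewrite le_eqVlt; apply/orP; left; apply/eqP; field; lra.
Qed.

End lipschitz.

(** * The lower bound on the action *)

Section lower_integral.
Context d (T : measurableType d) (R : realType) (mu : {measure set T -> \bar R}).
Local Open Scope ereal_scope.

Lemma ge0_le_integralT_lower (f g : T -> \bar R) : (forall x, 0 <= f x) ->
  (forall x, f x <= g x) -> \int[mu]_x f x <= \int[mu]_x g x.
Proof.
move=> f0 fg; rewrite !ge0_integralTE//; last first.
  by move=> x; exact: le_trans (f0 x) (fg x).
apply: ge_ereal_sup => _ [h hf <-]; apply: ereal_sup_ubound; exists h => // x.
exact: le_trans (hf x) (fg x).
Qed.

(** The integral of a nonnegative function is a supremum over simple functions
    below it, so that it is monotone even when the larger function is not
    known to be measurable. *)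
Lemma ae_le_integral_lower (D : set T) (f g : T -> \bar R) : measurable D ->
  mu.-integrable D f -> (forall x, D x -> 0 <= g x) ->
  {ae mu, forall x, D x -> f x <= g x} ->
  \int[mu]_(x in D) f x <= \int[mu]_(x in D) g x.
Proof.
move=> mD fi g0 [N [mN N0 fgN]].
have mf := measurable_int mu fi.
apply: (@le_trans _ _ (\int[mu]_(x in D) f^\+ x)).
  rewrite integralE geeDl//.
  by rewrite oppe_le0; apply: integral_ge0.
have mfp := measurable_funepos mf.
rewrite (ge0_negligible_integral mN mD mfp _ N0)//.
rewrite integral_mkcond [leRHS]integral_mkcond; apply: ge0_le_integralT_lower => x.
  by apply: erestrict_ge0.
rewrite !patchE; case: ifPn => [/set_mem[Dx Nx]|_].
  rewrite mem_set// funeposE ge_max g0// andbT.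
  by apply/negPn/negP => /negP h; apply: Nx; apply: fgN => /(_ Dx) /h.
by case: ifPn => // /set_mem /g0.
Qed.

End lower_integral.

Section lower_bound.
Variable R : realType.
Notation mu := (@lebesgue_measure R).
Variables (t : R) (phi : R -> R).
Hypotheses (t0 : 0 < t) (aphi : abs_continuous t phi)
  (phi1 : forall s, 0 <= s <= t -> -1 <= phi s <= 1).

Lemma abs_continuous_affine r (c k c' k' : R -> R) : 0 <= r <= t ->
  (forall s, 0 <= s <= r -> is_derive s (1 : R) c (c' s)) ->
  (forall s, 0 <= s <= r -> is_derive s (1 : R) k (k' s)) ->
  {within `[0, r], continuous c'} -> {within `[0, r], continuous k'} ->
  abs_continuous r (fun s => c s + k s * phi s).
Proof.
move=> /andP[r0 rt] dc dk cc' ck'.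
have ck : {within `[0, r], continuous k}.
  apply: derivable_within_continuous => z; rewrite in_itv/= => zr.
  have D : is_derive z 1 k (k' z) by exact: dk.
  exact: ex_derive.
have [P P0 HP] : exists2 P, 0 <= P & forall s, 0 <= s <= r -> `|k s| <= P.
  have cn : {within `[0, r], continuous (fun x => `|k x|)}.
    by move=> x; apply: continuous_comp; [exact: ck|exact: norm_continuous].
  have [z _ zM] := EVT_max r0 cn; exists `|k z| => // s; exact: zM.
have [C C0 HC] := C1_lipschitz r0 dc cc'.
have [K K0 HK] := C1_lipschitz r0 dk ck'.
have aphir : abs_continuous r phi.
  move=> e /aphi[d d0 H]; exists d => // n a b ab; apply: H => i.
  by have [? [? ?]] := ab i; split => //; split => //; exact: le_trans rt.
apply: (@abs_continuous_lipschitz _ r (C + K + P) phi) => //; first lra.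
move=> x y xr yr.
have -> : c y + k y * phi y - (c x + k x * phi x) =
  (c y - c x) + (k y - k x) * phi y + k x * (phi y - phi x) by ring.
have h1 := HC _ _ xr yr; have h2 := HK _ _ xr yr; have h3 := HP _ xr.
have p1 : `|phi y| <= 1.
  by rewrite ler_norml; apply: phi1; case/andP: yr => -> /= yr; exact: le_trans rt.
apply: le_trans (ler_normD _ _) _.
apply: le_trans (lerD (ler_normD _ _) (lexx _)) _.
rewrite !normrM.
have n1 := normr_ge0 (y - x); have n2 := normr_ge0 (phi y - phi x).
have n3 := normr_ge0 (k y - k x).
have := ler_wpM2l n3 p1; have := ler_wpM2r n2 h3; nra.
Qed.

Lemma continuous_within (a b : R) (f : R -> R) :
  (forall s, a <= s <= b -> {for s, continuous f}) -> {within `[a, b], continuous f}.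
Proof.
move=> cf; apply: continuous_in_subspaceT => s /set_mem; rewrite /= in_itv/=; exact: cf.
Qed.

End lower_bound.

Section paths.
Variable R : realType.
Notation mu := (@lebesgue_measure R).
Variables (t : R) (phi : R -> R).
Hypotheses (t0 : 0 < t) (aphi : abs_continuous t phi)
  (phi1 : forall s, 0 <= s <= t -> -1 <= phi s <= 1).

Lemma ae_neq (a : R) : {ae mu, forall s, s <> a}.
Proof.
exists [set a]; split; first exact: measurable_set1.
  exact: lebesgue_measure_set1.
by move=> s /=; apply: contra_notP.
Qed.

Lemma continuous_up beta s : {for s, continuous (up t beta)}.
Proof. exact: is_derive_continuous (is_derive_up t beta s). Qed.

Lemma continuous_um beta s : {for s, continuous (um t beta)}.
Proof. exact: is_derive_continuous (is_derive_um t beta s). Qed.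

Lemma abs_continuous_value beta r : 0 <= r <= t ->
  `|beta| * expR (2 * (r - t)) < 1 ->
  abs_continuous r (fun s => value t beta s (phi s)).
Proof.
move=> rt Hr.
pose a s := (up t beta s - 1) / up t beta s.
pose b s := (um t beta s - 1) / um t beta s.
have ca s : 0 <= s <= r -> {for s, continuous a}.
  move=> /andP[s0 sr]; have [u0 _] := u_gt0 Hr sr.
  apply: cvgM; first by apply: cvgB; [exact: continuous_up|exact: cvg_cst].
  by apply: cvgV; [rewrite gt_eqF|exact: continuous_up].
have cb s : 0 <= s <= r -> {for s, continuous b}.
  move=> /andP[s0 sr]; have [_ u0] := u_gt0 Hr sr.
  apply: cvgM; first by apply: cvgB; [exact: continuous_um|exact: cvg_cst].
  by apply: cvgV; [rewrite gt_eqF|exact: continuous_um].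
rewrite (_ : (fun s => _) = fun s =>
   (ln (up t beta s) + ln (um t beta s)) / 2 + momentum t beta s * phi s); last first.
  by apply/funext => s; rewrite /value /momentum; field.
apply: (@abs_continuous_affine _ t phi aphi phi1 r _ _ (fun s => a s + b s) (fun s => a s - b s)) => //.
- move=> s /andP[s0 sr]; have [u0 m0] := u_gt0 Hr sr.
  have Du := is_derive_ln u0 (is_derive_up t beta s).
  have Dm := is_derive_ln m0 (is_derive_um t beta s).
  apply: is_derive_eq; rewrite /GRing.scale/= /a /b; by field; rewrite !gt_eqF.
- move=> s /andP[s0 sr]; have [u0 m0] := u_gt0 Hr sr.
  have Du := is_derive_ln u0 (is_derive_up t beta s).
  have Dm := is_derive_ln m0 (is_derive_um t beta s).
  rewrite /momentum; apply: is_derive_eq; rewrite /GRing.scale/= /a /b; by field; rewrite !gt_eqF.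
- by apply: continuous_within => s sr; apply: cvgD; [exact: ca|exact: cb].
- by apply: continuous_within => s sr; apply: cvgB; [exact: ca|exact: cb].
Qed.

Definition gain beta s := momentum t beta s * derive1 phi s - hamil (phi s) (momentum t beta s).

(** Along a path the value function is absolutely continuous, with derivative
    [gain]; by the Hamilton-Jacobi equation only the two terms of the Fenchel
    lower bound survive in the derivative. *)
Lemma value_density beta : `|beta| < 1 -> exists G : R -> R,
  [/\ mu.-integrable `[0, t] (EFin \o G),
      {ae mu, forall s, 0 < s < t -> G s = gain beta s} &
      (\int[mu]_(s in `[0%R, t]) (G s)%:E =
        (value t beta t (phi t) - value t beta 0 (phi 0))%:E)%E].
Proof.
move=> b1; have Ht : `|beta| * expR (2 * (t - t)) < 1.
  by rewrite subrr mulr0 expR0 mulr1.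
have tt : 0 <= t <= t by rewrite lexx ltW.
have aV := abs_continuous_value tt Ht.
have [G [iG GE]] := abs_continuous_density (ltW t0) aV.
have [g [ig gE]] := abs_continuous_density (ltW t0) aphi.
exists G; split.
- by apply: integrableS iG.
- have := ae_density_derive iG GE; have := ae_density_derive ig gE.
  apply: filterS2; first exact: (ae_filter_ringOfSetsType mu).
  move=> s H1 H2 st; have [d1 e1] := H1 st; have [d2 e2] := H2 st.
  have [|u0 m0] := @u_gt0 _ t beta t s Ht; first by case/andP: st => _ /ltW.
  rewrite -e2 derive1E.
  have D := is_derive_value u0 m0 d1.
  exact: (@derive_val _ _ _ _ _ _ _ D).
- by rewrite GE// ?lexx// ltW.
Qed.

Lemma gain_le_lagrangian beta s : 0 < s < t ->
  ((gain beta s)%:E <= lagrangian (phi s) (derive1 phi s))%E.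
Proof.
by move=> /andP[s0 st]; apply: fenchel; apply: phi1; rewrite !ltW.
Qed.

(** The strict inequality |beta| < 1 keeps the logarithms finite up to the
    final time. *)
Lemma action_ge beta : `|beta| < 1 ->
  ((value t beta t (phi t) - value t beta 0 (phi 0))%:E <=
   \int[mu]_(s in `[0%R, t]) lagrangian (phi s) (derive1 phi s))%E.
Proof.
move=> /value_density[G [iG GE <-]].
apply: ae_le_integral_lower => //.
- by move=> s /=; rewrite in_itv/= => /phi1 /lagrangian_ge0.
- have := ae_neq 0; have := ae_neq t; move: GE; apply: filterS3.
    exact: (ae_filter_ringOfSetsType mu).
  move=> s H st s0.
  rewrite /= in_itv/= => /andP[h1 h2].
  have s_itv : 0 < s < t.
    by rewrite !lt_neqAle h1 h2 !andbT; apply/andP; split; apply/eqP => // /esym.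
  by rewrite H//; exact: gain_le_lagrangian.
Qed.

End paths.

(** * Equality in the lower bound *)

Section tight.
Variable R : realType.
Notation mu := (@lebesgue_measure R).

Section real_fatou.
Context d (T : measurableType d) (nu : {measure set T -> \bar R}) (D : set T).
Hypothesis mD : measurable D.
Local Open Scope ereal_scope.

Lemma measurable_fun_limn_einf (f : (T -> \bar R)^nat) :
  (forall n, measurable_fun D (f n)) ->
  measurable_fun D (fun x => limn_einf (f ^~ x)).
Proof.
move=> mf; rewrite (_ : (fun _ => _) = (fun x => - limn_esup (fun n => - f n x))).
  apply: measurableT_comp => //; apply: measurable_fun_limn_esup => n.
  exact: measurableT_comp.
by apply/funext => x; rewrite -limn_einfN; congr limn_einf; apply/funext => n /=; rewrite oppeK.
Qed.

(** Nonnegative functions with vanishing integrals tend to zero, at least along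
    a subsequence depending on the point. *)
Lemma ae_limn_einf0 (e : (T -> \bar R)^nat) :
  (forall n, measurable_fun D (e n)) -> (forall n x, D x -> 0 <= e n x) ->
  \int[nu]_(x in D) e n x @[n --> \oo] --> 0 ->
  {ae nu, forall x, D x -> limn_einf (e ^~ x) = 0}.
Proof.
move=> me e0 ie0; have ml := measurable_fun_limn_einf me.
apply/(ae_eq_integral_abs nu mD ml).
have l0 x : D x -> 0 <= limn_einf (e ^~ x).
  move=> Dx; rewrite limn_einf_lim; apply: lime_ge; first exact: is_cvg_einfs.
  by near=> n; apply: le_ereal_inf_tmp => _ [k _ <-]; exact: e0.
apply/eqP; rewrite eq_le integral_ge0 ?andbT => [|x _]; last exact: abse_ge0.
under eq_integral => x /set_mem Dx do rewrite gee0_abs ?l0//.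
apply: le_trans (fatou nu mD me e0) _.
by have [-> _] := cvg_limn_einf_sup ie0.
Unshelve. all: by end_near. Qed.

End real_fatou.

(** The maximizer p of the concave function q v - hamil m q determines v. It is
    enough to compare with rational q, so that countably many almost sure
    inequalities can be used simultaneously. *)
Lemma speed_unique (m v p : R) : -1 <= m <= 1 ->
  (forall q : rat, ratr q * v - hamil m (ratr q) <= p * v - hamil m p) ->
  v = speed m p.
Proof.
move=> m1 H.
have D q : is_derive q (1 : R) (fun q => q * v - hamil m q) (v - speed m q).
  rewrite /hamil /speed; apply: is_derive_eq; rewrite /GRing.scale/=; by field.
have Hr q : q * v - hamil m q <= p * v - hamil m p.
  rewrite leNgt; apply/negP => lt.
  have cq : {for q, continuous (fun z : R => z * v - hamil m z : R)}.
    exact: is_derive_continuous (D q).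
  have [e /= e0 He] := (nbhs_ballP _ _).1 (cvgr_gt _ cq _ lt).
  have [] := @rat_in_itvoo R (q - e) (q + e); first lra.
  move=> r; rewrite in_itv/= => /andP[r1 r2].
  have /He := (ltac:(rewrite /ball/= distrC ltr_distlC; apply/andP; split; lra) : ball q e (ratr r)).
  by rewrite ltNge H.
have : is_derive p (1 : R) (fun q => q * v - hamil m q) 0.
  apply: (@derive1_at_max _ _ (p - 1) (p + 1)); first lra.
  - by move=> q _; exact: ex_derive.
  - by rewrite in_itv/=; lra.
  - by move=> q _; exact: Hr.
by move=> D0; have := @derive_val _ _ _ _ _ _ _ D0;
  rewrite (@derive_val _ _ _ _ _ _ _ (D p)); lra.
Qed.

Lemma ae_itvcc (t : R) (P : R -> Prop) :
  {ae mu, forall s, 0 < s < t -> P s} -> {ae mu, forall s, `[0, t]%classic s -> P s}.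
Proof.
move=> aP.
apply: (@filterS3 _ _ (ae_filter_ringOfSetsType mu) _ _ _ _ _ aP (ae_neq t) (ae_neq 0)).
move=> s H st s0; rewrite /= in_itv/= => /andP[h1 h2]; apply: H.
by rewrite !lt_neqAle h1 h2 !andbT; apply/andP; split; apply/eqP => // /esym.
Qed.

Variables (t : R) (phi : R -> R).
Hypotheses (t0 : 0 < t) (aphi : abs_continuous t phi)
  (phi1 : forall s, 0 <= s <= t -> -1 <= phi s <= 1).

(** At the singular value |beta| = 1 the gain is still finite before the final
    time. *)
Lemma gain_cvg (beta : R) (b : nat -> R) s : `|beta| <= 1 -> 0 < s < t ->
  b n @[n --> \oo] --> beta -> gain t phi (b n) s @[n --> \oo] --> gain t phi beta s.
Proof.
move=> beta1 /andP[s0 st] bb.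
have Hs : `|beta| * expR (2 * (s - t)) < 1.
  apply: le_lt_trans (ler_wpM2r (expR_ge0 _) beta1) _.
  by rewrite mul1r expR_lt1; lra.
have [u0 m0] := u_gt0 Hs (lexx s).
have cu : up t (b n) s @[n --> \oo] --> up t beta s.
  by apply: cvgD; [exact: cvg_cst|apply: cvgM => //; exact: cvg_cst].
have cm : um t (b n) s @[n --> \oo] --> um t beta s.
  by apply: cvgB; [exact: cvg_cst|apply: cvgM => //; exact: cvg_cst].
have cp : momentum t (b n) s @[n --> \oo] --> momentum t beta s.
  rewrite /momentum; apply: cvgM; last exact: cvg_cst.
  apply: cvgB; first exact: (continuous_cvg _ (continuous_ln u0) cu).
  exact: (continuous_cvg _ (continuous_ln m0) cm).
rewrite /gain.
apply: cvgB; first by apply: cvgM => //; exact: cvg_cst.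
have c2 : 2 * momentum t (b n) s @[n --> \oo] --> 2 * momentum t beta s.
  by apply: cvgM => //; exact: cvg_cst.
apply: cvgD; (apply: cvgM; first exact: cvg_cst); (apply: cvgB; last exact: cvg_cst).
  apply: (continuous_cvg _ (@continuous_expR _ _)).
  exact: cvgN.
exact: (continuous_cvg _ (@continuous_expR _ _) c2).
Qed.

(** A path whose action does not exceed the limit of the lower bounds moves
    with the optimal speed almost everywhere. For each momentum q the positive
    part of q phi' - hamil phi q - G_n is at most the Lagrangian minus G_n,
    whose integral tends to 0; by Fatou's lemma the limiting momentum is almost
    surely at least as good as q, hence optimal. *)
Lemma action_eq_speed (beta l : R) (b : nat -> R) : `|beta| <= 1 ->
  (forall n, `|b n| < 1) -> b n @[n --> \oo] --> beta ->
  value t (b n) t (phi t) - value t (b n) 0 (phi 0) @[n --> \oo] --> l ->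
  (\int[mu]_(s in `[0%R, t]) lagrangian (phi s) (derive1 phi s) <= l%:E)%E ->
  {ae mu, forall s, 0 < s < t -> derivable phi s 1 /\
     derive1 phi s = speed (phi s) (momentum t beta s)}.
Proof.
move=> beta1 b1 bb lV lL.
have [G HG] := choice (fun n => value_density t0 aphi phi1 (b1 n)).
have [g [ig gE]] := abs_continuous_density (ltW t0) aphi.
have dE := ae_density_derive ig gE.
pose psi := phi \o clamp t.
have cpsi : continuous psi by apply: ac_continuous; apply: ac_clamp => //; exact: ltW.
have ig' : mu.-integrable `[0, t] (EFin \o g) by apply: integrableS ig.
have mD : measurable (`[0, t]%classic : set (measurableTypeR R)) by exact: measurable_itv.
have claim (q : R) : {ae mu, forall s, 0 < s < t ->
    q * derive1 phi s - hamil (phi s) q <= gain t phi beta s}.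
  (* psi and g agree almost everywhere on [0, t] with phi and its derivative,
     and make the integrability of h visible. *)
  pose h s := q * g s - hamil (psi s) q.
  have ih : mu.-integrable `[0, t] (EFin \o h).
    rewrite (_ : _ \o _ = (fun s => q%:E * (g s)%:E - (hamil (psi s) q)%:E))%E//.
    apply: integrableB => //; first exact: integrableZl.
    apply: continuous_compact_integrable; first exact: segment_compact.
    apply: continuous_subspaceT => s; rewrite /hamil.
    apply: cvgD; (apply: cvgM; last exact: cvg_cst); (apply: cvgM; last exact: cvg_cst).
      by apply: cvgD; [exact: cvg_cst|exact: cpsi].
    by apply: cvgB; [exact: cvg_cst|exact: cpsi].
  pose e n s := ((h s - G n s)%:E : \bar R).
  have ie n : mu.-integrable `[0, t] (e n).
    have [iG _ _] := HG n.
    by rewrite (_ : e n = (EFin \o h) \- (EFin \o G n))%E//; apply: integrableB.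
  have epE n s : (e n)^\+%E s = (Num.max (h s - G n s) 0)%:E.
    by rewrite funeposE /e -EFin_max.
  have iep n := integrable_funepos mD (ie n).
  have mep n := measurable_int mu (iep n).
  have Ie n : (\int[mu]_(s in `[0%R, t]) (e n)^\+ s <=
      (l - (value t (b n) t (phi t) - value t (b n) 0 (phi 0)))%:E)%E.
    have [iG GE GI] := HG n.
    rewrite EFinB -GI leeBrDr; last by rewrite GI.
    rewrite -integralD//.
    apply: le_trans lL; apply: ae_le_integral_lower => //.
    - exact: integrableD.
    - by move=> s /=; rewrite in_itv/= => /phi1 /lagrangian_ge0.
    - apply: ae_itvcc; move: GE dE.
      apply: filterS2; first exact: (ae_filter_ringOfSetsType mu).
      move=> s GE dE st; have [_ gs] := dE st.
      have s_itv : 0 <= s <= t by lra.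
      have ps : psi s = phi s by rewrite /psi/= clamp_id.
      rewrite epE /= -EFinD maxEle; case: ifPn => _.
        by rewrite add0r GE//; exact: gain_le_lagrangian.
      by rewrite subrK /h ps -gs; apply: fenchel; exact: phi1.
  have e0 : (\int[mu]_(s in `[0%R, t]) (e n)^\+ s @[n --> \oo] --> 0)%E.
    apply: (@squeeze_cvge _ _ _ _ (cst 0%E) _
      (fun n => (l - (value t (b n) t (phi t) - value t (b n) 0 (phi 0)))%:E)).
    - by near=> n; rewrite Ie andbT; apply: integral_ge0 => s _; exact: funepos_ge0.
    - exact: cvg_cst.
    - apply: cvg_EFin; first by near=> n.
      have C : l - (value t (b n) t (phi t) - value t (b n) 0 (phi 0)) @[n --> \oo] --> l - l.
        by apply: cvgB => //; exact: cvg_cst.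
      by rewrite subrr in C.
  have := ae_limn_einf0 mD mep (fun n s _ => funepos_ge0 _ _) e0.
  have aG : {ae mu, forall s, forall n, 0 < s < t -> G n s = gain t phi (b n) s}.
    apply/ae_foralln => n; by have [] := HG n.
  move: aG dE; apply: filterS3; first exact: (ae_filter_ringOfSetsType mu).
  move=> s aG dE aE st; have [_ gs] := dE st.
  have s_itv : `[0, t]%classic s by rewrite /= in_itv/=; lra.
  have ps : psi s = phi s by rewrite /psi/= clamp_id//; lra.
  have := aE s_itv.
  have cG : G n s @[n --> \oo] --> gain t phi beta s.
    under eq_fun do rewrite aG//.
    exact: gain_cvg.
  have ce : (e n)^\+%E s @[n --> \oo] --> (Num.max (h s - gain t phi beta s) 0)%:E.
    under eq_fun do rewrite epE.
    apply: cvg_EFin; first by near=> n.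
    have c1 : h s - G n s @[n --> \oo] --> h s - gain t phi beta s.
      by apply: cvgB => //; exact: cvg_cst.
    rewrite maxr_absE; under eq_fun do rewrite maxr_absE.
    apply: cvgM; last exact: cvg_cst.
    apply: cvgD; first by apply: cvgD => //; exact: cvg_cst.
    by apply: cvg_norm; apply: cvgB => //; exact: cvg_cst.
  have [-> _] := cvg_limn_einf_sup ce.
  rewrite /h ps gs => -[] max0.
  by rewrite -subr_le0 -max0 le_max lexx.
have aQ := ae_foralln (fun n => claim (ratr (odflt 0 (unpickle n : option rat)))).
apply: (@filterS2 _ _ (ae_filter_ringOfSetsType mu) _ _ _ _ aQ dE).
move=> s H {}dE st; have [ds _] := dE st; split => //.
apply: speed_unique => [|q]; first by apply: phi1; case/andP: st => ? ?; rewrite !ltW.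
by have := H (pickle q) st; rewrite pickleK.
Unshelve. all: by end_near. Qed.

End tight.

(** * The potential and the Gibbs variational principle *)

Section weight.
Variable R : realType.
Implicit Types (e c y a m : R).

(** The weight, in a field y, of a spin that has become c when e is the
    correlation of a spin with its initial value. *)
Definition W e c y := (1 + e * c) / 2 * expR y + (1 - e * c) / 2 * expR (- y).
Definition ch y : R := (expR y + expR (- y)) / 2.
Definition sh y : R := (expR y - expR (- y)) / 2.

Lemma WE e c y : W e c y = ch y + e * c * sh y.
Proof. by rewrite /W /ch /sh; field. Qed.

Lemma ch_sh y : `|sh y| < ch y.
Proof.
have := expR_gt0 y; have := expR_gt0 (- y).
by rewrite /ch /sh ltr_norml => ? ?; apply/andP; split; lra.
Qed.

Lemma ch_gt0 y : 0 < ch y.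
Proof. exact: le_lt_trans (normr_ge0 _) (ch_sh y). Qed.

Lemma mul_sh_lt e y : -1 <= e <= 1 -> 0 < ch y + e * sh y.
Proof.
move=> e1; have h : `|e * sh y| <= `|sh y|.
  by rewrite normrM ler_piMl// ler_norml.
by have := le_lt_trans h (ch_sh y); rewrite ltr_norml => /andP[]; lra.
Qed.

Lemma W_gt0 e c y : -1 <= e * c <= 1 -> 0 < W e c y.
Proof. by move=> ?; rewrite WE mul_sh_lt. Qed.

(** The exponential rate of the integrals that represent the kernel. Up to a
    constant, its negative bounds from below the rate of the paths from x to a,
    and the bound is attained when x is a critical point. *)
Definition Phi e J h a x :=
  - (J * x ^+ 2 / 2) + (1 + a) / 2 * ln (W e 1 (J * x + h))
                     + (1 - a) / 2 * ln (W e (- 1) (J * x + h)).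

(** Nonnegativity of the relative entropy, for unnormalised weights. *)
Lemma entropy_ge p q : 0 <= p -> 0 < q -> p - q <= p * (ln p - ln q) :> R.
Proof.
rewrite le_eqVlt => /predU1P[<- q0|p0 q0]; first by rewrite mul0r; lra.
have : ln (1 + (q / p - 1)) <= q / p - 1.
  by apply: le_ln1Dx; rewrite ltrBrDr addNr divr_gt0.
rewrite addrC subrK ln_div ?posrE// => H.
have : p * (ln q - ln p) <= p * (q / p - 1) by rewrite ler_pM2l.
have -> : p * (q / p - 1) = q - p by field; lra.
lra.
Qed.

(** Free energy is minimal at the Gibbs mean, where it is minus the logarithm of
    the partition function (gibbs_equality). *)
Lemma gibbs_variational m y u v : -1 <= m <= 1 -> 0 < u -> 0 < v ->
  - ln ((expR y * u + expR (- y) * v) / 2) <=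
  Ibar m - y * m - (1 + m) / 2 * ln u - (1 - m) / 2 * ln v.
Proof.
move=> /andP[m1 m2] u0 v0; set Z := (expR y * u + expR (- y) * v) / 2.
have eu : 0 < expR y * u by rewrite mulr_gt0 ?expR_gt0.
have ev : 0 < expR (- y) * v by rewrite mulr_gt0 ?expR_gt0.
have Z0 : 0 < Z by rewrite /Z; lra.
have ZE : Z = (expR y * u + expR (- y) * v) / 2 by [].
clearbody Z.
have p0 : 0 <= 1 + m by lra.
have q0 : 0 <= 1 - m by lra.
have := entropy_ge p0 (divr_gt0 eu Z0); have := entropy_ge q0 (divr_gt0 ev Z0).
rewrite !ln_div ?posrE// !lnM ?posrE ?expR_gt0// !expRK /Ibar.
have : expR y * u / Z + expR (- y) * v / Z = 2.
  by rewrite -mulrDl ZE; field; rewrite gt_eqF//; lra.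
lra.
Qed.

Lemma gibbs_equality m y u v : 0 < u -> 0 < v ->
  m = (expR y * u - expR (- y) * v) / (expR y * u + expR (- y) * v) ->
  Ibar m - y * m - (1 + m) / 2 * ln u - (1 - m) / 2 * ln v =
  - ln ((expR y * u + expR (- y) * v) / 2).
Proof.
move=> u0 v0 ->; set Z := (expR y * u + expR (- y) * v) / 2.
have eu : 0 < expR y * u by rewrite mulr_gt0 ?expR_gt0.
have ev : 0 < expR (- y) * v by rewrite mulr_gt0 ?expR_gt0.
have Z0 : 0 < Z by rewrite /Z; lra.
have ZE : Z = (expR y * u + expR (- y) * v) / 2 by [].
clearbody Z.
set m0 := _ / (_ + _).
have -> : Ibar m0 = (1 + m0) / 2 * ln (expR y * u / Z) + (1 - m0) / 2 * ln (expR (- y) * v / Z).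
  by rewrite /Ibar; congr (_ * ln _ + _ * ln _); rewrite /m0 ZE; field; rewrite gt_eqF// addr_gt0.
rewrite !ln_div ?posrE// !lnM ?posrE ?expR_gt0// !expRK; by field.
Qed.

End weight.

Section optimal_beta.
Variable R : realType.
Variables (e a y : R).
Hypotheses (e01 : 0 < e < 1) (a1 : -1 <= a <= 1).

Let Wp := W e 1 y.
Let Wm := W e (- 1) y.

Let Wp0 : 0 < Wp.
Proof.
case/andP: e01 => e0 e1; apply: W_gt0; rewrite mulr1; apply/andP; split; lra.
Qed.

Let Wm0 : 0 < Wm.
Proof.
case/andP: e01 => e0 e1; apply: W_gt0; rewrite mulrN1; apply/andP; split; lra.
Qed.

(** The terminal data of the backward equation for which the path from the
    Gibbs mean in the field y ends at a: the terminal values of the solution are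
    proportional to (1 + a) / W_+ and (1 - a) / W_-. *)
Definition norm_const := 2 / ((1 + a) / Wp + (1 - a) / Wm).
Definition opt_beta := norm_const * ((1 + a) / Wp - (1 - a) / Wm) / 2.

Let den_gt0 : 0 < (1 + a) / Wp + (1 - a) / Wm.
Proof.
have a1' := a1.
have p0 : 0 <= (1 + a) / Wp by rewrite divr_ge0 ?(ltW Wp0)//; lra.
have q0 : 0 <= (1 - a) / Wm by rewrite divr_ge0 ?(ltW Wm0)//; lra.
rewrite lt0r addr_ge0// andbT paddr_eq0// negb_and !mulf_eq0 !invr_eq0.
rewrite (gt_eqF Wp0) (gt_eqF Wm0) !orbF -negb_and; apply/negP => /andP[/eqP ? /eqP ?].
lra.
Qed.

Let num_neq0 : (1 + a) * Wm + (1 - a) * Wp != 0.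
Proof.
rewrite (_ : _ + _ = ((1 + a) / Wp + (1 - a) / Wm) * (Wp * Wm)).
  by rewrite gt_eqF// !mulr_gt0.
by field; rewrite !gt_eqF.
Qed.

Lemma norm_const_gt0 : 0 < norm_const.
Proof. by rewrite divr_gt0. Qed.

Lemma opt_betaP : 1 + opt_beta = norm_const * (1 + a) / Wp.
Proof.
rewrite /opt_beta /norm_const.
by field; rewrite num_neq0 !gt_eqF.
Qed.

Lemma opt_betaN : 1 - opt_beta = norm_const * (1 - a) / Wm.
Proof.
rewrite /opt_beta /norm_const.
by field; rewrite num_neq0 !gt_eqF.
Qed.

Lemma opt_beta_le1 : `|opt_beta| <= 1.
Proof.
have c0 := norm_const_gt0; have a1' := a1.
have : 0 <= 1 + opt_beta by rewrite opt_betaP divr_ge0 ?(ltW Wp0)// mulr_ge0 ?(ltW c0)//; lra.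
have : 0 <= 1 - opt_beta by rewrite opt_betaN divr_ge0 ?(ltW Wm0)// mulr_ge0 ?(ltW c0)//; lra.
by rewrite ler_norml => *; apply/andP; split; lra.
Qed.

(** The normalisation is the partition function of the initial spin in the
    field y, tilted by the solution at time 0. *)
Lemma norm_constE : norm_const = ch y + e * opt_beta * sh y.
Proof.
have h1 : (1 + opt_beta) * Wp = norm_const * (1 + a).
  by rewrite opt_betaP divfK// gt_eqF.
have h2 : (1 - opt_beta) * Wm = norm_const * (1 - a).
  by rewrite opt_betaN divfK// gt_eqF.
have := h1; have := h2; rewrite /Wp /Wm !WE; lra.
Qed.

Lemma terminal_value :
  (1 + a) / 2 * ln (1 + opt_beta) + (1 - a) / 2 * ln (1 - opt_beta) =
  ln norm_const + Ibar a - (1 + a) / 2 * ln Wp - (1 - a) / 2 * ln Wm.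
Proof.
have c0 := norm_const_gt0; have a1' := a1.
have E (k p w : R) : 0 < k -> 0 <= p -> 0 < w ->
    p / 2 * ln (k * p / w) = p / 2 * (ln k + ln p - ln w).
  move=> k0; rewrite le_eqVlt => /predU1P[<- _|p0 w0]; first by rewrite !mul0r.
  by rewrite ln_div ?posrE ?mulr_gt0// lnM ?posrE.
rewrite opt_betaP opt_betaN !E//; try lra.
by rewrite /Ibar; field.
Qed.

End optimal_beta.

(** * The lower bound on the rate *)

Section lower.
Variable R : realType.
Variables (t J h a : R).
Hypotheses (t0 : 0 < t) (a1 : -1 <= a <= 1).

Definition eps (t : R) := expR (- (2 * t)).
Let e := eps t.

Lemma eps01 : 0 < eps t < 1.
Proof. by rewrite /eps expR_gt0 expR_lt1 oppr_lt0 mulr_gt0. Qed.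

(** When a = 1 or -1 the optimal terminal parameter has modulus 1; it is
    approached from inside, where the lower bound on the action holds. *)
Definition approx_beta (beta : R) (n : nat) := beta * (1 - n.+2%:R^-1).

Lemma approx_beta_lt1 beta n : `|beta| <= 1 -> `|approx_beta beta n| < 1.
Proof.
move=> b1; have n0 : (0 : R) < n.+2%:R^-1 by rewrite invr_gt0.
have n1 : n.+2%:R^-1 < (1 : R) by rewrite invf_lt1// ltr1n.
rewrite /approx_beta; move: (n.+2%:R^-1) n0 n1 => k k0 k1.
have k2 : 0 <= 1 - k by lra.
rewrite normrM (ger0_norm k2); apply: le_lt_trans (ler_wpM2r k2 b1) _.
by rewrite mul1r; lra.
Qed.

Lemma approx_beta_cvg beta : approx_beta beta n @[n --> \oo] --> beta.
Proof.
rewrite -[X in _ --> X]mulr1; apply: cvgM; first exact: cvg_cst.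
rewrite -[X in _ --> X]subr0; apply: cvgB; first exact: cvg_cst.
have := @cvg_harmonic R; rewrite -(cvg_shiftS _) => H.
exact: H.
Qed.

Definition limit_bound beta m :=
  (1 + a) / 2 * ln (1 + beta) + (1 - a) / 2 * ln (1 - beta) -
  ((1 + m) / 2 * ln (1 + e * beta) + (1 - m) / 2 * ln (1 - e * beta)).

(** The terminal terms whose logarithm tends to -oo carry the factor 1 + a or
    1 - a, which vanishes just then. *)
Lemma value_approx_cvg y m (beta := opt_beta e a y) :
  value t (approx_beta beta n) t a - value t (approx_beta beta n) 0 m
    @[n --> \oo] --> limit_bound beta m.
Proof.
have ab := @approx_beta_cvg beta.
have b1 := opt_beta_le1 y eps01 a1; rewrite -/e -/beta in b1.
have e01 := eps01; rewrite -/e in e01.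
have eb : `|e * beta| < 1.
  by rewrite normrM; have := ger0_norm (ltW (andP e01).1) => ->; nra.
have [u0 v0] : 0 < 1 + e * beta /\ 0 < 1 - e * beta.
  by move: eb; rewrite ltr_norml => /andP[]; split; lra.
have lim (k c : R) : (0 < 1 + c * beta) \/ k = 0 ->
    k / 2 * ln (1 + c * approx_beta beta n) @[n --> \oo] --> k / 2 * ln (1 + c * beta).
  move=> [c0|->]; last first.
    by under eq_fun do rewrite !mul0r; rewrite !mul0r; exact: cvg_cst.
  apply: cvgM; first exact: cvg_cst.
  apply: (continuous_cvg _ (continuous_ln c0)).
  by apply: cvgD; [exact: cvg_cst|apply: cvgM => //; exact: cvg_cst].
have c0 := norm_const_gt0 y eps01 a1; rewrite -/e in c0.
apply: cvgB.
  rewrite (_ : (fun n => _) = fun n => (1 + a) / 2 * ln (1 + 1 * approx_beta beta n)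
      + (1 - a) / 2 * ln (1 + (- 1) * approx_beta beta n)); last first.
    by apply/funext => n; rewrite /value /up /um subrr mulr0 expR0 !mulr1 mul1r mulN1r.
  have -> : (1 + a) / 2 * ln (1 + beta) + (1 - a) / 2 * ln (1 - beta) =
    (1 + a) / 2 * ln (1 + 1 * beta) + (1 - a) / 2 * ln (1 + (- 1) * beta).
    by rewrite mul1r mulN1r.
  apply: cvgD; apply: lim; rewrite ?mul1r ?mulN1r.
    have [a0|a0] := eqVneq (1 + a) 0; first by right.
    left; have p0 : 0 < 1 + a.
      by rewrite lt_neqAle eq_sym a0 andTb; case/andP: a1; lra.
    rewrite (opt_betaP y eps01 a1) divr_gt0//; first exact: mulr_gt0.
    by case/andP: eps01 => ? ?; apply: W_gt0; rewrite mulr1; apply/andP; split; lra.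
  have [a0|a0] := eqVneq (1 - a) 0; first by right.
  left; have p0 : 0 < 1 - a.
    by rewrite lt_neqAle eq_sym a0 andTb; case/andP: a1; lra.
  rewrite (opt_betaN y eps01 a1) divr_gt0//; first exact: mulr_gt0.
  by case/andP: eps01 => ? ?; apply: W_gt0; rewrite mulrN1; apply/andP; split; lra.
rewrite (_ : (fun n => _) = fun n => (1 + m) / 2 * ln (1 + e * approx_beta beta n)
      + (1 - m) / 2 * ln (1 + (- e) * approx_beta beta n)); last first.
  apply/funext => n; rewrite /value /up /um sub0r mulrN -/(eps t) -/e.
  by rewrite mulNr ![e * _]mulrC.
have -> : (1 + m) / 2 * ln (1 + e * beta) + (1 - m) / 2 * ln (1 - e * beta) =
    (1 + m) / 2 * ln (1 + e * beta) + (1 - m) / 2 * ln (1 + (- e) * beta).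
  by rewrite mulNr.
by apply: cvgD; apply: lim; left => //; rewrite mulNr.
Qed.

(** The Gibbs mean in the field y, tilted by the optimal solution: the initial
    point of the optimal path. *)
Definition start y := (sh y + e * opt_beta e a y * ch y) / norm_const e a y.

Lemma limit_bound_ge m (y := J * m + h) : -1 <= m <= 1 ->
  Ibar a - Phi e J h a m <= IS J h m + limit_bound (opt_beta e a y) m.
Proof.
move=> m1; have b1 := opt_beta_le1 y eps01 a1; rewrite -/e in b1.
have e01 := eps01; rewrite -/e in e01.
have eb : `|e * opt_beta e a y| < 1.
  by rewrite normrM; have := ger0_norm (ltW (andP e01).1) => ->; nra.
have [u0 v0] : 0 < 1 + e * opt_beta e a y /\ 0 < 1 - e * opt_beta e a y.
  by move: eb; rewrite ltr_norml => /andP[]; split; lra.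
have := gibbs_variational y m1 u0 v0.
have -> : (expR y * (1 + e * opt_beta e a y) + expR (- y) * (1 - e * opt_beta e a y)) / 2
   = norm_const e a y.
  by rewrite (norm_constE y eps01 a1) -/e /ch /sh; field.
rewrite /limit_bound (terminal_value y eps01 a1) /Phi /IS /Hbar -/y.
have -> : h = y - J * m by rewrite /y; ring.
lra.
Qed.

Lemma limit_bound_eq m (y := J * m + h) : m = start y ->
  IS J h m + limit_bound (opt_beta e a y) m = Ibar a - Phi e J h a m.
Proof.
move=> mE; have b1 := opt_beta_le1 y eps01 a1; rewrite -/e in b1.
have e01 := eps01; rewrite -/e in e01.
have eb : `|e * opt_beta e a y| < 1.
  by rewrite normrM; have := ger0_norm (ltW (andP e01).1) => ->; nra.
have [u0 v0] : 0 < 1 + e * opt_beta e a y /\ 0 < 1 - e * opt_beta e a y.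
  by move: eb; rewrite ltr_norml => /andP[]; split; lra.
have c0 := norm_const_gt0 y eps01 a1; rewrite -/e in c0.
have nE : expR y * (1 + e * opt_beta e a y) + expR (- y) * (1 - e * opt_beta e a y)
   = 2 * norm_const e a y.
  by rewrite (norm_constE y eps01 a1) -/e /ch /sh; field.
have := @gibbs_equality _ m y _ _ u0 v0; rewrite nE.
have -> : 2 * norm_const e a y / 2 = norm_const e a y by field.
have -> : (expR y * (1 + e * opt_beta e a y) - expR (- y) * (1 - e * opt_beta e a y)) /
  (2 * norm_const e a y) = start y.
  by rewrite /start /ch /sh; field; rewrite gt_eqF.
move=> /(_ mE).
rewrite /limit_bound (terminal_value y eps01 a1) /Phi /IS /Hbar -/y.
have -> : h = y - J * m by rewrite /y; ring.
lra.
Qed.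

Lemma paths_toP phi : paths_to t a phi ->
  (forall s, 0 <= s <= t -> -1 <= phi s <= 1) /\ phi t = a.
Proof. by move=> [[]]. Qed.

(** The free parameter of the lower bound on the action is chosen according to
    the initial slope J phi(0) + h of the quadratic part. *)
Lemma rate_ge phi : paths_to t a phi ->
  ((Ibar a - Phi e J h a (phi 0))%:E <= rate J h t phi)%E.
Proof.
move=> /paths_toP[phi1 phit]; rewrite /rate /ID; case: asboolP => [aphi|_]; last first.
  by rewrite addey// leey.
have m1 : -1 <= phi 0 <= 1 by apply: phi1; rewrite lexx ltW.
set y := J * phi 0 + h.
apply: le_trans (_ : (IS J h (phi 0) + limit_bound (opt_beta e a y) (phi 0))%:E <= _)%E.
  by rewrite lee_fin limit_bound_ge.
rewrite EFinD leeD2l//.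
have b1 n : `|approx_beta (opt_beta e a y) n| < 1.
  by apply: approx_beta_lt1; exact: (opt_beta_le1 y eps01 a1).
have H n := action_ge t0 aphi phi1 (b1 n).
set I := (\int[_]_(_ in _) _)%E in H *.
case EI : I H => [i| |] H; last 2 first.
- by rewrite leey.
- by have := H 0%N.
rewrite lee_fin; have V := @value_approx_cvg y (phi 0).
rewrite -(cvg_lim _ V)//; apply: limr_le; first by apply/cvg_ex; eexists; exact: V.
by near=> n; have := H n; rewrite lee_fin phit.
Unshelve. all: by end_near. Qed.

End lower.

(** * The optimal path *)

Section optimal.
Variable R : realType.
Variables (t a y : R).
Hypotheses (t0 : 0 < t) (a1 : -1 <= a <= 1).

Let e := eps t.
Let beta := opt_beta e a y.
Let nc := norm_const e a y.

(** The solution of phi' = speed phi (momentum), which is a linear equation. *)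
Definition opt_path (s : R) :=
  (beta * ch y * expR (2 * (s - t)) + sh y * expR (- (2 * s))) / nc.

Let nc0 : 0 < nc. Proof. exact: norm_const_gt0 (eps01 t0) a1. Qed.
Let ncE : nc = ch y + e * beta * sh y. Proof. exact: norm_constE (eps01 t0) a1. Qed.
Let beta1 : `|beta| <= 1. Proof. exact: opt_beta_le1 (eps01 t0) a1. Qed.

Lemma beta_expR_lt1 s : s < t -> `|beta| * expR (2 * (s - t)) < 1.
Proof.
move=> st; apply: le_lt_trans (ler_wpM2r (expR_ge0 _) beta1) _.
by rewrite mul1r expR_lt1; lra.
Qed.

Lemma opt_path0 : opt_path 0 = start t a y.
Proof.
rewrite /opt_path /start -/e -/beta -/nc mulr0 oppr0 expR0 sub0r mulrN.
by rewrite -/(eps t) -/e; congr (_ / _); ring.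
Qed.

Let expE s : expR (2 * (s - t)) * expR (- (2 * s)) = e.
Proof. by rewrite -expRD /e /eps; congr expR; ring. Qed.

(** Twice the fraction of spins 1 at time s factors into a forward and a backward
    solution of the equation of one spin. *)
Lemma opt_pathP s : 1 + opt_path s = (ch y + expR (- (2 * s)) * sh y) * up t beta s / nc.
Proof.
have := expE s; have := ncE; rewrite /opt_path /up.
move: (expR (2 * (s - t))) (expR (- (2 * s))) => E F nE EF.
have -> : (ch y + F * sh y) * (1 + beta * E) = nc + (beta * ch y * E + sh y * F).
  by rewrite nE -EF; ring.
by rewrite [RHS]mulrDl divff// gt_eqF.
Qed.

Lemma opt_pathN s : 1 - opt_path s = (ch y - expR (- (2 * s)) * sh y) * um t beta s / nc.
Proof.
have := expE s; have := ncE; rewrite /opt_path /um.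
move: (expR (2 * (s - t))) (expR (- (2 * s))) => E F nE EF.
have -> : (ch y - F * sh y) * (1 - beta * E) = nc - (beta * ch y * E + sh y * F).
  by rewrite nE -EF; ring.
by rewrite [RHS]mulrBl divff// gt_eqF.
Qed.

Lemma opt_path_end : opt_path t = a.
Proof.
have := opt_pathP t; rewrite /up subrr mulr0 expR0 mulr1.
have -> : 1 + beta = nc * (1 + a) / W e 1 y by exact: opt_betaP (eps01 t0) a1.
rewrite -[expR _]/e WE mulr1.
have : 0 < ch y + e * sh y by apply: mul_sh_lt; have := eps01 t0; rewrite -/e; lra.
move=> w0 E; suff : 1 + opt_path t = 1 + a by lra.
by rewrite E; field; rewrite !gt_eqF.
Qed.

Lemma expRN_itv (s : R) : 0 <= s -> 0 < expR (- (2 * s)) <= 1.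
Proof. by move=> s0; rewrite expR_gt0 /= expR_le1; lra. Qed.

Let sh_lt (s : R) (c : R) : 0 <= s -> c = 1 \/ c = -1 ->
  0 < ch y + c * expR (- (2 * s)) * sh y.
Proof.
by move=> /expRN_itv/andP[s0 s1] [->|->]; apply: mul_sh_lt; apply/andP; split; lra.
Qed.

Lemma opt_path_lt s : 0 <= s < t -> -1 < opt_path s < 1.
Proof.
move=> /andP[s0 st]; have [u0 m0] := u_gt0 (beta_expR_lt1 st) (lexx s).
have p1 := opt_pathP s; have p2 := opt_pathN s.
have h1 := sh_lt s0 (or_introl erefl); have h2 := sh_lt s0 (or_intror erefl).
rewrite mul1r in h1; rewrite mulN1r mulNr in h2.
have : 0 < 1 + opt_path s by rewrite p1 !mulr_gt0// invr_gt0.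
have : 0 < 1 - opt_path s by rewrite p2 !mulr_gt0// invr_gt0.
by move=> ? ?; apply/andP; split; lra.
Qed.

Lemma opt_path_itv s : 0 <= s <= t -> -1 <= opt_path s <= 1.
Proof.
move=> /andP[s0]; rewrite le_eqVlt => /predU1P[->|st]; first by rewrite opt_path_end.
by have /andP[] := opt_path_lt (introT andP (conj s0 st)) => ? ?; apply/andP; split; exact: ltW.
Qed.

Lemma is_derive_opt_path s : is_derive s (1 : R) opt_path
  (2 * (beta * ch y * expR (2 * (s - t)) - sh y * expR (- (2 * s))) / nc).
Proof.
rewrite /opt_path; apply: is_derive_eq; rewrite /GRing.scale/=; by ring.
Qed.

(** In the factorised form, the factor exp (2 p) = up / um of the speed replaces
    um by up in 1 - phi, and its inverse does the converse in 1 + phi. *)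
Lemma opt_path_speed s : 0 <= s < t ->
  is_derive s (1 : R) opt_path (speed (opt_path s) (momentum t beta s)).
Proof.
move=> /andP[s0 st]; have [u0 m0] := u_gt0 (beta_expR_lt1 st) (lexx s).
rewrite /speed expRN expR_momentum// opt_pathN opt_pathP.
apply: is_derive_eq (is_derive_opt_path s) _.
have := expE s; rewrite /up /um in u0 m0 *.
move: (expR (2 * (s - t))) (expR (- (2 * s))) u0 m0 => E F u0 m0 EF.
by field; rewrite !gt_eqF.
Qed.

Lemma continuous_opt_path : continuous opt_path.
Proof. by move=> s; exact: is_derive_continuous (is_derive_opt_path s). Qed.

Lemma opt_path_paths_to : paths_to t a opt_path.
Proof.
split; last exact: opt_path_end.
split; first exact: opt_path_itv.
  by move=> s _; apply: cvg_within_filter; exact: continuous_opt_path.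
move=> s _; apply/cvg_ex; exists (opt_path s).
by apply: cvg_within_filter; exact: continuous_opt_path.
Qed.

Lemma opt_path_ac : abs_continuous t opt_path.
Proof.
have cd : continuous (fun s => 2 * (beta * ch y * expR (2 * (s - t)) - sh y * expR (- (2 * s))) / nc).
  move=> s; have D : is_derive s (1 : R) (fun s => 2 * (beta * ch y * expR (2 * (s - t)) - sh y * expR (- (2 * s))) / nc) (4 * opt_path s).
    rewrite /opt_path; apply: is_derive_eq; rewrite /GRing.scale/=; by ring.
  exact: is_derive_continuous D.
have [M M0 HM] := C1_lipschitz (ltW t0) (fun s _ => is_derive_opt_path s)
   (continuous_subspaceT cd).
apply: (@abs_continuous_lipschitz _ t M idfun) => //; last first.
  move=> x z xt zt; apply: le_trans (HM _ _ xt zt) _.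
  by rewrite ler_wpM2l// lerDl.
move=> d d0; exists d => // n b c bc _; apply: le_lt_trans.
by apply: ler_sum => i _; rewrite ger0_norm// subr_ge0; have [_ []] := bc i.
Qed.

End optimal.

Section attained.
Variable R : realType.
Notation mu := (@lebesgue_measure R).
Variables (t a y : R).
Hypotheses (t0 : 0 < t) (a1 : -1 <= a <= 1).

Let e := eps t.
Let beta := opt_beta e a y.
Let phi := opt_path t a y.

Let beta1 : `|beta| <= 1. Proof. exact: opt_beta_le1 (eps01 t0) a1. Qed.
Let Hlt s : s < t -> `|beta| * expR (2 * (s - t)) < 1.
Proof. exact: beta_expR_lt1. Qed.

Lemma is_derive_momentum s : 0 < up t beta s -> 0 < um t beta s ->
  is_derive s (1 : R) (momentum t beta)
    ((2 * (up t beta s - 1) / up t beta s - 2 * (um t beta s - 1) / um t beta s) / 2).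
Proof.
move=> u0 m0; have Du := is_derive_ln u0 (is_derive_up t beta s).
have Dm := is_derive_ln m0 (is_derive_um t beta s).
rewrite /momentum; apply: is_derive_eq; rewrite /GRing.scale/=; by field; rewrite !gt_eqF.
Qed.

Let dphi s : derivable phi s 1.
Proof. have D := is_derive_opt_path t a y s; exact: ex_derive. Qed.

Lemma lagrangian_opt_path s : 0 <= s < t ->
  lagrangian (phi s) (derive1 phi s) = (gain t phi beta s)%:E.
Proof.
move=> st; have D := opt_path_speed y t0 a1 st.
have vE : derive1 phi s = speed (phi s) (momentum t beta s).
  by rewrite derive1E (@derive_val _ _ _ _ _ _ _ D).
rewrite /gain vE /lagrangian (opt_path_lt y t0 a1 st) lagrangian_int_speed//.
exact: opt_path_lt.
Qed.

Lemma continuous_gain s : s < t -> {for s, continuous (gain t phi beta)}.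
Proof.
move=> st; have [u0 m0] := u_gt0 (Hlt st) (lexx s).
have cm : {for s, continuous (momentum t beta)}.
  exact: is_derive_continuous (is_derive_momentum u0 m0).
have cphi : {for s, continuous phi} by exact: continuous_opt_path.
have cd : {for s, continuous (derive1 phi)}.
  have -> : derive1 phi = fun s => 2 * (beta * ch y * expR (2 * (s - t)) - sh y * expR (- (2 * s))) / norm_const e a y.
    apply/funext => z; rewrite derive1E.
    by have D := is_derive_opt_path t a y z; rewrite (@derive_val _ _ _ _ _ _ _ D).
  have D : is_derive s (1 : R) (fun s => 2 * (beta * ch y * expR (2 * (s - t)) - sh y * expR (- (2 * s))) / norm_const e a y) (4 * phi s).
    rewrite /phi /opt_path -/e -/beta; apply: is_derive_eq; rewrite /GRing.scale/=; by ring.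
  exact: is_derive_continuous D.
have c2 : 2 * momentum t beta z @[z --> s] --> 2 * momentum t beta s.
  by apply: cvgM => //; exact: cvg_cst.
rewrite /gain; apply: cvgB; first exact: cvgM.
apply: cvgD; apply: cvgM.
- by apply: cvgM; [apply: cvgD => //; exact: cvg_cst|exact: cvg_cst].
- apply: cvgB; last exact: cvg_cst.
  by apply: (continuous_cvg _ (@continuous_expR _ _)); exact: cvgN.
- by apply: cvgM; [apply: cvgB => //; exact: cvg_cst|exact: cvg_cst].
- apply: cvgB; last exact: cvg_cst.
  exact: (continuous_cvg _ (@continuous_expR _ _) c2).
Qed.

Let V s := value t beta s (phi s).

Let dV s : s < t -> is_derive s (1 : R) V (gain t phi beta s).
Proof.
move=> st; have [u0 m0] := u_gt0 (Hlt st) (lexx s).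
exact: (@is_derive_value R t beta phi s u0 m0 (@dphi s)).
Qed.

Lemma opt_action_partial r : 0 < r < t ->
  (\int[mu]_(s in `[0%R, r]) lagrangian (phi s) (derive1 phi s) = (V r - V 0)%:E)%E.
Proof.
move=> /andP[r0 rt].
have -> : (\int[mu]_(s in `[0%R, r]) lagrangian (phi s) (derive1 phi s) =
    \int[mu]_(s in `[0%R, r]) (gain t phi beta s)%:E)%E.
  apply: eq_integral => s /set_mem; rewrite /= in_itv/= => /andP[s0 sr].
  by apply: lagrangian_opt_path; rewrite s0 (le_lt_trans sr).
rewrite EFinB; apply: continuous_FTC2 => //.
- apply: continuous_within => s /andP[s0 sr].
  exact: continuous_gain (le_lt_trans sr rt).
- split.
  + move=> s; rewrite in_itv/= => /andP[s0 sr].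
    have D := dV (lt_trans sr rt); exact: ex_derive.
  + by apply: cvg_within_filter; exact: is_derive_continuous (dV t0).
  + by apply: cvg_within_filter; exact: is_derive_continuous (dV rt).
- move=> s; rewrite in_itv/= => /andP[s0 sr].
  have D := dV (lt_trans sr rt).
  by rewrite derive1E (@derive_val _ _ _ _ _ _ _ D).
Qed.

Let T := (1 + a) / 2 * ln (1 + beta) + (1 - a) / 2 * ln (1 - beta).

(** At |beta| = 1 the value function is singular at the final time. Then a is
    beta, so that the singular logarithm has final weight 0 and before the final
    time a negative value, and the value function stays below its final value
    ln 2. *)
Lemma value_end_bound : exists2 c : nat -> R, c n @[n --> \oo] --> T &
  forall n, V (approx_beta t n) <= c n.
Proof.
have rt n : 0 <= approx_beta t n < t.
  rewrite /approx_beta; have n0 : (0 : R) < n.+2%:R^-1 by rewrite invr_gt0.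
  have n1 : n.+2%:R^-1 < (1 : R) by rewrite invf_lt1// ltr1n.
  move: (n.+2%:R^-1) n0 n1 => k k0 k1; have t0' := t0; apply/andP; split; nra.
have [b1|b1] := ltP `|beta| 1.
  exists (V \o approx_beta t) => //.
  have Ht : `|beta| * expR (2 * (t - t)) < 1 by rewrite subrr mulr0 expR0 mulr1.
  have [u0 m0] := u_gt0 Ht (lexx t).
  have cV : {for t, continuous V}.
    exact: (is_derive_continuous (@is_derive_value R t beta phi t u0 m0 (@dphi t))).
  have -> : T = V t.
    by rewrite /V /value /phi (opt_path_end y t0 a1) /up /um subrr mulr0 expR0 !mulr1.
  exact: (continuous_cvg _ cV (@approx_beta_cvg _ t)).
exists (cst T) => [|n]; first exact: cvg_cst.
have /andP[s0 st] := rt n; set s := approx_beta t n in s0 st *.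
have /andP[p1 p2] : -1 <= phi s <= 1 by apply: opt_path_itv => //; rewrite s0 ltW.
have E0 : 0 < expR (2 * (s - t)) by exact: expR_gt0.
have E1 : expR (2 * (s - t)) <= 1 by rewrite expR_le1; lra.
have l2 : 0 <= ln 2 :> R by rewrite ln_ge0// ler1n.
have lnu : ln (1 + expR (2 * (s - t))) <= ln 2 by rewrite ler_ln ?posrE//; lra.
have lnm : ln (1 - expR (2 * (s - t))) <= 0 by rewrite ln_le0//; lra.
have : beta = 1 \/ beta = -1.
  have /eqP : `|beta| = 1 by apply/eqP; rewrite eq_le beta1 b1.
  by rewrite eqr_norml => /andP[/orP[/eqP|/eqP] -> _]; [left|right].
have c0 := norm_const_gt0 y (eps01 t0) a1; rewrite -/e in c0.
have w (c : R) : c = 1 \/ c = -1 -> 0 < W e c y.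
  by have := eps01 t0; rewrite -/e => /andP[? ?]; case=> ->; apply: W_gt0; rewrite ?mulr1 ?mulrN1;
    apply/andP; split; lra.
rewrite /V /value /T /up /um.
case=> bE.
  have := opt_betaN y (eps01 t0) a1; rewrite -/e -/beta bE subrr.
  move: (norm_const e a y) c0 (W e (- 1) y) (w _ (or_intror erefl)) => k k0 u u0 /esym/eqP.
  rewrite !mulf_eq0 invr_eq0 (gt_eqF u0) (gt_eqF k0) orbF /=.
  move=> /eqP aE; rewrite mul1r (_ : 1 + 1 = 2)//.
  have -> : a = 1 by lra.
  nra.
have := opt_betaP y (eps01 t0) a1; rewrite -/e -/beta bE addrN.
move: (norm_const e a y) c0 (W e 1 y) (w _ (or_introl erefl)) => k k0 u u0 /esym/eqP.
rewrite !mulf_eq0 invr_eq0 (gt_eqF u0) (gt_eqF k0) orbF /=.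
move=> /eqP aE; rewrite mulN1r !opprK (_ : 1 + 1 = 2)//.
have -> : a = -1 by lra.
nra.
Qed.

(** On [0, r] with r < t the action is the increment of the value function; the
    bound passes to the limit by monotone convergence. *)
Lemma opt_action :
  (\int[mu]_(s in `[0%R, t]) lagrangian (phi s) (derive1 phi s) <=
   (limit_bound t a beta (phi 0))%:E)%E.
Proof.
have rt n : 0 < approx_beta t n < t.
  rewrite /approx_beta; have n0 : (0 : R) < n.+2%:R^-1 by rewrite invr_gt0.
  have n1 : n.+2%:R^-1 < (1 : R) by rewrite invf_lt1// ltr1n.
  move: (n.+2%:R^-1) n0 n1 => k k0 k1; have t0' := t0; apply/andP; split; nra.
have mL : measurable_fun `[0, t[ (fun s => lagrangian (phi s) (derive1 phi s)).
  apply: (@eq_measurable_fun _ _ _ _ _ (fun s => (gain t phi beta s)%:E)).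
    move=> s /set_mem; rewrite /= in_itv/= => st.
    by rewrite lagrangian_opt_path.
  apply/measurable_EFinP; apply: (@measurable_funS _ _ _ _ `]-oo, t[) => //.
    by apply: subset_itvr; rewrite bnd_simp.
  apply: open_continuous_measurable_fun; first exact: interval_open.
  by move=> s /set_mem; rewrite /= in_itv/= => st; exact: continuous_gain.
rewrite -integral_itv_bndo_bndc//.
pose F n := `[0, approx_beta t n]%classic : set R.
have FE : \bigcup_n F n = `[0, t[%classic.
  apply/seteqP; split => s.
    move=> [n _]; rewrite /F /= !in_itv/= => /andP[-> sr] /=.
    by have /andP[_] := rt n; exact: le_lt_trans.
  rewrite /= in_itv/= => /andP[s0 st].
  have [n ns] : exists n, s < approx_beta t n.
    have := cvgr_gt _ (@approx_beta_cvg _ t) _ st.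
    by move=> [n _ H]; exists n; apply: H => /=.
  by exists n => //; rewrite /F /= in_itv/= s0 ltW.
have L0 s : `[0, t[%classic s -> (0 <= lagrangian (phi s) (derive1 phi s))%E.
  rewrite /= in_itv/= => /andP[s0 st]; apply: lagrangian_ge0.
  by apply: opt_path_itv => //; rewrite s0 ltW.
have FS n : F n `<=` `[0, t[%classic by rewrite -FE; exact: bigcup_sup.
have cI : (\int[mu]_(s in F n) lagrangian (phi s) (derive1 phi s) @[n --> \oo] -->
   \int[mu]_(s in `[0%R, t[) lagrangian (phi s) (derive1 phi s))%E.
  rewrite -FE; apply: ge0_nondecreasing_set_cvg_integral => //.
  - move=> m n mn; apply/subsetPset/subset_itvl; rewrite bnd_simp /approx_beta.
    rewrite ler_wpM2l ?(ltW t0)// lerD2l lerN2 lef_pV2 ?posrE// ler_nat.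
    by rewrite !ltnS.
  - by move=> n; exact: measurable_itv.
  - by move=> n; apply: measurable_funS mL => //; exact: FS.
  - by move=> n s /FS; exact: L0.
have [c cT Hc] := value_end_bound.
have cV : ((c n - V 0)%:E @[n --> \oo] --> (limit_bound t a beta (phi 0))%:E)%E.
  apply: cvg_EFin; first by near=> n.
  have -> : limit_bound t a beta (phi 0) = T - V 0.
    rewrite /limit_bound /T /V /value /up /um sub0r mulrN -/(eps t).
    by rewrite ![beta * _]mulrC.
  by apply: cvgB => //; exact: cvg_cst.
apply: (lee_cvg_to cI cV).
by near=> n; rewrite /F opt_action_partial// lee_fin lerB.
Unshelve. all: by end_near. Qed.

End attained.

(** * Uniqueness of the optimal path *)

Section unique.
Variable R : realType.
Notation mu := (@lebesgue_measure R).
Variables (t a y : R).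
Hypotheses (t0 : 0 < t) (a1 : -1 <= a <= 1).

Let e := eps t.
Let beta := opt_beta e a y.
Let phi := opt_path t a y.

(** An integrating factor of the linear equation phi' = speed phi (momentum):
    its product with the difference of two solutions is constant. *)
Definition ode_factor (s : R) := expR (2 * s) / (up t beta s * um t beta s).

Let ode_factor' s := ode_factor s *
  (2 - 2 * (up t beta s - 1) / up t beta s - 2 * (um t beta s - 1) / um t beta s).

Lemma is_derive_ode_factor s : 0 < up t beta s -> 0 < um t beta s ->
  is_derive s (1 : R) ode_factor (ode_factor' s).
Proof.
move=> u0 m0; have Du := is_derive_up t beta s; have Dm := is_derive_um t beta s.
have n0 : up t beta s * um t beta s != 0 by rewrite gt_eqF// mulr_gt0.
have Di : is_derive s (1 : R) (fun z => (up t beta z * um t beta z)^-1)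
   (- (up t beta s * um t beta s) ^- 2 *
     (up t beta s * (2 * (um t beta s - 1)) + um t beta s * (2 * (up t beta s - 1)))).
  apply: is_deriveV => //.
rewrite /ode_factor /ode_factor' /ode_factor; apply: is_derive_eq.
rewrite /GRing.scale/=; by field; rewrite !gt_eqF.
Qed.

(** The product of the integrating factor with the difference of the paths is
    absolutely continuous with derivative 0 almost everywhere, hence constant,
    and it vanishes at 0. *)
Lemma opt_path_unique (psi : R -> R) : paths_to t a psi ->
  abs_continuous t psi -> psi 0 = phi 0 ->
  (\int[mu]_(s in `[0%R, t]) lagrangian (psi s) (derive1 psi s) <=
   (limit_bound t a beta (phi 0))%:E)%E ->
  forall s, 0 <= s <= t -> psi s = phi s.
Proof.
move=> /paths_toP[psi1 psit] apsi psi0 Ipsi s /andP[s0].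
rewrite le_eqVlt => /predU1P[->|st]; first by rewrite psit /phi opt_path_end.
move: s0; rewrite le_eqVlt => /predU1P[<-//|s0].
have b1 : `|beta| <= 1 by exact: opt_beta_le1 (eps01 t0) a1.
have V : value t (approx_beta beta n) t (psi t) - value t (approx_beta beta n) 0 (psi 0)
    @[n --> \oo] --> limit_bound t a beta (phi 0).
  by rewrite psit psi0; exact: (@value_approx_cvg R t a t0 a1 y (phi 0)).
have dpsi := action_eq_speed t0 apsi psi1 b1 (fun n => approx_beta_lt1 n b1)
  (@approx_beta_cvg _ beta) V Ipsi.
have us z : z <= s -> 0 < up t beta z /\ 0 < um t beta z.
  exact: u_gt0 (beta_expR_lt1 y t0 a1 st).
pose D z := - (phi z * ode_factor z) + ode_factor z * psi z.
pose phi' z := 2 * (beta * ch y * expR (2 * (z - t)) - sh y * expR (- (2 * z))) / norm_const e a y.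
have cof z : z <= s -> {for z, continuous ode_factor}.
  by move=> /us[u0 m0]; exact: is_derive_continuous (is_derive_ode_factor u0 m0).
have cphi z : {for z, continuous phi} by exact: continuous_opt_path.
have cphi' z : {for z, continuous phi'}.
  have Dz : is_derive z (1 : R) phi' (4 * phi z).
    rewrite /phi /phi' /opt_path -/e -/beta; apply: is_derive_eq; rewrite /GRing.scale/=; by ring.
  exact: is_derive_continuous Dz.
have cof' z : z <= s -> {for z, continuous ode_factor'}.
  move=> zs; have [u0 m0] := us _ zs; rewrite /ode_factor'.
  have cu : {for z, continuous (up t beta)} by exact: continuous_up.
  have cm : {for z, continuous (um t beta)} by exact: continuous_um.
  apply: cvgM; first exact: cof.
  apply: cvgB; [apply: cvgB; first exact: cvg_cst|].
    apply: cvgM; [apply: cvgM; [exact: cvg_cst|apply: cvgB => //; exact: cvg_cst]|].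
    by apply: cvgV => //; rewrite gt_eqF.
  apply: cvgM; [apply: cvgM; [exact: cvg_cst|apply: cvgB => //; exact: cvg_cst]|].
  by apply: cvgV => //; rewrite gt_eqF.
have aD : abs_continuous s D.
  apply: (@abs_continuous_affine _ t psi apsi psi1 s _ _
     (fun z => - (phi z * ode_factor' z + phi' z * ode_factor z)) ode_factor').
  - by rewrite !ltW.
  - move=> z /andP[z0 zs]; have [u0 m0] := us _ zs.
    have D1 := is_derive_ode_factor u0 m0; have D2 := is_derive_opt_path t a y z.
    rewrite -/phi -/e -/beta -/(phi' z) in D2.
    apply: is_derive_eq; rewrite /GRing.scale/=; by ring.
  - move=> z /andP[z0 zs]; have [u0 m0] := us _ zs.
    exact: is_derive_ode_factor.
  - apply: continuous_within => z /andP[z0 zs]; apply: cvgN; apply: cvgD; apply: cvgM => //.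
    + exact: cphi.
    + exact: cof'.
    + exact: cphi'.
    + exact: cof.
  - by apply: continuous_within => z /andP[z0 zs]; exact: cof'.
have [G [iG GE]] := abs_continuous_density (ltW s0) aD.
have dD := ae_density_derive iG GE.
have G0 : {ae mu, forall z, `[0, s]%classic z -> (G z)%:E = cst 0%E z}.
  apply: ae_itvcc.
  apply: (@filterS2 _ _ (ae_filter_ringOfSetsType mu) _ _ _ _ dD dpsi).
  move=> z H1 H2 /andP[z0 zs]; have zt := lt_trans zs st.
  have [d1 <-] := H1 (introT andP (conj z0 zs)).
  have [d2 e2] := H2 (introT andP (conj z0 zt)).
  have [u0 m0] := us z (ltW zs).
  have D1 := is_derive_ode_factor u0 m0.
  have D2 := opt_path_speed y t0 a1 (introT andP (conj (ltW z0) zt)).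
  rewrite -/phi -/e -/beta in D2.
  have D3 : is_derive z (1 : R) psi (speed (psi z) (momentum t beta z)).
    by apply: DeriveDef => //; rewrite -derive1E.
  have DD : is_derive z (1 : R) D 0.
    apply: is_derive_eq; rewrite /GRing.scale/= /ode_factor' /speed expRN expR_momentum//.
    have uE : um t beta z = 2 - up t beta z by rewrite /up /um; ring.
    move: (ode_factor z) => w; rewrite uE in m0 *.
    by field; lra.
  by rewrite derive1E (@derive_val _ _ _ _ _ _ _ DD).
have : (\int[mu]_(z in `[0%R, s]) (G z)%:E = 0)%E.
  rewrite (ae_eq_integral (cst 0%E))//; first by rewrite integral0.
  by apply: (@measurable_int _ _ _ mu); apply: integrableS iG.
rewrite GE// ?lexx ?ltW// => -[].
have [u0 m0] := us s (lexx s).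
have w0 : ode_factor s != 0 by rewrite gt_eqF// divr_gt0 ?expR_gt0 ?mulr_gt0.
have -> : D 0 = 0 by rewrite /D psi0; ring.
rewrite subr0 /D => H.
apply: (mulfI w0); lra.
Qed.

End unique.

(** * Minimizers of the rate and maximizers of the potential *)

Section variational.
Variable R : realType.
Variables (t J h a : R).
Hypotheses (t0 : 0 < t) (a1 : -1 <= a <= 1).
Let e := eps t.

Definition is_argmax (f : R -> R) x := forall z, f z <= f x.

Let P := Phi e J h a.

Hypothesis P_crit : forall x, is_argmax P x -> x = start t a (J * x + h).
Hypothesis P_max : exists x, is_argmax P x.

Lemma rate_opt_path x : x = start t a (J * x + h) ->
  rate J h t (opt_path t a (J * x + h)) = (Ibar a - P x)%:E.
Proof.
move=> xE; have x0 : opt_path t a (J * x + h) 0 = x by rewrite opt_path0.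
apply/eqP; rewrite eq_le; apply/andP; split; last first.
  by have := rate_ge J h t0 a1 (opt_path_paths_to (J * x + h) t0 a1); rewrite x0.
rewrite /rate /ID asboolT; last exact: opt_path_ac.
apply: le_trans (leeD2l _ (opt_action (J * x + h) t0 a1)) _.
rewrite x0 -EFinD lee_fin.
by rewrite (limit_bound_eq t0 a1 xE).
Qed.

Lemma inf_rate x : is_argmax P x ->
  ereal_inf (rate J h t @` paths_to t a) = (Ibar a - P x)%:E.
Proof.
move=> mx; apply/eqP; rewrite eq_le; apply/andP; split.
  apply: ereal_inf_lbound; exists (opt_path t a (J * x + h)).
    exact: opt_path_paths_to.
  by rewrite rate_opt_path//; exact: P_crit.
apply: le_ereal_inf_tmp => _ [phi pphi <-].
apply: le_trans (rate_ge J h t0 a1 pphi); rewrite lee_fin.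
by have := mx (phi 0); rewrite /P /e; lra.
Qed.

Lemma cost_ge m : ((Ibar a - P m)%:E <= cost J h t a m)%E.
Proof.
apply: le_ereal_inf_tmp => _ [phi [pphi phi0] <-].
by have := rate_ge J h t0 a1 pphi; rewrite phi0.
Qed.

Lemma cost_argmax x : is_argmax P x -> cost J h t a x = (Ibar a - P x)%:E.
Proof.
move=> mx; apply/eqP; rewrite eq_le cost_ge andbT.
apply: ereal_inf_lbound; exists (opt_path t a (J * x + h)).
  split; first exact: opt_path_paths_to.
  by rewrite /= opt_path0; apply/esym/P_crit.
by rewrite rate_opt_path//; exact: P_crit.
Qed.

Lemma argmax_itv x : is_argmax P x -> -1 <= x <= 1.
Proof.
move=> /P_crit ->; rewrite -opt_path0; apply: opt_path_itv => //.
by rewrite lexx ltW.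
Qed.

Lemma inf_cost x : is_argmax P x ->
  ereal_inf (cost J h t a @` [set m | -1 <= m <= 1]) = (Ibar a - P x)%:E.
Proof.
move=> mx; apply/eqP; rewrite eq_le; apply/andP; split.
  rewrite -(cost_argmax mx); apply: ereal_inf_lbound; exists x => //.
  exact: argmax_itv.
apply: le_ereal_inf_tmp => _ [m m1 <-]; apply: le_trans (cost_ge m).
by rewrite lee_fin; have := mx m; rewrite /P /e; lra.
Qed.

Lemma magn_minimizerP m : magn_minimizer J h t a m <-> is_argmax P m.
Proof.
have [x mx] := P_max; rewrite /magn_minimizer (inf_cost mx); split.
  move=> [m1 mE] z; have := cost_ge m; rewrite mE lee_fin.
  by have := mx z; rewrite /P /e; lra.
move=> mm; split; first exact: argmax_itv.
rewrite cost_argmax//; congr (_%:E).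
by have := mx m; have := mm x; lra.
Qed.

Lemma unique_path_minimizerP :
  unique_path_minimizer J h t a <-> exists! m, is_argmax P m.
Proof.
have [x mx] := P_max.
have minP z : is_argmax P z -> path_minimizer J h t a (opt_path t a (J * z + h)).
  move=> mz; split; first exact: opt_path_paths_to.
  by rewrite (inf_rate mz) rate_opt_path//; exact: P_crit.
have zt : (0 : R) <= 0 <= t by rewrite lexx ltW.
have op0 z : is_argmax P z -> opt_path t a (J * z + h) 0 = z.
  by move=> mz; rewrite opt_path0; apply/esym/P_crit.
split.
  move=> [phi _ uphi]; exists x; split => // z mz.
  by rewrite -(op0 _ mx) -(op0 _ mz) (uphi _ (minP _ mx))// (uphi _ (minP _ mz)).
move=> [x' [mx' ux]]; exists (opt_path t a (J * x' + h)); first exact: minP.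
move=> psi [ppsi]; rewrite (inf_rate mx') => Epsi.
have psi0 : psi 0 = x'.
  apply/esym/ux => z; have := rate_ge J h t0 a1 ppsi.
  by rewrite Epsi lee_fin; have := mx' z; rewrite /P /e; lra.
move: Epsi; rewrite /rate /ID; case: asboolP => [apsi|_]; last by rewrite addey.
rewrite psi0 -(limit_bound_eq t0 a1 (P_crit mx')) [RHS]EFinD.
rewrite -/e => /(congr1 (fun z => z - (IS J h x')%:E)%E).
rewrite addeAC subee// add0e [RHS]addeAC subee// add0e => IE.
apply: opt_path_unique => //.
  by rewrite psi0 op0.
by rewrite op0// IE.
Qed.

End variational.

(** * Critical points of the potential *)

Section rolle.
Variable R : realType.
Implicit Types (f : R -> R).

Lemma rolle f (f' : R -> R) x y : (forall z, is_derive z (1 : R) f (f' z)) ->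
  x < y -> f x = f y -> exists z, x < z < y /\ f' z = 0.
Proof.
move=> df xy fxy; have [||z zxy D0] := @Rolle R f x y xy _ _ fxy.
- by move=> z _; have D := df z; exact: ex_derive.
- apply: continuous_subspaceT => z; exact: is_derive_continuous (df z).
- exists z; split; first by move: zxy; rewrite in_itv.
  have D := df z; have := @derive_val _ _ _ _ _ _ _ D.
  by rewrite (@derive_val _ _ _ _ _ _ _ D0).
Qed.

Lemma argmax_derive0 f (f' : R -> R) x : (forall z, is_derive z (1 : R) f (f' z)) ->
  is_argmax f x -> f' x = 0.
Proof.
move=> df mx; have D := df x.
have : is_derive x (1 : R) f 0.
  apply: (@derive1_at_max _ _ (x - 1) (x + 1)); first lra.
  - by move=> z _; have Dz := df z; exact: ex_derive.
  - by rewrite in_itv/=; lra.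
  - by move=> z _; exact: mx.
by move=> D0; rewrite -(@derive_val _ _ _ _ _ _ _ D) (@derive_val _ _ _ _ _ _ _ D0).
Qed.

End rolle.

Section potential.
Variable R : realType.
Variables (e J h : R).
Hypotheses (e01 : 0 < e <= 1) (J0 : 0 < J).

Lemma W_pos c y : c = 1 \/ c = -1 -> 0 < W e c y.
Proof. by case/andP: e01 => ? ? [->|->]; apply: W_gt0; apply/andP; split; lra. Qed.

Let Wp0 y : 0 < W e 1 y. Proof. exact: W_pos (or_introl erefl). Qed.
Let Wm0 y : 0 < W e (- 1) y. Proof. exact: W_pos (or_intror erefl). Qed.

Lemma is_derive_W (c : R) (x : R) : is_derive x (1 : R) (fun x => W e c (J * x + h))
  (J * (sh (J * x + h) + e * c * ch (J * x + h))).
Proof.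
rewrite /W /sh /ch; apply: is_derive_eq; rewrite /GRing.scale/=; by field.
Qed.

(** The mean of the initial spin given a final magnetization a, in the field
    J x + h: critical points of the potential are self-consistent. *)
Definition mean a x := (1 + a) / 2 * ((sh (J * x + h) + e * ch (J * x + h)) / W e 1 (J * x + h))
  + (1 - a) / 2 * ((sh (J * x + h) - e * ch (J * x + h)) / W e (- 1) (J * x + h)).

Lemma is_derive_Phi a x : is_derive x (1 : R) (Phi e J h a) (J * (mean a x - x)).
Proof.
have Dp := @is_derive_ln R (fun x => W e 1 (J * x + h)) x _ (Wp0 (J * x + h)) (is_derive_W 1 x).
have Dm := @is_derive_ln R (fun x => W e (- 1) (J * x + h)) x _ (Wm0 (J * x + h)) (is_derive_W (- 1) x).
rewrite /Phi /mean; apply: is_derive_eq; rewrite /GRing.scale/=.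
by field; rewrite !gt_eqF.
Qed.

Lemma argmax_mean a x : is_argmax (Phi e J h a) x -> x = mean a x.
Proof.
move=> /(argmax_derive0 (is_derive_Phi a))/eqP.
by rewrite mulf_eq0 gt_eqF//= subr_eq0 => /eqP.
Qed.

Lemma ln_W_bound c y : c = 1 \/ c = -1 -> `|ln (W e c y)| <= `|y|.
Proof.
move=> c1; have W0 := W_pos y c1.
have [p q] : 0 <= (1 + e * c) / 2 /\ 0 <= (1 - e * c) / 2.
  by case/andP: e01 => ? ?; case: c1 => ->; split; lra.
have a1 : expR y <= expR `|y| by rewrite ler_expR ler_norm.
have a2 : expR (- y) <= expR `|y| by rewrite ler_expR -normrN ler_norm.
have b1 : expR (- `|y|) <= expR y by rewrite ler_expR lerNl -normrN ler_norm.
have b2 : expR (- `|y|) <= expR (- y) by rewrite ler_expR lerN2 ler_norm.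
rewrite ler_norml; apply/andP; split; rewrite -ler_expR lnK ?posrE// /W.
  have := ler_wpM2l p b1; have := ler_wpM2l q b2; nra.
have := ler_wpM2l p a1; have := ler_wpM2l q a2; nra.
Qed.

Lemma Phi_lipschitz a b x :
  `|Phi e J h a x - Phi e J h b x| <= `|a - b| * `|J * x + h|.
Proof.
have hp := ln_W_bound (J * x + h) (or_introl erefl).
have hm := ln_W_bound (J * x + h) (or_intror erefl).
have -> : Phi e J h a x - Phi e J h b x =
  (a - b) * ((ln (W e 1 (J * x + h)) - ln (W e (- 1) (J * x + h))) / 2).
  by rewrite /Phi; field.
rewrite normrM ler_wpM2l// normrM (ger0_norm (_ : 0 <= 2^-1 :> R))// ler_pdivrMr//.
by apply: le_trans (ler_normB _ _) _; lra.
Qed.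

Lemma Phi_le a x : -1 <= a <= 1 ->
  Phi e J h a x <= - (J * x ^+ 2 / 2) + `|J * x + h|.
Proof.
move=> /andP[a1 a2]; rewrite /Phi -addrA lerD2l.
have := ler_normlW (ln_W_bound (J * x + h) (or_introl erefl)).
have := ler_normlW (ln_W_bound (J * x + h) (or_intror erefl)).
nra.
Qed.

Lemma continuous_Phi a : continuous (Phi e J h a).
Proof. by move=> x; exact: is_derive_continuous (is_derive_Phi a x). Qed.

(** The quadratic term beats the logarithms, which grow at most linearly, for
    all a at once. *)
Lemma Phi_coercive (K : R) : exists2 r, 0 < r & forall a x, -1 <= a <= 1 ->
  r <= `|x| -> Phi e J h a x <= K.
Proof.
(* From here on J |x|^2 / 2 exceeds J |x| + |h| + |K|. *)
pose r := 4 + 2 * (`|h| + `|K|) / J + 2.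
have hK : 0 <= (`|h| + `|K|) / J by rewrite divr_ge0// ltW.
exists r => [|a x a1 rx]; first by rewrite /r; lra.
apply: le_trans (Phi_le x a1) _.
have : `|J * x + h| <= J * `|x| + `|h|.
  by apply: le_trans (ler_normD _ _) _; rewrite normrM gtr0_norm.
have -> : x ^+ 2 = `|x| ^+ 2 by rewrite real_normK// num_real.
set X := `|x| in rx *; set H := `|h| in r hK rx *; have kK := ler_normr K.
have Kn : - `|K| <= K by rewrite lerNl -normrN ler_norm.
set k := `|K| in r hK rx Kn *.
have H0 : 0 <= H by exact: normr_ge0. have k0 : 0 <= k by exact: normr_ge0.
have JX : 2 * (H + k) + 6 * J <= J * X.
  have : J * r <= J * X by rewrite ler_pM2l.
  by have -> : J * r = 2 * (H + k) + 6 * J by (rewrite /r; field; rewrite gt_eqF).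
have X4 : 4 <= X by move: rx; rewrite /r; lra.
have : J * X * 4 <= J * X * X by rewrite ler_wpM2l// mulr_ge0 ?ltW//; lra.
have -> : J * X ^+ 2 = J * X * X by ring.
have J0' := J0; lra.
Qed.

Lemma Phi_max a : -1 <= a <= 1 -> exists x, is_argmax (Phi e J h a) x.
Proof.
move=> a1; have [r r0 H] := Phi_coercive (Phi e J h a 0).
have rr : - r <= r by lra.
have [|x xr mx] := @EVT_max R (Phi e J h a) _ _ rr.
  by apply: continuous_subspaceT; exact: continuous_Phi.
exists x => z; have [zr|rz] := ltP `|z| r.
  by apply: mx; rewrite in_itv/= -ler_norml ltW.
apply: le_trans (H a z a1 rz) _; apply: mx; rewrite in_itv/=; lra.
Qed.

(** The derivative in a of the potential increases with x, which makes the
    maximizers increase with a. *)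
Lemma ln_ratio_mono x z : x < z ->
  ln (W e 1 (J * x + h)) - ln (W e (- 1) (J * x + h)) <
  ln (W e 1 (J * z + h)) - ln (W e (- 1) (J * z + h)).
Proof.
move=> xz; rewrite -!ln_div ?posrE// ltr_ln ?posrE ?divr_gt0//.
have uv : expR (J * x + h) < expR (J * z + h) by rewrite ltr_expR ltrD2r ltr_pM2l.
rewrite ltr_pdivrMr// mulrAC ltr_pdivlMr// /W !expRN mulr1 mulrN1.
have := expR_gt0 (J * x + h); have := expR_gt0 (J * z + h).
move: (expR (J * x + h)) (expR (J * z + h)) uv => u v uv v0 u0.
have eP : 0 < e by case/andP: e01.
rewrite -subr_gt0.
have -> : ((1 + e) / 2 * v + (1 - e) / 2 / v) * ((1 + - e) / 2 * u + (1 - - e) / 2 / u) -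
  ((1 + e) / 2 * u + (1 - e) / 2 / u) * ((1 + - e) / 2 * v + (1 - - e) / 2 / v) =
  e * (v ^+ 2 - u ^+ 2) / (u * v) by field; rewrite !gt_eqF.
by rewrite divr_gt0 ?mulr_gt0// subr_gt0 ltr_pXn2r// nnegrE ltW.
Qed.

Lemma argmax_mono a b x z : a < b -> is_argmax (Phi e J h a) x ->
  is_argmax (Phi e J h b) z -> x <= z.
Proof.
move=> ab mx mz; rewrite leNgt; apply/negP => /ln_ratio_mono.
have := mx z; have := mz x; rewrite /Phi.
move: (ln _) (ln _) (ln _) (ln _) => A B C D; nra.
Qed.

End potential.

(** * Degenerate magnetizations are isolated *)

Section degenerate.
Variable R : realType.
Variables (e J h : R).
Hypotheses (e01 : 0 < e <= 1) (J0 : 0 < J).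

Let k := (1 - e ^+ 2) / 2.
Let z x := 2 * (J * x + h).

(** The self-consistency equation x = mean a x is linear in a; clearing
    denominators separates x from a. *)
Definition crit_level (x : R) := x * (k * ch (z x) + 1 - k) - k * sh (z x).
Let level' x := k * ch (z x) + 1 - k + 2 * J * k * x * sh (z x) - 2 * J * k * ch (z x).
Let level'' x := 4 * J * k * ((1 - J) * sh (z x) + J * x * ch (z x)).

Lemma is_derive_ch_z x : is_derive x (1 : R) (fun x => ch (z x)) (2 * J * sh (z x)).
Proof. rewrite /z /sh /ch; apply: is_derive_eq; rewrite /GRing.scale/=; by field. Qed.

Lemma is_derive_sh_z x : is_derive x (1 : R) (fun x => sh (z x)) (2 * J * ch (z x)).
Proof. rewrite /z /sh /ch; apply: is_derive_eq; rewrite /GRing.scale/=; by field. Qed.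

Lemma is_derive_level x : is_derive x (1 : R) crit_level (level' x).
Proof.
have D1 := is_derive_ch_z x; have D2 := is_derive_sh_z x.
rewrite /crit_level /level'; apply: is_derive_eq; rewrite /GRing.scale/=; by ring.
Qed.

Lemma is_derive_level' x : is_derive x (1 : R) level' (level'' x).
Proof.
have D1 := is_derive_ch_z x; have D2 := is_derive_sh_z x.
rewrite /level' /level''; apply: is_derive_eq; rewrite /GRing.scale/=; by ring.
Qed.

Lemma ch2_sh2 (y : R) : ch y ^+ 2 - sh y ^+ 2 = 1.
Proof.
have := expR_gt0 y; rewrite /ch /sh expRN => y0; by field; rewrite gt_eqF.
Qed.

Lemma crit_levelP a x : x = mean e J h a x -> crit_level x = a * e.
Proof.
rewrite /mean => xE; set y := J * x + h in xE.
have p0 : 0 < W e 1 y by apply: W_pos => //; left.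
have m0 : 0 < W e (- 1) y by apply: W_pos => //; right.
have xD : x * (W e 1 y * W e (- 1) y) =
    (1 + a) / 2 * (sh y + e * ch y) * W e (- 1) y + (1 - a) / 2 * (sh y - e * ch y) * W e 1 y.
  by rewrite {1}xE; field; rewrite !gt_eqF.
have chz : ch (z x) = ch y ^+ 2 + sh y ^+ 2.
  rewrite /ch /sh /z -/y (_ : 2 * y = y + y); last by ring.
  by rewrite opprD !expRD; field.
have shz : sh (z x) = 2 * (sh y * ch y).
  rewrite /ch /sh /z -/y (_ : 2 * y = y + y); last by ring.
  by rewrite opprD !expRD; field.
have one := ch2_sh2 y.
rewrite /crit_level chz shz /k.
move: xD; rewrite !WE => xD.
have E1 : (1 - e ^+ 2) / 2 * (ch y ^+ 2 + sh y ^+ 2) + 1 - (1 - e ^+ 2) / 2 =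
  (ch y + e * 1 * sh y) * (ch y + e * - 1 * sh y).
  have C : ch y ^+ 2 = 1 + sh y ^+ 2 by rewrite -one addrNK.
  have -> : (ch y + e * 1 * sh y) * (ch y + e * - 1 * sh y) =
    ch y ^+ 2 - e ^+ 2 * sh y ^+ 2 by ring.
  by rewrite C; field.
rewrite E1 xD.
have -> : a * e = a * e * (ch y ^+ 2 - sh y ^+ 2) by rewrite one mulr1.
by field.
Qed.

Definition degenerate a :=
  exists x y, [/\ x < y, is_argmax (Phi e J h a) x & is_argmax (Phi e J h a) y].

(** The second derivative of [crit_level], up to the factor 4 J k ch (z x). *)
Let q x := J * x + (1 - J) * (sh (z x) / ch (z x)).
Let q' x := J + (1 - J) * (2 * J / ch (z x) ^+ 2).

Lemma is_derive_q x : is_derive x (1 : R) q (q' x).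
Proof.
have c0 : ch (z x) != 0 by rewrite gt_eqF// ch_gt0.
have D1 := is_derive_ch_z x; have D2 := is_derive_sh_z x.
have D3 : is_derive x (1 : R) (fun x => (ch (z x))^-1) (- (ch (z x)) ^- 2 * (2 * J * sh (z x))).
  exact: is_deriveV.
rewrite /q /q'; apply: is_derive_eq; rewrite /GRing.scale/=.
have E : 2 * J / ch (z x) ^+ 2 = 2 * J * (ch (z x) ^+ 2 - sh (z x) ^+ 2) / ch (z x) ^+ 2.
  by rewrite ch2_sh2 mulr1.
by rewrite E; field.
Qed.

(** Between two maximizers lies a third critical point; all three are on the
    same level, and Rolle's theorem applies twice. *)
Lemma degenerate_inflection a : degenerate a -> exists x, q x = 0 /\
  exists u v, [/\ is_argmax (Phi e J h a) u, is_argmax (Phi e J h a) v & u < x < v].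
Proof.
move=> [u [v [uv mu_ mv]]].
have Puv : Phi e J h a u = Phi e J h a v by apply/eqP; rewrite eq_le mu_ mv.
have [c [/andP[uc cv] /eqP]] := rolle (@is_derive_Phi R e J h e01 a) uv Puv.
rewrite mulf_eq0 gt_eqF//= subr_eq0 => /eqP/esym/crit_levelP cE.
have uE := crit_levelP (@argmax_mean R e J h e01 J0 _ _ mu_).
have vE := crit_levelP (@argmax_mean R e J h e01 J0 _ _ mv).
have [d1 [/andP[ud dc] d1E]] := rolle is_derive_level uc (etrans uE (esym cE)).
have [d2 [/andP[cd dv] d2E]] := rolle is_derive_level cv (etrans cE (esym vE)).
have [x [/andP[dx xd] xE]] := rolle is_derive_level' (lt_trans dc cd) (etrans d1E (esym d2E)).
have k0 : k != 0.
  apply/eqP => k0; move: uE vE; rewrite /crit_level k0 => uE vE; lra.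
exists x; split; last first.
  by exists u, v; split => //; rewrite (lt_trans ud dx) (lt_trans xd dv).
have {}xE : (1 - J) * sh (z x) + J * x * ch (z x) = 0.
  have k4 : 4 * J * k != 0 by rewrite mulf_neq0// gt_eqF// mulr_gt0.
  by apply: (mulfI k4); rewrite mulr0.
have c0 := ch_gt0 (z x).
rewrite /q; have -> : J * x + (1 - J) * (sh (z x) / ch (z x)) =
   ((1 - J) * sh (z x) + J * x * ch (z x)) / ch (z x) by field; rewrite gt_eqF.
by rewrite xE mul0r.
Qed.

(** The hyperbolic cosine is even and takes each value at most twice. *)
Lemma ch_eq_sign (u v : R) : u < v -> ch u = ch v -> u < 0 < v.
Proof.
move=> uv; rewrite /ch !expRN => E.
have lt_uv : expR u < expR v by rewrite ltr_expR.
have u0 := expR_gt0 u; have v0 := expR_gt0 v.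
have f : (expR u - expR v) * (expR u * expR v - 1) = 0.
  have : ((expR u + (expR u)^-1) / 2 - (expR v + (expR v)^-1) / 2) * (2 * expR u * expR v) = 0.
    by rewrite E subrr mul0r.
  by move=> <-; field; rewrite !gt_eqF.
have uv1 : expR (u + v) = expR 0.
  have n0 : expR u - expR v != 0 by rewrite subr_eq0 lt_eqF.
  rewrite expRD expR0; apply/eqP; rewrite -subr_eq0; apply/eqP.
  by apply: (mulfI n0); rewrite f mulr0.
have := expR_inj uv1 => E0; apply/andP; split; lra.
Qed.

(** Between zeros of q its derivative vanishes, which determines the value of
    the hyperbolic cosine; this value is taken at most twice. *)
Lemma q_zeros (x1 x2 x3 x4 : R) : x1 < x2 -> x2 < x3 -> x3 < x4 ->
  q x1 = 0 -> q x2 = 0 -> q x3 = 0 -> q x4 = 0 -> False.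
Proof.
move=> x12 x23 x34 q1 q2 q3 q4.
have [y1 [/andP[_ y1x] y1E]] := rolle is_derive_q x12 (etrans q1 (esym q2)).
have [y2 [/andP[xy2 y2x] y2E]] := rolle is_derive_q x23 (etrans q2 (esym q3)).
have [y3 [/andP[xy3 _] y3E]] := rolle is_derive_q x34 (etrans q3 (esym q4)).
have chE y : q' y = 0 -> ch (z y) ^+ 2 = 2 * (J - 1).
  rewrite /q' => H; have c0 := ch_gt0 (z y).
  have : (J + (1 - J) * (2 * J / ch (z y) ^+ 2)) * ch (z y) ^+ 2 = 0 by rewrite H mul0r.
  have -> : (J + (1 - J) * (2 * J / ch (z y) ^+ 2)) * ch (z y) ^+ 2 =
     J * (ch (z y) ^+ 2 - 2 * (J - 1)) by field; rewrite gt_eqF.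
  by move/eqP; rewrite mulf_eq0 gt_eqF//= subr_eq0 => /eqP.
have eqch (u v : R) : ch u ^+ 2 = ch v ^+ 2 -> ch u = ch v.
  by move=> H; apply/eqP; rewrite -(eqrXn2 _ (ltW (ch_gt0 u)) (ltW (ch_gt0 v)) (n := 2)) // H.
have zm u v : u < v -> z u < z v by rewrite /z => uv; rewrite ltr_pM2l// ltrD2r ltr_pM2l.
have := ch_eq_sign (zm _ _ (lt_trans y1x xy2)) (eqch _ _ (etrans (chE _ y1E) (esym (chE _ y2E)))).
have := ch_eq_sign (zm _ _ (lt_trans y2x xy3)) (eqch _ _ (etrans (chE _ y2E) (esym (chE _ y3E)))).
by move=> /andP[z2 _] /andP[_ z2']; lra.
Qed.

(** Each degenerate magnetization contributes an inflection point of the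
    critical level strictly between its maximizers, and the maximizers of
    different magnetizations are ordered. *)
Lemma degenerate_lt4 (a1 a2 a3 a4 : R) : a1 < a2 -> a2 < a3 -> a3 < a4 ->
  degenerate a1 -> degenerate a2 -> degenerate a3 -> degenerate a4 -> False.
Proof.
move=> a12 a23 a34 /degenerate_inflection[x1 [q1 [u1 [v1 [mu1 mv1 /andP[ux1 xv1]]]]]].
move=> /degenerate_inflection[x2 [q2 [u2 [v2 [mu2 mv2 /andP[ux2 xv2]]]]]].
move=> /degenerate_inflection[x3 [q3 [u3 [v3 [mu3 mv3 /andP[ux3 xv3]]]]]].
move=> /degenerate_inflection[x4 [q4 [u4 [v4 [mu4 mv4 /andP[ux4 xv4]]]]]].
have h1 := @argmax_mono R e J h e01 J0 _ _ _ _ a12 mv1 mu2.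
have h2 := @argmax_mono R e J h e01 J0 _ _ _ _ a23 mv2 mu3.
have h3 := @argmax_mono R e J h e01 J0 _ _ _ _ a34 mv3 mu4.
by apply: (@q_zeros x1 x2 x3 x4) => //; lra.
Qed.

(** Accumulation on one side of a0 would produce four degenerate
    magnetizations. *)
Lemma degenerate_isolated (a0 : R) : exists2 d, 0 < d &
  forall a, 0 < `|a - a0| < d -> ~ degenerate a.
Proof.
have right : exists2 d, 0 < d & forall a, a0 < a < a0 + d -> ~ degenerate a.
  apply: contrapT => H.
  have next b : a0 < b -> exists2 a, a0 < a < b & degenerate a.
    move=> b0; apply: contrapT => N; apply: H; exists (b - a0); first lra.
    by move=> a /andP[a1 a2] da; apply: N; exists a => //; rewrite a1; lra.
  have [a4 /andP[a40 _] d4] := next (a0 + 1) (ltac:(lra)).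
  have [a3 /andP[a30 a34] d3] := next a4 a40.
  have [a2 /andP[a20 a23] d2] := next a3 a30.
  have [a1 /andP[a10 a12] d1] := next a2 a20.
  exact: degenerate_lt4 a12 a23 a34 d1 d2 d3 d4.
have left : exists2 d, 0 < d & forall a, a0 - d < a < a0 -> ~ degenerate a.
  apply: contrapT => H.
  have next b : b < a0 -> exists2 a, b < a < a0 & degenerate a.
    move=> b0; apply: contrapT => N; apply: H; exists (a0 - b); first lra.
    by move=> a /andP[a1 a2] da; apply: N; exists a => //; rewrite a2 andbT; lra.
  have [a1 /andP[_ a10] d1] := next (a0 - 1) (ltac:(lra)).
  have [a2 /andP[a12 a20] d2] := next a1 a10.
  have [a3 /andP[a23 a30] d3] := next a2 a20.
  have [a4 /andP[a34 a40] d4] := next a3 a30.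
  exact: degenerate_lt4 a12 a23 a34 d1 d2 d3 d4.
have [d d0 Hd] := right; have [d' d'0 Hd'] := left.
exists (Num.min d d') => [|a]; first by rewrite lt_min d0.
rewrite lt_min normr_gt0 subr_eq0 => /andP[aa0 /andP[]].
rewrite !ltr_norml => /andP[a1 a2] /andP[a3 a4].
case: (ltgtP a a0) aa0 => // alt _; [apply: Hd'|apply: Hd]; apply/andP; split; lra.
Qed.

End degenerate.

(** * Transition probabilities *)

Section semigroup.
Variable R : realType.
Variable N : nat.
Implicit Types (x s : config N) (A : {set 'I_N}).
Notation spin := (spin R).

(** The Walsh functions: eigenvectors of the generator, since a flip at i changes
    the sign exactly when i is in A. *)
Definition character A x : R := \prod_i (if i \in A then spin (tnth x i) else 1).

Lemma spinN b : spin (~~ b) = - spin b.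
Proof. by case: b; rewrite /Defs.spin /= ?opprK. Qed.

Lemma character_flip A i x :
  character A (flip i x) = (if i \in A then -1 else 1) * character A x.
Proof.
rewrite /character (bigD1 i)//= [in RHS](bigD1 i)//= mulrA; congr (_ * _).
  by rewrite tnth_mktuple eqxx spinN; case: ifP; rewrite ?mulN1r ?mul1r.
by apply: eq_bigr => j ji; rewrite tnth_mktuple (negPf ji).
Qed.

Lemma generator_character (c : {set 'I_N} -> R) :
  generator (fun x => \sum_(A : {set 'I_N}) c A * character A x) =
  fun x => \sum_(A : {set 'I_N}) (c A * (- (2 * #|A|%:R))) * character A x.
Proof.
apply/funext => x; rewrite /generator.
under eq_bigr => i _ do rewrite -sumrB.
rewrite exchange_big/=; apply: eq_bigr => A _.
under eq_bigr => i _ do rewrite character_flip -mulrBr -{2}[character A x]mul1r -mulrBl.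
rewrite -mulr_sumr -mulr_suml mulrA; congr (_ * _ * _).
rewrite (eq_bigr (fun i => if i \in A then - 2 else 0)) => [|i _].
  by rewrite -big_mkcond/= sumr_const mulNrn mulr_natr.
by case: ifP => _; lra.
Qed.

Lemma iter_generator (c : {set 'I_N} -> R) k :
  iter k (@generator R N) (fun x => \sum_(A : {set 'I_N}) c A * character A x) =
  fun x => \sum_(A : {set 'I_N}) (c A * (- (2 * #|A|%:R)) ^+ k) * character A x.
Proof.
elim: k => [|k IH].
  by apply/funext => x; apply: eq_bigr => A _; rewrite expr0 mulr1.
rewrite iterS IH generator_character; apply/funext => x; apply: eq_bigr => A _.
by rewrite exprSr mulrA.
Qed.

(** Expanding the product expresses the indicator of s, at w = 1, and the
    transition probability to s, at w = exp (- 2 t), in the same characters. *)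
Lemma prod_character (w : R) x s :
  \prod_i ((1 + w * (spin (tnth x i) * spin (tnth s i))) / 2) =
  \sum_(A : {set 'I_N}) (2 ^- N * w ^+ #|A| * character A s) * character A x.
Proof.
rewrite big_split/= prodr_const card_ord exprVn mulrC.
under eq_bigr do rewrite addrC.
rewrite bigA_distr/= mulr_sumr; apply: eq_bigr => A _.
rewrite -!mulrA; congr (_ * _).
rewrite /character -prodr_const [X in _ = X * _]big_mkcond/= -!big_split/=.
by apply: eq_bigr => i _; case: ifP => _; rewrite ?mulr1//; ring.
Qed.

Lemma indicator_prod x s :
  (x == s)%:R = \prod_i ((1 + 1 * (spin (tnth x i) * spin (tnth s i))) / 2) :> R.
Proof.
have fac b c : (1 + 1 * (spin b * spin c)) / 2 = (b == c)%:R.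
  by case: b; case: c; rewrite /Defs.spin /=; lra.
under eq_bigr do rewrite fac.
have [->|xs] := eqVneq x s; first by rewrite big1// => i _; rewrite eqxx.
have [i xi] : exists i, tnth x i != tnth s i.
  apply/existsP; rewrite -negb_forall; apply: contra xs => /forallP H.
  by apply/eqP/eq_from_tnth => i; exact/eqP.
by rewrite (bigD1 i)//= (negPf xi) mul0r.
Qed.

Lemma cvg_sum_finite (I : finType) (u : I -> nat -> R) (l : I -> R) :
  (forall i, u i n @[n --> \oo] --> l i) ->
  \sum_i u i n @[n --> \oo] --> \sum_i l i.
Proof.
move=> H; elim: (index_enum I) => [|i r IH].
  under eq_fun do rewrite big_nil.
  by rewrite big_nil; exact: cvg_cst.
under eq_fun do rewrite big_cons.
by rewrite big_cons; apply: cvgD.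
Qed.

(** Independent spins: each one is a two-state chain flipping at rate one. *)
Lemma semigroup_indicator (t : R) x s :
  semigroup t (fun x => (x == s)%:R) x =
  \prod_i ((1 + expR (- (2 * t)) * (spin (tnth x i) * spin (tnth s i))) / 2).
Proof.
pose c A : R := 2 ^- N * 1 ^+ #|A| * character A s.
have -> : (fun x => (x == s)%:R) = fun x => \sum_(A : {set 'I_N}) c A * character A x.
  by apply/funext => z; rewrite indicator_prod prod_character.
rewrite /semigroup prod_character; apply/cvg_lim => //.
rewrite (_ : series _ = fun n => \sum_(A : {set 'I_N}) (c A * character A x) *
   series (exp_coeff (t * (- (2 * #|A|%:R)))) n); last first.
  apply/funext => n; rewrite /series/=.
  under eq_bigr => k _ do rewrite iter_generator mulr_sumr.
  rewrite exchange_big/=; apply: eq_bigr => A _.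
  rewrite mulr_sumr; apply: eq_bigr => k _; rewrite /exp_coeff/= exprMn.
  by rewrite [RHS]mulrC; ring.
apply: cvg_sum_finite => A.
have -> : 2 ^- N * expR (- (2 * t)) ^+ #|A| * character A s * character A x =
  c A * character A x * expR (t * (- (2 * #|A|%:R))).
  have -> : expR (t * (- (2 * #|A|%:R))) = expR (- (2 * t)) ^+ #|A|.
    by rewrite -expRM_natl; congr expR; ring.
  by rewrite /c expr1n; ring.
apply: cvgM; first exact: cvg_cst.
exact: is_cvg_series_exp_coeff.
Qed.

End semigroup.

(** * The law at time t as a Gaussian mixture of product measures *)

Section hs.
Variable R : realType.
Notation mu := (@lebesgue_measure R).
Variables (J h t : R).
Hypotheses (J0 : 0 < J) (t0 : 0 <= t).
Notation spin := (spin R).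

Lemma sum_config_prod N (F : 'I_N -> bool -> R) :
  \sum_(e : config N) \prod_i F i (tnth e i) = \prod_i \sum_b F i b.
Proof.
rewrite bigA_distr_bigA/=.
rewrite (reindex (fun f : {ffun 'I_N -> bool} => [tuple f i | i < N]))/=.
  by apply: eq_bigr => f _; apply: eq_bigr => i _; rewrite tnth_mktuple.
exists (fun e : config N => [ffun i => tnth e i]) => [f _|e _].
  by apply/ffunP => i; rewrite ffunE tnth_mktuple.
by apply: eq_from_tnth => i; rewrite tnth_mktuple ffunE.
Qed.

Lemma continuous_gauss (N M : R) :
  continuous (fun x : R => expR (- (N * J * x ^+ 2 / 2)) * expR (J * x * M)).
Proof.
move=> x; have D : is_derive x (1 : R)
    (fun x : R => expR (- (N * J * x ^+ 2 / 2)) * expR (J * x * M))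
    ((J * M - N * J * x) * (expR (- (N * J * x ^+ 2 / 2)) * expR (J * x * M))).
  by apply: is_derive_eq; rewrite /GRing.scale/=; field.
exact: is_derive_continuous D.
Qed.

(** Completing the square, the square of the total spin is linearised. *)
Lemma hubbard_stratonovich N : (0 < N)%N -> exists2 k, 0 < k & forall M : R,
  (\int[mu]_x (expR (- (N%:R * J * x ^+ 2 / 2)) * expR (J * x * M))%:E =
    (k * expR (J / (2 * N%:R) * M ^+ 2))%:E)%E.
Proof.
move=> N0; have NR : 0 < N%:R :> R by rewrite ltr0n.
have NJ : 0 < N%:R * J by rewrite mulr_gt0.
pose s := (Num.sqrt (N%:R * J))^-1.
have s0 : s != 0 by rewrite invr_eq0 sqrtr_eq0 -ltNge.
have s2 : s ^+ 2 = (N%:R * J)^-1 by rewrite exprVn sqr_sqrtr// ltW.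
have p0 := normal_peak_gt0 s0.
exists (normal_peak s)^-1 => [|M]; first by rewrite invr_gt0.
set f := fun x : R => expR (- (N%:R * J * x ^+ 2 / 2)) * expR (J * x * M).
set c := normal_peak s * expR (- (J / (2 * N%:R) * M ^+ 2)).
have c0 : 0 < c by rewrite mulr_gt0 ?expR_gt0.
have cf : continuous f by exact: continuous_gauss.
have := integral_normal_pdf (M / N%:R) s.
have -> : (\int[mu]_x (normal_pdf (M / N%:R) s x)%:E = c%:E * \int[mu]_x (f x)%:E)%E.
  rewrite -ge0_integralZl_EFin//; last 3 first.
  - by move=> x _; rewrite lee_fin mulr_ge0 ?expR_ge0.
  - by apply/measurable_EFinP; exact: continuous_measurable_fun.
  - exact: ltW.
  apply: eq_integral => x _; rewrite -EFinM normal_pdfE//; congr (_%:E).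
  rewrite /c /f -[RHS]mulrA -!expRD /normal_fun; congr (_ * expR _).
  rewrite mulr2n s2; field.
  by rewrite gt_eqF// gt_eqF.
case: (\int[mu]_x _)%E => [r| |] /=; last 2 first.
- by rewrite mulry gtr0_sg// mul1e.
- by rewrite mulrNy gtr0_sg// mul1e.
rewrite -EFinM => -[cr]; congr (_%:E).
have -> : r = c^-1 by apply: (mulfI (lt0r_neq0 c0)); rewrite cr mulfV// gt_eqF.
by rewrite /c invfM expRN; congr (_ * _); rewrite invrK.
Qed.

Lemma weights_sum (e y : R) c : \sum_(b : bool) expR (y * spin b) * ((1 + e * (spin b * spin c)) / 2)
  = W e (spin c) y.
Proof.
by rewrite big_bool /W /Defs.spin /= mulr1 mulrN1; case: c; field.
Qed.

Lemma eps_itv : 0 < eps t <= 1.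
Proof. by rewrite /eps expR_gt0 expR_le1 oppr_le0 mulr_ge0. Qed.

Lemma W_spin_gt0 (y : R) b : 0 < W (eps t) (spin b) y.
Proof.
by case/andP: eps_itv => ? ?; apply: W_gt0; case: b; rewrite /Defs.spin ?mulr1 ?mulrN1;
  apply/andP; split; lra.
Qed.

Lemma continuous_W (e c : R) : continuous (fun x => W e c (J * x + h)).
Proof. by move=> x; exact: is_derive_continuous (is_derive_W e J h c x). Qed.

(** Given the Gaussian variable x the initial spins are independent in the
    field J x + h, and so are the spins at time t. *)
Lemma law_integral N : (0 < N)%N -> exists2 c, 0 < c & forall s : config N,
  ((law J h t s)%:E = c%:E * \int[mu]_x (expR (- (N%:R * J * x ^+ 2 / 2)) *
      \prod_i W (eps t) (spin (tnth s i)) (J * x + h))%:E)%E.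
Proof.
move=> N0; have NR : 0 < N%:R :> R by rewrite ltr0n.
have [k k0 HS] := hubbard_stratonovich N0.
pose Z := \sum_(e : config N) expR (- hamiltonian J h e).
have Z0 : 0 < Z.
  rewrite /Z (bigD1 [tuple true | i < N])//= ltr_pwDl ?expR_gt0//.
  by rewrite sumr_ge0// => e _; exact: expR_ge0.
exists (k * Z)^-1 => [|s]; first by rewrite invr_gt0 mulr_gt0.
pose p (e : config N) := \prod_i ((1 + eps t * (spin (tnth e i) * spin (tnth s i))) / 2).
have p0 e : 0 <= p e.
  apply: prodr_ge0 => i _; case/andP: eps_itv => ? ?.
  by case: (tnth e i); case: (tnth s i); rewrite /Defs.spin; lra.
pose M (e : config N) := \sum_i spin (tnth e i).
have lawE : law J h t s = Z^-1 * \sum_e expR (J / (2 * N%:R) * M e ^+ 2) * (expR (h * M e) * p e).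
  rewrite /law mulr_sumr; apply: eq_bigr => e _.
  rewrite semigroup_indicator -/(eps t) -/(p e) /gibbs -/Z.
  have -> : expR (- hamiltonian J h e) = expR (J / (2 * N%:R) * M e ^+ 2) * expR (h * M e).
    rewrite -expRD /hamiltonian -big_distrlr/= -/(M e); congr expR; ring.
  by move: (Z^-1) => z; ring.
have intE : (\int[mu]_x (expR (- (N%:R * J * x ^+ 2 / 2)) *
      \prod_i W (eps t) (spin (tnth s i)) (J * x + h))%:E =
   \sum_e (k * expR (J / (2 * N%:R) * M e ^+ 2) * (expR (h * M e) * p e))%:E)%E.
  pose G e x := expR (- (N%:R * J * x ^+ 2 / 2)) * expR (J * x * M e).
  have mG e : measurable_fun setT (EFin \o G e).
    have cG : continuous (G e) by exact: continuous_gauss.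
    by apply/measurable_EFinP; exact: continuous_measurable_fun.
  have G0 e x : 0 <= G e x by rewrite mulr_ge0 ?expR_ge0.
  have c0 e : 0 <= expR (h * M e) * p e by rewrite mulr_ge0 ?expR_ge0 ?p0.
  have HSe e : ((k * expR (J / (2 * N%:R) * M e ^+ 2) * (expR (h * M e) * p e))%:E =
      \int[mu]_x ((expR (h * M e) * p e)%:E * (G e x)%:E))%E.
    rewrite ge0_integralZl_EFin//; [|by move=> x _; rewrite lee_fin|exact: mG].
    have -> : (\int[mu]_x (G e x)%:E = (k * expR (J / (2 * N%:R) * M e ^+ 2))%:E)%E by exact: HS.
    by rewrite -EFinM mulrC.
  rewrite (eq_bigr _ (fun e _ => HSe e)) -ge0_integral_sum//; last 2 first.
  - by move=> e; apply: measurable_funeM; exact: mG.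
  - by move=> e x _; rewrite -EFinM lee_fin mulr_ge0.
  apply: eq_integral => x _; under [RHS]eq_bigr do rewrite -EFinM.
  rewrite sumEFin; congr (_%:E).
  pose F i b := expR ((J * x + h) * spin b) * ((1 + eps t * (spin b * spin (tnth s i))) / 2).
  have E e : expR (h * M e) * p e * G e x =
      expR (- (N%:R * J * x ^+ 2 / 2)) * \prod_i F i (tnth e i).
    rewrite big_split/= -/(p e) -expR_sum -mulr_sumr -/(M e) mulrDl expRD /G; ring.
  under [RHS]eq_bigr do rewrite E.
  rewrite -mulr_sumr sum_config_prod; congr (_ * _).
  by apply: eq_bigr => i _; rewrite weights_sum.
rewrite intE sumEFin -EFinM lawE; congr (_%:E).
rewrite [(k * Z)^-1]invfM [k^-1 * _]mulrC -mulrA; congr (_ * _).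
rewrite mulr_sumr; apply: eq_bigr => e _.
by rewrite !mulrA mulVf ?mul1r// gt_eqF.
Qed.

End hs.

(** * The specification kernel as a ratio of integrals *)

Section gamma_ratio.
Variable R : realType.
Notation mu := (@lebesgue_measure R).
Variables (J h t : R).
Hypotheses (J0 : 0 < J) (t0 : 0 <= t).
Notation spin := (spin R).
Let e := eps t.

(** Of the n + 1 Gaussian factors, n are absorbed in the potential and one is
    left over in [base]. *)
Definition tilt n a x := expR (n%:R * Phi (eps t) J h a x).
Definition base x := expR (- (J * x ^+ 2 / 2)).

Lemma magnset_config n a : (0 < n)%N -> magnset n a -> exists s : config n, magn R s = a.
Proof.
move=> n0 [k kn ->]; exists [tuple (i < k)%N | i < n].
have NR : n%:R != 0 :> R by rewrite pnatr_eq0 -lt0n.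
rewrite /magn; under eq_bigr do rewrite tnth_mktuple.
rewrite (eq_bigr (fun i : 'I_n => 2 * (if (i < k)%N then 1 else 0) - 1 : R)); last first.
  by move=> i _; rewrite /Defs.spin; case: ifP => _; lra.
rewrite sumrB -mulr_sumr -big_mkcond/=.
have -> : \sum_(i < n | (i < k)%N) 1 = k%:R :> R.
  rewrite -(big_ord_widen_cond _ xpredT (fun=> 1)) //.
  by rewrite sumr_const card_ord.
by rewrite sumr_const card_ord; field.
Qed.

(** The n conditioned spins enter only through their magnetization. *)
Lemma prod_W n (s : config n) y : (0 < n)%N ->
  \prod_i W e (spin (tnth s i)) y =
  expR (n%:R * ((1 + magn R s) / 2 * ln (W e 1 y) + (1 - magn R s) / 2 * ln (W e (- 1) y))).
Proof.
move=> n0; have NR : n%:R != 0 :> R by rewrite pnatr_eq0 -lt0n.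
have Wp b : 0 < W e (spin b) y by exact: W_spin_gt0.
rewrite (eq_bigr (fun i => expR (1 / 2 * (ln (W e 1 y) + ln (W e (- 1) y)) +
    spin (tnth s i) * ((ln (W e 1 y) - ln (W e (- 1) y)) / 2)))); last first.
  move=> i _; rewrite -[LHS]lnK ?posrE//; congr expR.
  by case: (tnth s i); rewrite /Defs.spin/=; field.
rewrite -expR_sum; congr expR; rewrite big_split/= sumr_const card_ord -mulr_suml.
have -> : \sum_i spin (tnth s i) = n%:R * magn R s by rewrite /magn mulrA mulfV// mul1r.
by field.
Qed.

Lemma prod_W_cons n b (s : config n) y : (0 < n)%N ->
  \prod_i W e (spin (tnth [tuple of b :: s] i)) y =
  W e (spin b) y *
  expR (n%:R * ((1 + magn R s) / 2 * ln (W e 1 y) + (1 - magn R s) / 2 * ln (W e (- 1) y))).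
Proof.
move=> n0; rewrite big_ord_recl/= tnth0; congr (_ * _).
by rewrite -prod_W//; apply: eq_bigr => i _; rewrite tnthS.
Qed.

Lemma continuous_tilt n a : continuous (tilt n a).
Proof.
move=> x; have D := is_derive_Phi J h (eps_itv t0) a x.
have D2 : is_derive x (1 : R) (tilt n a)
  (n%:R * (J * (mean (eps t) J h a x - x)) * tilt n a x).
  by rewrite /tilt; apply: is_derive_eq; rewrite /GRing.scale/=; ring.
exact: is_derive_continuous D2.
Qed.

Lemma continuous_base : continuous base.
Proof.
move=> x; have D2 : is_derive x (1 : R) base (- (J * x) * base x).
  by rewrite /base; apply: is_derive_eq; rewrite /GRing.scale/=; field.
exact: is_derive_continuous D2.
Qed.

Definition local_weight n a b x := tilt n a x * (base x * W (eps t) (spin b) (J * x + h)).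

Lemma continuous_local_weight n a b : continuous (local_weight n a b).
Proof.
move=> x; apply: cvgM; first exact: continuous_tilt.
by apply: cvgM; [exact: continuous_base|exact: continuous_W].
Qed.

Lemma local_weight_ge0 n a b x : 0 <= local_weight n a b x.
Proof. by rewrite !mulr_ge0 ?expR_ge0// ltW// W_spin_gt0. Qed.

(** Each conditioned spin contributes its weight, and together they give the
    factor exp (n Phi_a); the normalisation of the law cancels. *)
Lemma gamma_ratio n a b : (0 < n)%N -> magnset n a ->
  (forall c, mu.-integrable setT (EFin \o local_weight n a c)) /\
  gamma J h t n b a = (\int[mu]_x local_weight n a b x)%R /
    (\sum_(c : bool) \int[mu]_x local_weight n a c x)%R.
Proof.
move=> n0 /(magnset_config n0)[s sa].
have [k k0 lawE] := law_integral h J0 t0 (ltn0Sn n).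
have E c : ((law J h t [tuple of c :: s])%:E = k%:E * \int[mu]_x (local_weight n a c x)%:E)%E.
  rewrite lawE; congr (_ * _)%E; apply: eq_integral => x _; congr (_%:E).
  rewrite prod_W_cons// sa /local_weight /tilt /base /Phi.
  rewrite -[X in _ = _ * (_ * X)]/(W e (spin c) (J * x + h)).
  rewrite mulrA mulrAC [in RHS]mulrA; congr (_ * _).
  by rewrite -!expRD -natr1; congr expR; field.
have mw c : measurable_fun setT (EFin \o local_weight n a c).
  by apply/measurable_EFinP; apply: continuous_measurable_fun; exact: continuous_local_weight.
have iw c : mu.-integrable setT (EFin \o local_weight n a c).
  apply/integrableP; split; first exact: mw.
  apply: (@le_lt_trans _ _ (\int[mu]_x (local_weight n a c x)%:E)%E).
    rewrite le_eqVlt; apply/orP; left; apply/eqP.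
    by apply: eq_integral => x _ /=; rewrite ger0_norm// local_weight_ge0.
  rewrite ltey; apply/eqP => H; have := E c; rewrite H.
  by rewrite mulry gtr0_sg// mul1e.
split => //; rewrite -sa gammaE sa /cond_spin.
have lE c : law J h t [tuple of c :: s] = k * (\int[mu]_x local_weight n a c x)%R.
  apply: EFin_inj; rewrite E EFinM /Rintegral fineK//.
  exact: integrable_fin_num (iw c).
rewrite lE; under eq_bigr do rewrite lE.
by rewrite -mulr_sumr -mulf_div divff ?mul1r// gt_eqF.
Qed.

End gamma_ratio.

(** * Laplace's method *)

Section laplace.
Variable R : realType.
Notation mu := (@lebesgue_measure R).

(** A comparison of integrals: v is close to l w, up to a remainder that is
    small compared with the integral of w. *)
Lemma ratio_bound (w v o : R -> R) (l d T K : R) :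
  mu.-integrable setT (EFin \o w) -> mu.-integrable setT (EFin \o v) ->
  mu.-integrable setT (EFin \o o) -> 0 < K -> 0 <= T ->
  K <= (\int[mu]_x w x)%R ->
  (forall x, `|v x - l * w x| <= d * w x + T * o x) -> (0 <= \int[mu]_x o x)%R ->
  `|(\int[mu]_x v x)%R / (\int[mu]_x w x)%R - l| <= d + T * (\int[mu]_x o x)%R / K.
Proof.
move=> iw iv io K0 T0 Kw H o0; set D := (\int[mu]_x w x)%R in Kw *.
have D0 : 0 < D := lt_le_trans K0 Kw.
have iZ k (f : R -> R) : mu.-integrable setT (EFin \o f) ->
    mu.-integrable setT (EFin \o (fun x => k * f x)).
  by move=> intf; have := integrableZl (measurableT) k intf; apply: eq_integrable.
have ivl : mu.-integrable setT (EFin \o (fun x => v x - l * w x)).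
  have := integrableB measurableT iv (iZ l w iw).
  by apply: eq_integrable => // x _ /=; rewrite EFinB.
have i1 : mu.-integrable setT (EFin \o (fun x => d * w x + T * o x)).
  have := integrableD measurableT (iZ d w iw) (iZ T o io).
  by apply: eq_integrable => // x _ /=; rewrite EFinD.
have E : (\int[mu]_x v x)%R - l * D = (\int[mu]_x (v x - l * w x))%R.
  by rewrite RintegralB// ?RintegralZl//; exact: iZ.
have -> : (\int[mu]_x v x)%R / D - l = (\int[mu]_x (v x - l * w x))%R / D.
  by rewrite -E mulrBl mulfK// gt_eqF.
rewrite normrM normfV (gtr0_norm D0) ler_pdivrMr//.
apply: le_trans (le_normr_Rintegral measurableT ivl) _.
apply: (@le_trans _ _ (\int[mu]_x (d * w x + T * o x))%R).
  apply: le_Rintegral => //; have := integrable_norm ivl.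
  by apply: eq_integrable => // x _ /=.
rewrite RintegralD ?RintegralZl//; try exact: iZ.
rewrite mulrDl lerD2l -ler_pdivrMr//.
rewrite ler_wpM2l ?mulr_ge0// lef_pV2// posrE.
Qed.

End laplace.

Section concentration.
Variable R : realType.
Notation mu := (@lebesgue_measure R).
Variables (J h t : R).
Hypotheses (J0 : 0 < J) (t0 : 0 <= t).
Notation spin := (spin R).
Notation P := (Phi (eps t) J h).

Definition total_weight n a x := local_weight J h t n a true x + local_weight J h t n a false x.

(** The conditional probability of a spin b at time t given the Gaussian
    variable x; at the maximizer it is the limit of the kernel. *)
Definition limit_kernel b x := W (eps t) (spin b) (J * x + h) /
  (W (eps t) (spin true) (J * x + h) + W (eps t) (spin false) (J * x + h)).

Let W0 b y : 0 < W (eps t) (spin b) y. Proof. exact: W_spin_gt0. Qed.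

Lemma local_weight_limit_kernel n a b x :
  local_weight J h t n a b x = limit_kernel b x * total_weight n a x.
Proof.
rewrite /total_weight /limit_kernel /local_weight.
have := W0 true (J * x + h); have := W0 false (J * x + h).
move: (W _ (spin true) _) (W _ (spin false) _) => u v v0 u0.
field; lra.
Qed.

Lemma continuous_limit_kernel b : continuous (limit_kernel b).
Proof.
move=> x; apply: cvgM; first exact: continuous_W.
apply: cvgV; last by apply: cvgD; exact: continuous_W.
by rewrite gt_eqF// addr_gt0.
Qed.

Lemma limit_kernel_itv b x : 0 <= limit_kernel b x <= 1.
Proof.
have ut := W0 true (J * x + h); have uf := W0 false (J * x + h).
have ub := W0 b (J * x + h); rewrite /limit_kernel; apply/andP; split.
  by apply: divr_ge0; [exact: ltW|apply: addr_ge0; exact: ltW].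
rewrite (ler_pdivrMr _ _ (addr_gt0 ut uf)) mul1r.
by case: b ub => ub; [rewrite lerDl|rewrite lerDr]; exact: ltW.
Qed.

Definition base_weight x := base J x * (W (eps t) (spin true) (J * x + h) +
   W (eps t) (spin false) (J * x + h)).

Lemma total_weightE n a x : total_weight n a x = expR (n%:R * P a x) * base_weight x.
Proof. by rewrite /total_weight /local_weight /base_weight /tilt; ring. Qed.

Lemma base_weight_gt0 x : 0 < base_weight x.
Proof. by rewrite mulr_gt0 ?expR_gt0// addr_gt0. Qed.

Lemma continuous_base_weight : continuous base_weight.
Proof.
move=> x; apply: cvgM; first exact: continuous_base.
by apply: cvgD; exact: continuous_W.
Qed.

Lemma integrable_base_weight : mu.-integrable setT (EFin \o base_weight).
Proof.
have [k k0 HS] := hubbard_stratonovich J0 (ltn0Sn 0).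
have iG (M : R) : mu.-integrable setT (EFin \o (fun x => expR (- (1%:R * J * x ^+ 2 / 2)) * expR (J * x * M))).
  apply/integrableP; split.
    apply/measurable_EFinP; apply: continuous_measurable_fun; exact: continuous_gauss.
  apply: (@le_lt_trans _ _ (\int[mu]_x (expR (- (1%:R * J * x ^+ 2 / 2)) * expR (J * x * M))%:E)%E).
    rewrite le_eqVlt; apply/orP; left; apply/eqP.
    by apply: eq_integral => x _ /=; rewrite ger0_norm// mulr_ge0 ?expR_ge0.
  by rewrite HS ltry.
have iZ c (f : R -> R) : mu.-integrable setT (EFin \o f) ->
    mu.-integrable setT (EFin \o (fun x => c * f x)).
  by move=> intf; have := integrableZl (measurableT) c intf; apply: eq_integrable.
have := integrableD measurableT (iZ (expR h) _ (iG 1)) (iZ (expR (- h)) _ (iG (- 1))).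
apply: eq_integrable => // x _ /=; rewrite -EFinD; congr (_%:E).
rewrite /base_weight /base /W /Defs.spin mulr1 mulrN1 !opprD !expRD mul1r mulr1 mulrN1.
by field.
Qed.

(** On a bounded set away from the maximizer the gap is positive by compactness,
    and outside it by coercivity; the Lipschitz dependence on the magnetization
    makes it uniform. *)
Lemma Phi_far a x0 r : -1 <= a <= 1 -> is_argmax (P a) x0 ->
  (forall x, is_argmax (P a) x -> x = x0) -> 0 < r ->
  exists2 c, 0 < c & exists2 d, 0 < d & forall b x, -1 <= b <= 1 -> `|b - a| < d ->
    r <= `|x - x0| -> P b x <= P a x0 - c.
Proof.
move=> a1 m0 um r0.
have [q q0 Hq] := Phi_coercive h (eps_itv t0) J0 (P a x0 - 1).
have max_itv (u v : R) : (forall x, u <= x <= v -> x <> x0) ->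
    exists2 c, 0 < c & forall x, u <= x <= v -> P a x <= P a x0 - c.
  move=> ux; have [uv|vu] := leP u v; last by exists 1 => // x; lra.
  have [|z zuv mz] := @EVT_max R (P a) u v uv.
    by apply: continuous_subspaceT; exact: continuous_Phi (eps_itv t0) a.
  rewrite in_itv/= in zuv.
  have zlt : P a z < P a x0.
    rewrite lt_neqAle m0 andbT; apply/eqP => E; apply: (ux z zuv); apply: um => y.
    by rewrite E.
  exists (P a x0 - P a z) => [|x xuv]; first by rewrite subr_gt0.
  by rewrite subKr; apply: mz; rewrite in_itv.
have [c1 c10 H1] : exists2 c, 0 < c & forall x, - q <= x <= x0 - r -> P a x <= P a x0 - c.
  by apply: max_itv => x /andP[_ xr] xx; rewrite xx in xr; lra.
have [c2 c20 H2] : exists2 c, 0 < c & forall x, x0 + r <= x <= q -> P a x <= P a x0 - c.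
  by apply: max_itv => x /andP[xr _] xx; rewrite xx in xr; lra.
pose c := Num.min 1 (Num.min c1 c2) / 2.
have c0 : 0 < c by rewrite /c divr_gt0// !lt_min ltr01 c10.
have cm : 2 * c <= 1 /\ 2 * c <= c1 /\ 2 * c <= c2.
  by rewrite /c mulrCA mulfV// mulr1 !ge_min !lexx !orbT.
pose d := c / (J * q + `|h| + 1).
have den : 0 < J * q + `|h| + 1.
  have := mulr_gt0 J0 q0; have := normr_ge0 h; lra.
exists c => //; exists d; first by rewrite divr_gt0.
move=> b x b1 bd xr; have [qx|xq] := leP q `|x|; first by have := Hq b x b1 qx; lra.
have L := @Phi_lipschitz R (eps t) J h (eps_itv t0) b a x.
have yb : `|J * x + h| <= J * q + `|h| + 1.
  apply: le_trans (ler_normD _ _) _; rewrite normrM gtr0_norm//.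
  have : J * `|x| <= J * q by rewrite ler_pM2l// ltW.
  lra.
have bc : `|b - a| * `|J * x + h| <= c.
  apply: le_trans (ler_pM _ _ (ltW bd) yb) _ => //.
  by rewrite /d divfK// gt_eqF.
have := le_trans L bc; rewrite ler_norml => /andP[_ Pb].
move: xq; rewrite ltr_norml => /andP[xq1 xq2].
have [xx|xx] := leP x0 x.
  have xr' : r <= x - x0 by move: xr; rewrite ger0_norm// subr_ge0.
  have : x0 + r <= x <= q by apply/andP; split; lra.
  by move=> /H2; lra.
have : - q <= x <= x0 - r.
  have xr' : r <= x0 - x by move: xr; rewrite distrC ger0_norm// subr_ge0 ltW.
  by apply/andP; split; lra.
by move=> /H1; lra.
Qed.

(** The counterpart of the previous bound: near the maximizer the potential is
    almost maximal, which bounds the total mass from below. *)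
Lemma Phi_near a x0 c : 0 < c ->
  exists2 r, 0 < r & exists2 d, 0 < d & forall b x, `|b - a| < d ->
    `|x - x0| <= r -> P a x0 - c <= P b x.
Proof.
move=> c0; have c2 : 0 < c / 2 by lra.
have cP := @continuous_Phi R (eps t) J h (eps_itv t0) a x0.
have lt1 : P a x0 - c / 2 < P a x0 by lra.
have [s /= s0 Hs] := (nbhs_ballP _ _).1 (cvgr_gt _ cP _ lt1).
pose r := Num.min (s / 2) 1.
have rs : r <= s / 2 by rewrite /r ge_min lexx.
have r1 : r <= 1 by rewrite /r ge_min lexx orbT.
have den : 0 < J * (`|x0| + 1) + `|h| + 1.
  have : 0 <= J * (`|x0| + 1) by rewrite mulr_ge0 ?ltW// addr_ge0.
  have := normr_ge0 h; lra.
exists r; first by rewrite /r lt_min ltr01; lra.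
exists (c / 2 / (J * (`|x0| + 1) + `|h| + 1)); first by rewrite divr_gt0.
move=> b x bd xr.
have Pax : P a x0 - c / 2 < P a x.
  by apply: Hs; rewrite /ball/= distrC; lra.
have L := @Phi_lipschitz R (eps t) J h (eps_itv t0) b a x.
have yb : `|J * x + h| <= J * (`|x0| + 1) + `|h| + 1.
  apply: le_trans (ler_normD _ _) _; rewrite normrM gtr0_norm//.
  have xb : `|x| <= `|x0| + 1.
    have -> : x = x0 + (x - x0) by ring.
    by apply: le_trans (ler_normD _ _) _; lra.
  have : J * `|x| <= J * (`|x0| + 1) by rewrite ler_pM2l.
  lra.
have bc : `|b - a| * `|J * x + h| <= c / 2.
  apply: le_trans (ler_pM _ _ (ltW bd) yb) _ => //.
  by rewrite divfK// gt_eqF.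
have := le_trans L bc; rewrite ler_norml => /andP[Pb _].
lra.
Qed.

End concentration.

Section laplace_limit.
Variable R : realType.
Notation mu := (@lebesgue_measure R).
Variables (J h t : R).
Hypotheses (J0 : 0 < J) (t0 : 0 <= t).
Notation spin := (spin R).
Notation P := (Phi (eps t) J h).

Lemma magnset_itv n (a : R) : (0 < n)%N -> magnset n a -> -1 <= a <= 1.
Proof.
move=> n0 [k kn ->]; have NR : 0 < n%:R :> R by rewrite ltr0n.
have q0 : 0 <= k%:R / n%:R :> R by rewrite divr_ge0.
have q1 : k%:R / n%:R <= 1 :> R by rewrite ler_pdivrMr// mul1r ler_nat.
by rewrite -mulrA; apply/andP; split; lra.
Qed.

Lemma total_weight_integral_ge n a x0 r m K : 0 < r -> 0 < m ->
  (forall x, `|x - x0| <= r -> m <= base_weight J h t x) ->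
  (forall x, `|x - x0| <= r -> K <= P a x) ->
  mu.-integrable setT (EFin \o total_weight J h t n a) ->
  expR (n%:R * K) * (m * (2 * r)) <= (\int[mu]_x total_weight J h t n a x)%R.
Proof.
move=> r0 m0 Hm HK iw.
have w0 x : 0 <= total_weight J h t n a x.
  by rewrite total_weightE mulr_ge0 ?expR_ge0// ltW// base_weight_gt0.
rewrite -lee_fin /Rintegral fineK; last exact: integrable_fin_num iw.
pose A := `[x0 - r, x0 + r]%classic : set (measurableTypeR R).
have mA : measurable A by exact: measurable_itv.
apply: (@le_trans _ _ (\int[mu]_(x in A) (expR (n%:R * K) * m)%:E)%E).
  have muA : mu A = (2 * r)%:E.
    have := @lebesgue_measure_itv R `[x0 - r, x0 + r].
    rewrite /= lte_fin ifT; last by lra.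
    by rewrite -EFinD => E; rewrite /A E; congr (_%:E); ring.
  rewrite integral_cst//; rewrite [X in (_ <= _ * X)%E]muA -EFinM lee_fin.
  by rewrite [leLHS]mulrA.
apply: (@le_trans _ _ (\int[mu]_(x in A) (total_weight J h t n a x)%:E)%E).
  apply: ge0_le_integral => //.
  - by move=> x _; rewrite lee_fin mulr_ge0 ?expR_ge0// ltW.
  - by apply: (@measurable_int _ _ _ mu); apply: integrableS iw.
  - move=> x; rewrite /A /= in_itv/= => /andP[x1 x2].
    have xr : `|x - x0| <= r by rewrite ler_norml; apply/andP; split; lra.
    rewrite lee_fin total_weightE; apply: ler_pM; rewrite ?expR_ge0 ?(ltW m0)//.
      by rewrite ler_expR ler_wpM2l// HK.
    exact: Hm.
apply: ge0_subset_integral => //.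
- exact: (measurable_int mu iw).
- by move=> x _; rewrite lee_fin.
Qed.

(** Laplace's method. The bounds on the potential are uniform for nearby
    magnetizations, hence so is the convergence, as needed for arbitrary
    sequences a_n and for the behaviour near a. *)
Lemma gamma_concentration a x0 b : -1 <= a <= 1 -> is_argmax (P a) x0 ->
  (forall x, is_argmax (P a) x -> x = x0) ->
  forall k, 0 < k -> exists2 d, 0 < d & exists n0 : nat, forall n a',
    (n0 <= n)%N -> (0 < n)%N -> magnset n a' -> `|a' - a| < d ->
    `|gamma J h t n b a' - limit_kernel J h t b x0| < k.
Proof.
move=> a1 m0 um k k0.
have cf : limit_kernel J h t b x @[x --> x0] --> limit_kernel J h t b x0.
  exact: (@continuous_limit_kernel R J h t t0 b x0).
have k2 : 0 < k / 2 by lra.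
move/cvgrPdist_lt : cf => /(_ _ k2) cf.
have [r /= r0 Hr] := (nbhs_ballP _ _).1 cf.
have [c c0 [d1 d10 far]] := @Phi_far R J h t J0 t0 a x0 r a1 m0 um r0.
have c2 : 0 < c / 2 by lra.
have [s s0 [d2 d20 near_]] := @Phi_near R J h t J0 t0 a x0 (c / 2) c2.
have [z _ mz] := @EVT_min R (base_weight J h t) (x0 - s) (x0 + s) (ltac:(lra))
  (continuous_subspaceT (@continuous_base_weight R J h t)).
set m := base_weight J h t z in mz.
have mpos : 0 < m by exact: base_weight_gt0.
pose C0 := (\int[mu]_x base_weight J h t x)%R.
have C00 : 0 <= C0 by apply: Rintegral_ge0 => x _; exact/ltW/base_weight_gt0.
pose Q := C0 / (m * (2 * s)).
have Q0 : 0 <= Q by rewrite divr_ge0// mulr_ge0 ?(ltW mpos)//; lra.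
exists (Num.min d1 d2); first by rewrite lt_min d10.
(* Since exp (- n c / 2) < 2 / (n c), the remainder is below k / 2 from here
   on. *)
pose n0 := (Num.truncn (4 * Q / (c * k))).+1.
have n0P : 4 * Q / (c * k) < n0%:R by exact: truncnS_gt.
exists n0 => n a' n0n n_pos Ma'; rewrite lt_min => /andP[da1 da2].
have a'1 := magnset_itv n_pos Ma'.
have [iw ->] := gamma_ratio h J0 t0 b n_pos Ma'.
have itw : mu.-integrable setT (EFin \o total_weight J h t n a').
  have := integrableD measurableT (iw true) (iw false).
  by apply: eq_integrable => // x _ /=; rewrite -EFinD.
have -> : \sum_(c : bool) (\int[mu]_x local_weight J h t n a' c x)%R =
    (\int[mu]_x total_weight J h t n a' x)%R.
  by rewrite big_bool; symmetry; exact: (RintegralD measurableT (iw true) (iw false)).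
pose M := P a x0.
pose K := expR (n%:R * (M - c / 2)) * (m * (2 * s)).
have K0 : 0 < K by rewrite /K mulr_gt0 ?expR_gt0// mulr_gt0// mulr_gt0.
have KW : K <= (\int[mu]_x total_weight J h t n a' x)%R.
  apply: (@total_weight_integral_ge n a' x0 s m) => //.
  - move=> x; rewrite ler_norml => /andP[x1 x2]; apply: mz.
    by rewrite in_itv/=; apply/andP; split; lra.
  - by move=> x xs; apply: near_.
have B := @ratio_bound R (total_weight J h t n a') (local_weight J h t n a' b)
  (base_weight J h t) (limit_kernel J h t b x0) (k / 2) (expR (n%:R * (M - c))) K
  itw (iw b) (integrable_base_weight h t J0) K0 (expR_ge0 _) KW.
apply: (le_lt_trans (B _ C00)).
  move=> x; rewrite local_weight_limit_kernel// -mulrBl normrM.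
  have tw0 : 0 <= total_weight J h t n a' x.
    by rewrite total_weightE mulr_ge0 ?expR_ge0// ltW// base_weight_gt0.
  rewrite (ger0_norm tw0).
  have bw0 := base_weight_gt0 J h t0 x.
  have [xr|rx] := ltP `|x - x0| r.
    have fx : `|limit_kernel J h t b x - limit_kernel J h t b x0| <= k / 2.
      by rewrite distrC ltW//; apply: Hr; rewrite /ball/= distrC.
    apply: le_trans (ler_wpM2r tw0 fx) _; rewrite lerDl; apply: mulr_ge0; first exact: expR_ge0.
    exact: (ltW bw0).
  have f1 : `|limit_kernel J h t b x - limit_kernel J h t b x0| <= 1.
    have /andP[? ?] := @limit_kernel_itv R J h t t0 b x.
    have /andP[? ?] := @limit_kernel_itv R J h t t0 b x0.
    by rewrite ler_norml; apply/andP; split; lra.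
  apply: le_trans (ler_wpM2r tw0 f1) _; rewrite mul1r.
  apply: (@le_trans _ _ (expR (n%:R * (M - c)) * base_weight J h t x)).
    rewrite total_weightE ler_wpM2r ?(ltW bw0)// ler_expR ler_wpM2l//.
    exact: far.
  by rewrite lerDr mulr_ge0 ?(ltW k2).
rewrite -/C0.
have -> : expR (n%:R * (M - c)) * C0 / K = expR (- (n%:R * (c / 2))) * Q.
  have -> : expR (n%:R * (M - c)) = expR (n%:R * (M - c / 2)) * expR (- (n%:R * (c / 2))).
    by rewrite -expRD; congr expR; field.
  rewrite /K /Q; have := expR_gt0 (n%:R * (M - c / 2)); move: (expR (n%:R * (M - c / 2))) => E E0.
  field; rewrite !gt_eqF//.
rewrite -[ltRHS](@addrNK _ (k / 2)) addrC ltrD2r.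
have -> : k - k / 2 = k / 2 by field.
have nn : n0%:R <= n%:R :> R by rewrite ler_nat.
have ck : 0 < c * k by rewrite mulr_gt0.
have big : 4 * Q < n%:R * (c * k) by rewrite -ltr_pdivrMr//; lra.
have npos : 0 < n%:R :> R by rewrite ltr0n.
have X0 : 0 < n%:R * (c / 2) by rewrite mulr_gt0.
have EX : n%:R * (c / 2) < expR (n%:R * (c / 2)).
  by have := expR_ge1Dx (n%:R * (c / 2)); lra.
rewrite expRN mulrC ltr_pdivrMr ?expR_gt0//.
apply: (@lt_trans _ _ (k / 2 * (n%:R * (c / 2)))).
  by have -> : k / 2 * (n%:R * (c / 2)) = n%:R * (c * k) / 4 by [field]; lra.
by rewrite ltr_pM2l.
Qed.

End laplace_limit.

(** * Degeneracy at the end points *)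

Section endpoint.
Variable R : realType.
Variables (J h t : R).
Hypotheses (J0 : 0 < J) (t0 : 0 <= t).
Notation spin := (spin R).
Let e := eps t.

Definition flip_all N (f : config N) : config N := [tuple ~~ tnth f i | i < N].

Lemma flip_all_bij N : bijective (@flip_all N).
Proof.
by exists (@flip_all N) => f; apply: eq_from_tnth => i; rewrite !tnth_mktuple negbK.
Qed.

(** Under the hypothesis the weight of the initial value of an aligned spin does
    not depend on that value. Then flipping all initial spins at once only
    exchanges the two initial values of the first spin, so that the sum over the
    interactions factors out. *)
Lemma law_aligned n sb r (s : config n) : (forall i, tnth s i = sb) ->
  (forall b, expR (h * spin b) * ((1 + e * (spin b * spin sb)) / 2) = r) ->
  exists2 K, 0 < K & forall c, law J h t [tuple of c :: s] = K * W e (spin c) h.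
Proof.
move=> sE rE.
pose M (f : config n.+1) := \sum_i spin (tnth f i).
pose Z := \sum_(f : config n.+1) expR (- hamiltonian J h f).
pose E f := expR (J / (2 * n.+1%:R) * M f ^+ 2).
have r0 : 0 < r.
  have e0 : 0 < e by exact: expR_gt0.
  by rewrite -(rE sb) mulr_gt0 ?expR_gt0// divr_gt0//; case: (sb); rewrite /Defs.spin; lra.
have sum_gt0 (F : config n.+1 -> R) : (forall f, 0 < F f) -> 0 < \sum_f F f.
  move=> F0; rewrite (bigD1 [tuple of sb :: s])//= ltr_wpDr ?sumr_ge0// => f _.
  exact: ltW.
exists (Z^-1 * r ^+ n * (\sum_f E f) / 2) => [|c].
  rewrite divr_gt0// !mulr_gt0 ?invr_gt0 ?exprn_gt0//; apply: sum_gt0 => f; exact: expR_gt0.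
pose A b := expR (h * spin b) * ((1 + e * (spin b * spin c)) / 2).
have lE : law J h t [tuple of c :: s] = Z^-1 * r ^+ n * \sum_f E f * A (tnth f ord0).
  rewrite /law mulr_sumr; apply: eq_bigr => f _.
  rewrite semigroup_indicator -/(eps t) -/e /gibbs -/Z.
  have -> : expR (- hamiltonian J h f) = E f * expR (h * M f).
    rewrite -expRD /hamiltonian -big_distrlr/= -/(M f); congr expR; ring.
  have pE : expR (h * M f) * \prod_i ((1 + e *
      (spin (tnth f i) * spin (tnth [tuple of c :: s] i))) / 2) = A (tnth f ord0) * r ^+ n.
    rewrite /M mulr_sumr expR_sum -big_split/= big_ord_recl tnth0; congr (_ * _).
    rewrite (eq_bigr (fun=> r)) ?prodr_const ?card_ord// => i _.
    by rewrite tnthS sE rE.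
  move: (\prod_i _) (expR (h * M f)) (Z^-1) pE => p x z pE.
  have -> : E f * x * z * p = z * E f * (x * p) by ring.
  by rewrite pE; ring.
have flipE : \sum_f E f * A (tnth f ord0) = \sum_f E f * A (~~ tnth f ord0).
  rewrite (reindex (@flip_all n.+1)) /=; last exact/onW_bij/flip_all_bij.
  apply: eq_bigr => f _; rewrite tnth_mktuple; congr (expR (_ * _) * _).
  rewrite /M (eq_bigr (fun i => - spin (tnth f i))) => [|i _].
    by rewrite sumrN sqrrN.
  by rewrite tnth_mktuple spinN.
have sumA b : A b + A (~~ b) = W e (spin c) h.
  by rewrite -weights_sum big_bool /A; case: b => //=; rewrite addrC.
have S2 : 2 * \sum_f E f * A (tnth f ord0) = (\sum_f E f) * W e (spin c) h.
  rewrite mulr_natl mulr2n {2}flipE -big_split/= mulr_suml.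
  by apply: eq_bigr => f _; rewrite -mulrDr sumA.
rewrite lE.
have -> : \sum_f E f * A (tnth f ord0) = (\sum_f E f) * W e (spin c) h / 2.
  by rewrite -S2; field.
by move: (Z^-1) => z; field.
Qed.

(** At a fully aligned magnetization the potential is the Curie-Weiss free
    energy in a shifted field h'. Two maximizers have shifted arguments of
    opposite signs, because the derivative of the mean-field equation vanishes
    on both sides of the critical point between them; since the maximum
    dominates the value at the reflected argument, h' = 0. *)
Lemma degenerate_aligned sb x1 x2 : x1 < x2 -> e < 1 ->
  is_argmax (Phi e J h (spin sb)) x1 -> is_argmax (Phi e J h (spin sb)) x2 ->
  x1 < 0 < x2 /\
  exists r, forall b, expR (h * spin b) * ((1 + e * (spin b * spin sb)) / 2) = r.
Proof.
move=> x12 e1 m1 m2; have e0 : 0 < e by exact: expR_gt0.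
pose p := (1 + e * spin sb) / 2; pose q := (1 - e * spin sb) / 2.
have [p0 q0] : 0 < p /\ 0 < q by rewrite /p /q; case: (sb); rewrite /Defs.spin; split; lra.
pose u := (ln p - ln q) / 2; pose r := expR ((ln p + ln q) / 2).
have r0 : 0 < r by exact: expR_gt0.
have pE : r * expR u = p by rewrite -expRD -[RHS]lnK//; congr expR; rewrite /u; field.
have qE : r * expR (- u) = q by rewrite -expRD -[RHS]lnK//; congr expR; rewrite /u; field.
pose h' := h + u.
have WE' y : W e (spin sb) y = 2 * r * ch (y + u).
  by rewrite /W -/p -/q -pE -qE /ch opprD !expRD; field.
pose Q x := - (J * x ^+ 2 / 2) + ln (ch (J * x + h')).
have PQ x : Phi e J h (spin sb) x = Q x + ln (2 * r).
  have -> : Phi e J h (spin sb) x = - (J * x ^+ 2 / 2) + ln (W e (spin sb) (J * x + h)).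
    by rewrite /Phi; case: (sb); rewrite /Defs.spin; field.
  have r2 : 0 < 2 * r by rewrite mulr_gt0.
  rewrite WE' lnM ?posrE ?ch_gt0// /Q.
  have -> : J * x + h + u = J * x + h' by rewrite /h' addrA.
  by ring.
have mQ1 : is_argmax Q x1 by move=> z; have := m1 z; rewrite !PQ lerD2r.
have mQ2 : is_argmax Q x2 by move=> z; have := m2 z; rewrite !PQ lerD2r.
pose z (x : R) := J * x + h'.
have Dch x : is_derive x (1 : R) (fun x => ch (z x)) (J * sh (z x)).
  rewrite /z /ch /sh; apply: is_derive_eq; rewrite /GRing.scale/=; by field.
have Dsh x : is_derive x (1 : R) (fun x => sh (z x)) (J * ch (z x)).
  rewrite /z /ch /sh; apply: is_derive_eq; rewrite /GRing.scale/=; by field.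
pose k x := sh (z x) / ch (z x) - x.
have DQ x : is_derive x (1 : R) Q (J * k x).
  have D1 := @is_derive_ln R (fun x => ch (z x)) x _ (ch_gt0 (z x)) (Dch x).
  have -> : Q = fun x => - (J * x ^+ 2 / 2) + ln (ch (z x)) by [].
  rewrite /k; move: (ch_gt0 (z x)) D1; set c := ch (z x); set s := sh (z x) => c0 D1.
  have D0 : is_derive x (1 : R) (fun x : R => - (J * x ^+ 2 / 2)) (- (J * x)).
    by apply: is_derive_eq; rewrite /GRing.scale/=; field.
  have D := is_deriveD D0 D1; apply: (is_derive_eq D).
  by move: c s c0 {D1 D} => c s c0; field; rewrite gt_eqF.
have Dk x : is_derive x (1 : R) k (J / ch (z x) ^+ 2 - 1).
  have c0 : ch (z x) != 0 by rewrite gt_eqF// ch_gt0.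
  have D3 : is_derive x (1 : R) (fun x => (ch (z x))^-1) (- (ch (z x)) ^- 2 * (J * sh (z x))).
    have D1 := Dch x; exact: is_deriveV.
  have D := is_deriveB (is_deriveM (Dsh x) D3) (is_derive_id x 1).
  apply: (is_derive_eq D); rewrite /GRing.scale/=.
  have := ch2_sh2 (z x); move: (ch (z x)) (sh (z x)) c0 => c s c0 E.
  have -> : J / c ^+ 2 = J * (c ^+ 2 - s ^+ 2) / c ^+ 2 by rewrite E mulr1.
  by field.
have Q12 : Q x1 = Q x2 by apply/eqP; rewrite eq_le mQ1 mQ2.
have kz x : J * k x = 0 -> k x = 0.
  by move/eqP; rewrite mulf_eq0 gt_eqF//= => /eqP.
have [c [/andP[xc cx] /kz kc]] := rolle DQ x12 Q12.
have k1 := kz _ (argmax_derive0 DQ mQ1); have k2 := kz _ (argmax_derive0 DQ mQ2).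
have [d1 [/andP[xd1 d1c] d1E]] := rolle Dk xc (etrans k1 (esym kc)).
have [d2 [/andP[cd2 d2x] d2E]] := rolle Dk cx (etrans kc (esym k2)).
have chE d : J / ch (z d) ^+ 2 - 1 = 0 -> ch (z d) ^+ 2 = J.
  move=> H; have c0 := ch_gt0 (z d).
  have : (J / ch (z d) ^+ 2 - 1) * ch (z d) ^+ 2 = 0 by rewrite H mul0r.
  by rewrite mulrBl mul1r divfK ?gt_eqF ?exprn_gt0// => /eqP; rewrite subr_eq0 => /eqP ->.
have zm x y : x < y -> z x < z y by move=> xy; rewrite /z ltrD2r ltr_pM2l.
have chd : ch (z d1) = ch (z d2).
  move: (ch_gt0 (z d1)) (ch_gt0 (z d2)) (chE _ d1E) (chE _ d2E).
  move: (ch (z d1)) (ch (z d2)) => c1 c2 c10 c20 E1 E2.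
  by apply: (@pexpIrn _ 2); rewrite ?nnegrE ?ltW// E1 E2.
have /andP[zd1 zd2] := ch_eq_sign (zm _ _ (lt_trans d1c cd2)) chd.
have z1 : z x1 < 0 by exact: lt_trans (zm _ _ xd1) zd1.
have z2 : 0 < z x2 by exact: lt_trans zd2 (zm _ _ d2x).
have chN y : ch (- y) = ch y by rewrite /ch opprK addrC.
have refl x : is_argmax Q x -> 0 <= z x * h'.
  move=> mx; have := mx (- (z x + h') / J); rewrite /Q.
  have -> : J * (- (z x + h') / J) + h' = - z x by field; rewrite gt_eqF.
  rewrite -/(z x) chN lerD2r lerN2 => H.
  have -> : z x * h' = J / 2 * (J * (- (z x + h') / J) ^+ 2 / 2 - J * x ^+ 2 / 2).
    by rewrite /z; field; rewrite gt_eqF.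
  by rewrite mulr_ge0 ?subr_ge0// divr_ge0// ltW.
have h'0 : h' = 0.
  have := refl _ mQ1; have := refl _ mQ2.
  rewrite pmulr_rge0// nmulr_rge0//; lra.
have hE : h = - u by move: h'0; rewrite /h'; lra.
split.
  move: z1 z2; rewrite /z h'0 !addr0 pmulr_rlt0// pmulr_rgt0// => -> ->.
  by [].
exists r; case.
  by rewrite /Defs.spin mulr1 mul1r -/p -pE hE mulrCA -expRD addNr expR0 mulr1.
rewrite /Defs.spin mulrN1 mulN1r mulrN -/q -qE hE opprK mulrCA -expRD addrN expR0 mulr1.
by [].
Qed.

Lemma gamma_aligned n sb b r : (0 < n)%N ->
  (forall c, expR (h * spin c) * ((1 + e * (spin c * spin sb)) / 2) = r) ->
  gamma J h t n b (spin sb) = limit_kernel J h t b 0.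
Proof.
move=> n0 rE; have NR : n%:R != 0 :> R by rewrite pnatr_eq0 -lt0n.
pose s : config n := [tuple sb | i < n].
have sE i : tnth s i = sb by rewrite tnth_mktuple.
have <- : magn R s = spin sb.
  rewrite /magn (eq_bigr (fun=> spin sb)) => [|i _]; last by rewrite sE.
  by rewrite sumr_const card_ord -[X in _ * X]mulr_natl mulKf.
have [K K0 lawE] := law_aligned sE rE.
rewrite gammaE /cond_spin big_bool /= !lawE /limit_kernel mulr0 add0r -/e.
have := W_spin_gt0 t0 h true; have := W_spin_gt0 t0 h false.
move: (W _ _ _) (W _ _ _) (W _ _ _) => w u v v0 u0.
by field; rewrite -mulrDr mulf_neq0 ?gt_eqF// addr_gt0.
Qed.

End endpoint.

(** * Existence of the limiting kernel *)

Section limits.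
Variable R : realType.
Variables (J h t : R).
Hypotheses (J0 : 0 < J) (t0 : 0 <= t).
Notation spin := (spin R).
Notation P := (Phi (eps t) J h).
Notation frac := (limit_kernel J h t).
Implicit Types (a l x z d k : R).

Lemma limit_kernel_mono x z : x < z -> frac true x < frac true z.
Proof.
move=> /(ln_ratio_mono h (eps_itv t0) J0).
have p u : 0 < W (eps t) 1 (J * u + h) := W_spin_gt0 t0 (J * u + h) true.
have q u : 0 < W (eps t) (- 1) (J * u + h) := W_spin_gt0 t0 (J * u + h) false.
rewrite -!ln_div ?posrE// ltr_ln ?posrE ?divr_gt0//.
have := q z; have := p z; have := q x; have := p x; rewrite /limit_kernel /Defs.spin /=.
move: (W _ 1 (J * x + h)) (W _ (- 1) (J * x + h)) (W _ 1 (J * z + h)) (W _ (- 1) (J * z + h)).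
move=> a b c d a0 b0 c0 d0.
rewrite ltr_pdivrMr// mulrAC ltr_pdivlMr// => H.
by rewrite ltr_pdivrMr ?addr_gt0// mulrAC ltr_pdivlMr ?addr_gt0//; lra.
Qed.

Lemma limit_kernel_false x : frac false x = 1 - frac true x.
Proof.
have p : 0 < W (eps t) (spin true) (J * x + h) by exact: W_spin_gt0.
have q : 0 < W (eps t) (spin false) (J * x + h) by exact: W_spin_gt0.
rewrite /limit_kernel; move: (W _ _ _) (W _ _ _) p q => u v u0 v0.
by field; rewrite gt_eqF// addr_gt0.
Qed.

(** The two values of the kernel sum to 1. *)
Lemma limit_kernel_dist b x z :
  `|frac b x - frac b z| = `|frac true x - frac true z|.
Proof.
case: b => //; rewrite !limit_kernel_false distrC; congr (`|_|); by ring.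
Qed.

(** Rounding down to the lattice. *)
Lemma magnset_approx a : -1 <= a <= 1 -> exists c : nat -> R,
  (forall n, (0 < n)%N -> magnset n (c n)) /\ c n @[n --> \oo] --> a.
Proof.
move=> a1; pose x n := n%:R * ((1 + a) / 2).
have x0 n : 0 <= x n by rewrite mulr_ge0// divr_ge0//; lra.
exists (fun n => -1 + 2 * (Num.truncn (x n))%:R / n%:R); split.
  move=> n n0; exists (Num.truncn (x n)) => //.
  rewrite -(ler_nat R) (le_trans (y := x n))//; first by have /andP[] := truncn_itv (x0 n).
  by rewrite ler_piMr//; lra.
apply/cvgrPdist_lt => k k0; near=> n.
have n0 : 0 < n%:R :> R by rewrite ltr0n; near: n; exact: nbhs_infty_gt.
have nk : 2 / k < n%:R by near: n; exact: nbhs_infty_gtr.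
have /andP[] := truncn_itv (x0 n); rewrite -natr1.
move: (Num.truncn (x n))%:R => q q1 q2.
have -> : a - (-1 + 2 * q / n%:R) = 2 * (x n - q) / n%:R by rewrite /x; field; rewrite gt_eqF.
rewrite ger0_norm; last by rewrite divr_ge0 ?(ltW n0)// mulr_ge0//; lra.
rewrite ltr_pdivrMr//; move: nk; rewrite ltr_pdivrMr// => nk.
by rewrite [k * _]mulrC; lra.
Unshelve. all: by end_near.
Qed.

Lemma gamma_lim_unique a x0 b : -1 <= a <= 1 -> is_argmax (P a) x0 ->
  (forall x, is_argmax (P a) x -> x = x0) -> gamma_lim J h t b a (frac b x0).
Proof.
move=> a1 mx ux a_ am ca; apply/cvgrPdist_lt => k k0.
have [d d0 [n0 H]] := gamma_concentration J0 t0 b a1 mx ux k0.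
near=> n; rewrite distrC; apply: H; first by near: n; exact: nbhs_infty_ge.
- by near: n; exact: nbhs_infty_gt.
- by apply: am; near: n; exact: nbhs_infty_gt.
- by rewrite distrC; near: n; apply: (cvgrPdist_lt _ _).1.
Unshelve. all: by end_near.
Qed.

(** Convergence along all lattice sequences is uniform near the limit point:
    otherwise far values at arbitrarily close points, interpolated by a
    lattice sequence, form a single sequence without the limit. *)
Lemma gamma_lim_uniform a b l : -1 <= a <= 1 -> gamma_lim J h t b a l ->
  forall k, 0 < k -> exists2 d, 0 < d & exists n0 : nat, forall n a',
    (n0 <= n)%N -> (0 < n)%N -> magnset n a' -> `|a' - a| < d ->
    `|gamma J h t n b a' - l| < k.
Proof.
move=> a1 lim k k0; apply: contrapT => far.
have pick j : exists p : nat * R, [/\ (j <= p.1)%N, (0 < p.1)%N, magnset p.1 p.2,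
    `|p.2 - a| < j.+1%:R^-1 & k <= `|gamma J h t p.1 b p.2 - l|].
  apply: contrapT => H; apply: far; exists j.+1%:R^-1; first by rewrite invr_gt0.
  exists j => n a' jn n0 ma da; rewrite ltNge; apply/negP => kg.
  by apply: H; exists (n, a').
have [f fP] := choice pick.
have [c [cm cc]] := magnset_approx a1.
(* Several j may share the same size n; any of them will do. *)
pose g n := if pselect (exists j, (f j).1 = n) is left H then (f (sval (cid H))).2 else c n.
have gP n : (exists j, (f j).1 = n /\ g n = (f j).2) \/
    ((forall j, (f j).1 <> n) /\ g n = c n).
  rewrite /g; case: pselect => [H|H]; last first.
    by right; split=> // j jn; apply: H; exists j.
  by left; case: (cid H) => j jn /=; exists j.
have gm n : (0 < n)%N -> magnset n (g n).
  case: (gP n) => [[j [<- ->]] _|[_ ->]]; last exact: cm.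
  by have [] := fP j.
have gc : g n @[n --> \oo] --> a.
  apply/cvgrPdist_lt => r r0.
  pose K := (Num.truncn r^-1).+1; pose M := \max_(j < K) (f j).1.
  near=> n; case: (gP n) => [[j [jn ->]]|[_ ->]]; last first.
    by near: n; apply: (cvgrPdist_lt _ _).1.
  have Mn : (M < n)%N by near: n; exact: nbhs_infty_gt.
  have Kj : (K <= j)%N.
    rewrite leqNgt; apply/negP => jK; move: Mn; rewrite -jn ltnNge.
    by rewrite (leq_bigmax (F := fun j : 'I_K => (f j).1) (Ordinal jK)).
  have [_ _ _ H _] := fP j; rewrite distrC (lt_trans H)//.
  rewrite invf_plt ?posrE//; apply: (lt_le_trans (y := K%:R)).
    have ri : 0 <= r^-1 by rewrite invr_ge0 ltW.
    by have /andP[] := truncn_itv ri.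
  by rewrite ler_nat (leq_trans Kj).
have /cvgrPdist_lt/(_ k k0)[N _ HN] := lim g gm gc.
have [Nn _ _ _ _] := fP N.
have := HN (f N).1 Nn; rewrite /= distrC.
case: (gP (f N).1) => [[j [jn ->]]|[H _]]; last by case: (H N).
by rewrite -jn ltNge; have [_ _ _ _ ->] := fP j.
Unshelve. all: by end_near.
Qed.

(** Near a good magnetization, the limits at non-degenerate magnetizations,
    which are known explicitly, stay close to the limit. *)
Lemma gamma_lim_near a b l : -1 <= a <= 1 -> gamma_lim J h t b a l ->
  forall k, 0 < k -> exists2 d, 0 < d & forall a' x', -1 <= a' <= 1 ->
    `|a' - a| < d -> is_argmax (P a') x' -> (forall x, is_argmax (P a') x -> x = x') ->
    `|frac b x' - l| <= k.
Proof.
move=> a1 lim k k0; have [d d0 [n0 H]] := gamma_lim_uniform a1 lim k0.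
exists d => // a' x' a1' da mx ux.
have [c [cm cc]] := magnset_approx a1'.
have G := @gamma_lim_unique _ _ b a1' mx ux _ cm cc.
rewrite leNgt; apply/negP => kf.
near \oo => n.
have n_gt0 : (0 < n)%N by near: n; exact: nbhs_infty_gt.
have g1 : `|frac b x' - gamma J h t n b (c n)| < `|frac b x' - l| - k.
  by near: n; apply: (cvgrPdist_lt _ _).1 => //; rewrite subr_gt0.
have g2 : `|gamma J h t n b (c n) - l| < k.
  apply: H => //; [by near: n; exact: nbhs_infty_ge|exact: cm|].
  have c1 : `|a' - c n| < d - `|a' - a|.
    by near: n; apply: (cvgrPdist_lt _ _).1 => //; rewrite subr_gt0.
  by have := ler_distD a' (c n) a; rewrite [`|c n - a'|]distrC; lra.
by have := ler_distD (gamma J h t n b (c n)) (frac b x') l; lra.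
Unshelve. all: by end_near.
Qed.

Lemma not_degenerateP a x : ~ degenerate (eps t) J h a -> is_argmax (P a) x ->
  forall z, is_argmax (P a) z -> z = x.
Proof.
move=> nd mx z mz; have [zx|xz|//] := ltgtP z x; exfalso; apply: nd.
  by exists z, x.
by exists x, z.
Qed.

Lemma not_degenerate_unique a : -1 <= a <= 1 ->
  ~ degenerate (eps t) J h a <-> exists! m, is_argmax (P a) m.
Proof.
move=> a1; split.
  have [x mx] := Phi_max h (eps_itv t0) J0 a1.
  move=> nd; exists x; split=> // z mz; exact/esym/(not_degenerateP nd mx).
move=> [m [_ um]] [x [z [xz mx mz]]].
by move: xz; rewrite -(um _ mx) -(um _ mz) ltxx.
Qed.

(** At e = 1 the critical level is the identity: critical points are unique. *)
Lemma degenerate_lt1 a : degenerate (eps t) J h a -> eps t < 1.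
Proof.
have /andP[e0 e1] := eps_itv t0; rewrite lt_neqAle e1 andbT.
move=> [x [z [xz /(argmax_mean (eps_itv t0) J0) mx /(argmax_mean (eps_itv t0) J0) mz]]].
apply/eqP => E.
have := crit_levelP (eps_itv t0) mx; have := crit_levelP (eps_itv t0) mz.
rewrite /crit_level E; lra.
Qed.

Lemma gamma_continuous_degenerate b a0 : -1 <= a0 <= 1 ->
  ~ degenerate (eps t) J h a0 -> gamma_continuous_at J h t b a0.
Proof.
move=> a1 nd; have [d d0 H] := degenerate_isolated h (eps_itv t0) J0 a0.
near=> a => a01; have nda : ~ degenerate (eps t) J h a.
  have [->//|aa0] := eqVneq a a0; apply: H.
  rewrite normr_gt0 subr_eq0 aa0/= distrC; near: a; exact: nbhsx_ballx.
have [x mx] := Phi_max h (eps_itv t0) J0 a01.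
exists (frac b x); apply: gamma_lim_unique => //.
exact: not_degenerateP nda mx.
Unshelve. all: by end_near.
Qed.

(** On either side of a0 there are non-degenerate magnetizations arbitrarily
    close; by monotonicity their maximizers lie on the same side of those of
    a0. *)
Lemma argmax_right a0 x2 d : a0 < 1 -> -1 <= a0 -> is_argmax (P a0) x2 -> 0 < d ->
  exists a x, [/\ -1 <= a <= 1, `|a - a0| < d, is_argmax (P a) x,
    (forall z, is_argmax (P a) z -> z = x) & x2 <= x].
Proof.
move=> a01 a0m m2 d0; have [r r0 H] := degenerate_isolated h (eps_itv t0) J0 a0.
pose u := Num.min (Num.min d r) (1 - a0) / 2.
have [u0 [ud ur u1]] : 0 < u /\ [/\ u < d, u < r & u <= 1 - a0].
  rewrite /u /Num.min; do 2 case: ifPn; rewrite -?leNgt => *; split; try split; lra.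
have aa : -1 <= a0 + u <= 1 by lra.
have du : `|a0 + u - a0| = u by rewrite addrAC subrr add0r gtr0_norm.
have [x mx] := Phi_max h (eps_itv t0) J0 aa.
exists (a0 + u), x; split=> //; first by rewrite du.
  by apply: not_degenerateP mx; apply: H; rewrite du u0.
by apply: (argmax_mono (eps_itv t0) J0 _ m2 mx); rewrite ltrDl.
Qed.

Lemma argmax_left a0 x1 d : a0 <= 1 -> -1 < a0 -> is_argmax (P a0) x1 -> 0 < d ->
  exists a x, [/\ -1 <= a <= 1, `|a - a0| < d, is_argmax (P a) x,
    (forall z, is_argmax (P a) z -> z = x) & x <= x1].
Proof.
move=> a01 a0m m2 d0; have [r r0 H] := degenerate_isolated h (eps_itv t0) J0 a0.
pose u := Num.min (Num.min d r) (1 + a0) / 2.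
have [u0 [ud ur u1]] : 0 < u /\ [/\ u < d, u < r & u <= 1 + a0].
  rewrite /u /Num.min; do 2 case: ifPn; rewrite -?leNgt => *; split; try split; lra.
have aa : -1 <= a0 - u <= 1 by lra.
have du : `|a0 - u - a0| = u by rewrite addrAC subrr add0r normrN gtr0_norm.
have [x mx] := Phi_max h (eps_itv t0) J0 aa.
exists (a0 - u), x; split=> //; first by rewrite du.
  by apply: not_degenerateP mx; apply: H; rewrite du u0.
by apply: (argmax_mono (eps_itv t0) J0 _ mx m2); rewrite gtrBl.
Qed.

Lemma limit_kernel_le x z : x <= z -> frac true x <= frac true z.
Proof. by rewrite le_eqVlt => /predU1P[->//|/limit_kernel_mono/ltW]. Qed.

Lemma limit_kernel_sep b x1 x2 y1 y2 : y1 <= x1 -> x1 < x2 -> x2 <= y2 ->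
  frac true x2 - frac true x1 <= `|frac b y2 - frac b y1|.
Proof.
move=> /limit_kernel_le h1 /limit_kernel_mono h12 /limit_kernel_le h2.
by rewrite limit_kernel_dist ger0_norm; lra.
Qed.

(** A degenerate magnetization is bad: inside ]-1, 1[ the kernel has distinct
    one-sided limits; at an end point the one-sided limit differs from the
    value along the constant sequence, which is the limiting kernel at 0, a
    point strictly between the maximizers. *)
Lemma degenerate_gamma_lim b a0 l : -1 <= a0 <= 1 ->
  degenerate (eps t) J h a0 -> ~ gamma_lim J h t b a0 l.
Proof.
move=> a01 dg lim; have e1 := degenerate_lt1 dg.
have [x1 [x2 [x12 m1 m2]]] := dg.
have aligned sb : a0 = spin sb -> x1 < 0 < x2 /\ l = frac b 0.
  move=> E; move: m1 m2; rewrite E => m1' m2'.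
  have [x012 [r rE]] := degenerate_aligned J0 x12 e1 m1' m2'; split=> //.
  have cm n : (0 < n)%N -> magnset n (spin sb).
    move=> n0; have NR : n%:R != 0 :> R by rewrite pnatr_eq0 -lt0n.
    exists (if sb then n else 0%N); case: (sb); rewrite ?leqnn// /Defs.spin.
      by rewrite mulfK//; lra.
    by rewrite mulr0 mul0r addr0.
  rewrite E in lim; have L : gamma J h t n b (spin sb) @[n --> \oo] --> l.
    by apply: (lim (fun=> spin sb) cm); exact: cvg_cst.
  have L2 : gamma J h t n b (spin sb) @[n --> \oo] --> frac b 0.
    apply/cvgrPdist_lt => k k0; near=> n; rewrite (gamma_aligned J t0 b (n := n) _ rE) ?subrr ?normr0//.
    by near: n; exact: nbhs_infty_gt.
  exact: (cvg_unique _ L L2).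
have from_above k : 0 < k -> a0 < 1 -> exists2 x, x2 <= x & `|frac b x - l| <= k.
  move=> k0 a0l; have [d d0 H] := gamma_lim_near a01 lim k0.
  have [|a [x [a1 da mx ux xx]]] := argmax_right a0l _ m2 d0; first by lra.
  by exists x => //; exact: (H a).
have from_below k : 0 < k -> -1 < a0 -> exists2 x, x <= x1 & `|frac b x - l| <= k.
  move=> k0 a0r; have [d d0 H] := gamma_lim_near a01 lim k0.
  have [|a [x [a1 da mx ux xx]]] := argmax_left _ a0r m1 d0; first by lra.
  by exists x => //; exact: (H a).
have gap u v : u < v -> exists2 k, 0 < k & 4 * k = frac true v - frac true u.
  by move=> /limit_kernel_mono uv; exists ((frac true v - frac true u) / 4); lra.
have [a0E|a0l] := eqVneq a0 1.
  have [/andP[x10 _] lE] := aligned true a0E.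
  have [k k0 kE] := gap _ _ x10.
  have [|x xx] := from_below k k0; first by rewrite a0E; lra.
  have := limit_kernel_sep b xx x10 (lexx 0); rewrite lE distrC; lra.
have [a0E|a0r] := eqVneq a0 (-1).
  have [/andP[_ x20] lE] := aligned false a0E.
  have [k k0 kE] := gap _ _ x20.
  have [|x xx] := from_above k k0; first by rewrite a0E; lra.
  have := limit_kernel_sep b (lexx 0) x20 xx; rewrite lE; lra.
have [k k0 kE] := gap _ _ x12.
have [|y yy Hy] := from_above k k0; first by rewrite lt_neqAle a0l; lra.
have [|z zz Hz] := from_below k k0; first by rewrite lt_neqAle eq_sym a0r; lra.
have := limit_kernel_sep b zz x12 yy.
have := ler_distD l (frac b y) (frac b z); rewrite [`|l - _|]distrC; lra.
Unshelve. all: by end_near.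
Qed.

Lemma gamma_continuousP b a0 : -1 <= a0 <= 1 ->
  gamma_continuous_at J h t b a0 <-> exists! m, is_argmax (P a0) m.
Proof.
move=> a01; rewrite -not_degenerate_unique//; split; last exact: gamma_continuous_degenerate.
move=> /nbhs_singleton/(_ a01)[l lim] dg.
exact: (degenerate_gamma_lim a01 dg lim).
Qed.

End limits.

(** * The equivalence *)

Section dichotomy.
Variable R : realType.

(** The stationarity equation of the potential says that the optimal path
    issued from x starts at x. *)
Lemma argmax_start (J h t a x : R) : 0 < J -> 0 < t -> -1 <= a <= 1 ->
  is_argmax (Phi (eps t) J h a) x -> x = start t a (J * x + h).
Proof.
move=> J0 t0 a1 /(argmax_mean (eps_itv (ltW t0)) J0) {1}->.
set y := J * x + h.
have bP := opt_betaP y (eps01 t0) a1; have bN := opt_betaN y (eps01 t0) a1.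
have n0 := norm_const_gt0 y (eps01 t0) a1.
rewrite /mean /start -/y.
move: (opt_beta _ _ _) (norm_const _ _ _) bP bN n0 => b n bP bN n0.
have p0 : 0 < W (eps t) 1 y := W_spin_gt0 (ltW t0) y true.
have q0 : 0 < W (eps t) (- 1) y := W_spin_gt0 (ltW t0) y false.
move: (W _ 1 y) (W _ (- 1) y) p0 q0 bP bN => p q p0 q0 bP bN.
have aP : (1 + a) / p = (1 + b) / n by rewrite bP; field; rewrite !gt_eqF.
have aN : (1 - a) / q = (1 - b) / n by rewrite bN; field; rewrite !gt_eqF.
have -> u v : (1 + a) / 2 * (u / p) + (1 - a) / 2 * (v / q) =
    (1 + a) / p * (u / 2) + (1 - a) / q * (v / 2).
  by field; rewrite !gt_eqF.
by rewrite aP aN; field; rewrite gt_eqF.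
Qed.

Lemma paths_to_cst (t a : R) : -1 <= a <= 1 -> paths_to t a (cst a).
Proof.
move=> a1; split=> //; split=> [//|s _|s _]; first exact: cvg_cst.
by apply: is_cvg_cst.
Qed.

(** With no time to evolve, a path is a point and costs nothing. *)
Lemma rate0 (J h a : R) phi : paths_to 0 a phi -> rate J h 0 phi = (IS J h a)%:E.
Proof.
move=> [_ phi0]; rewrite /rate phi0 /ID asboolT; last first.
  move=> e e0; exists 1 => // n b c bc _ _.
  rewrite big1// => i _; have [b0 [bci c0]] := bc i.
  by have -> : c i = b i; [lra|rewrite subrr normr0].
by rewrite set_itv1 integral_set1 adde0.
Qed.

Lemma unique_path_minimizer0 (J h a : R) : -1 <= a <= 1 ->
  unique_path_minimizer J h 0 a.
Proof.
move=> a1; exists (cst a).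
  split; first exact: paths_to_cst.
  apply/eqP; rewrite eq_le; apply/andP; split.
    apply: le_ereal_inf_tmp => _ [phi pphi <-].
    by rewrite (rate0 J h pphi) (rate0 J h (paths_to_cst 0 a1)).
  by apply: ereal_inf_lbound; exists (cst a) => //; exact: paths_to_cst.
move=> psi [[_ psi0] _] s s0; have -> : s = 0 by lra.
exact: psi0.
Qed.

(** A magnetization other than a cannot be joined to a, and costs +oo. *)
Lemma unique_magn_minimizer0 (J h a : R) : -1 <= a <= 1 ->
  exists! m, magn_minimizer J h 0 a m.
Proof.
move=> a1.
have costE : cost J h 0 a a = (IS J h a)%:E.
  apply/eqP; rewrite eq_le; apply/andP; split.
    apply: ereal_inf_lbound; exists (cst a); last exact: rate0 (paths_to_cst 0 a1).
    by split=> //; exact: paths_to_cst.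
  by apply: le_ereal_inf_tmp => _ [phi [pphi _] <-]; rewrite (rate0 J h pphi).
have cost_oo m : m != a -> cost J h 0 a m = +oo%E.
  move=> ma; rewrite /cost [X in ereal_inf (_ @` X)](_ : _ = set0) ?image_set0 ?ereal_inf0//.
  by rewrite -subset0 => phi [[_ phia] phim]; move: ma; rewrite -phim phia eqxx.
have infE : ereal_inf (cost J h 0 a @` [set m | -1 <= m <= 1]) = (IS J h a)%:E.
  apply/eqP; rewrite eq_le; apply/andP; split.
    by rewrite -costE; apply: ereal_inf_lbound; exists a.
  apply: le_ereal_inf_tmp => _ [m _ <-].
  by have [->|/cost_oo->] := eqVneq m a; rewrite ?costE ?leey.
exists a; split; first by split=> //; rewrite costE infE.
move=> m [_]; have [//|/cost_oo->] := eqVneq m a.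
by rewrite infE.
Qed.

Lemma gamma_continuous0 (J h a : R) b : 0 < J -> -1 <= a <= 1 ->
  gamma_continuous_at J h 0 b a.
Proof.
move=> J0 a1; apply: gamma_continuous_degenerate => // /degenerate_lt1.
by rewrite /eps mulr0 oppr0 expR0 ltxx => /(_ J0 (lexx 0)).
Qed.

End dichotomy.

Theorem theorem1 (R : realType) (J h t a0 : R) (sigma : bool)
  (J_gt0 : 0 < J) (t_ge0 : 0 <= t) (a0_itv : -1 <= a0 <= 1) :
  (gamma_continuous_at J h t sigma a0 <-> unique_path_minimizer J h t a0) /\
  (gamma_continuous_at J h t sigma a0 <->
     exists! m : R, magn_minimizer J h t a0 m).
Proof.
have [t0|t0] := eqVneq t 0.
  rewrite t0; have g := gamma_continuous0 h sigma J_gt0 a0_itv.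
  have u := unique_path_minimizer0 J h a0_itv.
  by have v := unique_magn_minimizer0 J h a0_itv; split.
have {t0}t_gt0 : 0 < t by rewrite lt_neqAle eq_sym t0.
have crit x := @argmax_start R J h t a0 x J_gt0 t_gt0 a0_itv.
have mx := Phi_max h (eps_itv t_ge0) J_gt0 a0_itv.
have magnE : magn_minimizer J h t a0 = is_argmax (Phi (eps t) J h a0).
  by apply/funext => m; apply/propext; exact: magn_minimizerP.
rewrite (gamma_continuousP h J_gt0 t_ge0 sigma a0_itv) magnE.
by rewrite (unique_path_minimizerP t_gt0 a0_itv crit mx).
Qed.
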